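(* (GBC) For any class forcing notion $\mathbb P$ and any finitely many class names $\dot\Gamma_0,\ldots,\dot\Gamma_m$, the following are equivalent: (i) $\mathbb P$ admits a uniform forcing relation for the first-order forcing language $\mathcal L_{\omega,\omega}(\in,\dot\Gamma_0,\ldots,\dot\Gamma_m)$; (ii) there is a class name $\dot{\mathbb T}$ and a forcing relation defined on the statement ''$\dot{\mathbb T}$ is a truth predicate for $\mathcal L_{\omega,\omega}(\in,\dot\Gamma_0,\ldots,\dot\Gamma_m)$'' for which $\mathbb 1\Vdash$ ''$\dot{\mathbb T}$ is a truth predicate for $\mathcal L_{\omega,\omega}(\in,\dot\Gamma_0,\ldots,\dot\Gamma_m)$''.
   Context: A class forcing notion is a separative class pre-order $\mathbb P$ with top $\mathbb 1$; a class name is a class of pairs $\langle\rho,p\rangle$ with $\rho$ a $\mathbb P$-name and $p\in\mathbb P$. The first-order forcing language has $\in$, all $\mathbb P$-names as constants, and predicate symbols for the $\dot\Gamma_i$. A uniform forcing relation for this language is a single relation $\Vdash$ defined on all its formulas with: $p\Vdash\sigma\in\tau$ iff densely many $q\le p$ have $\langle\rho,r\rangle\in\tau$ with $q\le r$, $q\Vdash\sigma=\rho$; $p\Vdash\sigma=\tau$ iff $p\Vdash\sigma\subseteq\tau$ and $p\Vdash\tau\subseteq\sigma$, where $p\Vdash\sigma\subseteq\tau$ iff whenever $\langle\rho,r\rangle\in\sigma$ and $q'\le p,r$ there is $q\le q'$ with $q\Vdash\rho\in\tau$; $p\Vdash\sigma\in\dot\Gamma$ iff densely many $q\le p$ have $\langle\tau,r\rangle\in\dot\Gamma$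 with $q\le r$, $q\Vdash\sigma=\tau$; $p\Vdash\varphi\wedge\psi$ iff both; $p\Vdash\neg\varphi$ iff no $q\le p$ forces $\varphi$; $p\Vdash\forall x\varphi(x)$ iff $p\Vdash\varphi(\tau)$ for all names $\tau$. (A forcing relation defined on a particular statement means one defined on a subformula-closed collection containing it and all atomic formulas, satisfying these clauses.) A truth predicate for a first-order language with predicates $\Gamma_i$ is a class $\mathbb T$ of pairs $\langle\varphi,\vec a\rangle$ ($\vec a$ a valuation of the free variables) such that: atomic formulas ($=$, $\in$, $\in\Gamma_i$) are judged correctly; $\mathbb T(\varphi\wedge\psi,\vec a)$ iff $\mathbb T(\varphi,\vec a)$ and $\mathbb T(\psi,\vec a)$; $\mathbb T(\neg\varphi,\vec a)$ iff not $\mathbb T(\varphi,\vec a)$; $\mathbb T(\forall x\varphi,\vec a)$ iff $\mathbb T(\varphi,b^\frown\vec a)$ for all $b$. *)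

(* Defs.v *)
From mathcomp Require Import all_boot.
From Stdlib Require Import Classical.

Set Implicit Arguments.
Unset Strict Implicit.
Unset Printing Implicit Defensive.

(** Set-theoretic notions are written once, over an abstract [logic], and used
    in two ways: read inside a class structure, where they are propositions
    about its sets ([sem], [sets]), and as formal first-order formulas
    ([syn]), which is what the forcing language talks about. *)

Record logic := Logic {
  tm : Type;
  fo : Type;
  l_eq : tm -> tm -> fo;
  l_mem : tm -> tm -> fo;
  l_pred : nat -> tm -> fo;
  l_and : fo -> fo -> fo;
  l_or : fo -> fo -> fo;
  l_imp : fo -> fo -> fo;
  l_iff : fo -> fo -> fo;
  l_not : fo -> fo;
  l_all : (tm -> fo) -> fo;
  l_ex : (tm -> fo) -> fo }.

Declare Scope logic_scope.
Delimit Scope logic_scope with L.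
Notation "x =' y" := (l_eq x y) (at level 70) : logic_scope.
Notation "x \e y" := (l_mem x y) (at level 70) : logic_scope.
Notation "A /\' B" := (l_and A B) (at level 80, right associativity) : logic_scope.
Notation "A \/' B" := (l_or A B) (at level 85, right associativity) : logic_scope.
Notation "A ->' B" := (l_imp A B) (at level 99, right associativity, B at level 200)
  : logic_scope.
Notation "A <->' B" := (l_iff A B) (at level 95, no associativity) : logic_scope.
Notation "~' A" := (l_not A) (at level 75, right associativity) : logic_scope.
Notation "\all x .. y , A" := (l_all (fun x => .. (l_all (fun y => A)) ..))
  (at level 200, x binder, y binder, right associativity) : logic_scope.
Notation "\ex x .. y , A" := (l_ex (fun x => .. (l_ex (fun y => A)) ..))
  (at level 200, x binder, y binder, right associativity) : logic_scope.

(** First-order formulas with membership and unary predicate symbols indexed by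
    [nat]; variables are de Bruijn indices. *)
Inductive fm : Type :=
| FEq of nat & nat
| FMem of nat & nat
| FPred of nat & nat
| FAnd of fm & fm
| FNot of fm
| FAll of fm.

Definition scons {V : Type} (b : V) (rho : nat -> V) (i : nat) : V :=
  if i is j.+1 then rho j else b.

Fixpoint sat {V : Type} (E : V -> V -> Prop) (X : nat -> V -> Prop)
    (f : fm) (rho : nat -> V) : Prop :=
  match f with
  | FEq i j => rho i = rho j
  | FMem i j => E (rho i) (rho j)
  | FPred k i => X k (rho i)
  | FAnd g h => sat E X g rho /\ sat E X h rho
  | FNot g => ~ sat E X g rho
  | FAll g => forall b, sat E X g (scons b rho)
  end.

Definition sem (V : Type) (E : V -> V -> Prop) (X : nat -> V -> Prop) : logic :=
  @Logic V Prop eq E X and or (fun A B => A -> B) iff not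
    (fun A => forall x, A x) (fun A => exists x, A x).

(** A syntactic term is the level at which its variable was bound, and a
    syntactic formula is a formula depending on the number [d] of binders
    above it, so level [l] has de Bruijn index [d - l.+1].  The connectives that
    are not primitive in [fm] are the usual abbreviations. *)
Section Syntax.
Let F := nat -> fm.
Let fand (A B : F) : F := fun d => FAnd (A d) (B d).
Let fnot (A : F) : F := fun d => FNot (A d).
Let fall (A : nat -> F) : F := fun d => FAll (A d d.+1).
Let fimp (A B : F) : F := fnot (fand A (fnot B)).

Definition syn : logic :=
  @Logic nat F
    (fun x y d => FEq (d - x.+1) (d - y.+1))
    (fun x y d => FMem (d - x.+1) (d - y.+1))
    (fun k x d => FPred k (d - x.+1))
    fand
    (fun A B => fnot (fand (fnot A) (fnot B)))
    fimp
    (fun A B => fand (fimp A B) (fimp B A))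
    fnot
    fall
    (fun A => fnot (fall (fun x => fnot (A x)))).
End Syntax.

Section SetNotions.
Local Open Scope logic_scope.
Context {L : logic}.
Implicit Types x y z a b c n : tm L.

Definition is_empty x := \all w, ~' (w \e x).
Definition is_subset x y := \all w, w \e x ->' w \e y.
Definition is_succ y x := \all w, w \e y <->' (w \e x \/' w =' x).
Definition is_upair z x y := \all w, w \e z <->' (w =' x \/' w =' y).

Definition is_pair z x y :=
  \ex u v, is_upair u x x /\' is_upair v x y /\' is_upair z u v.

Definition is_trans x := \all y, y \e x ->' is_subset y x.

Definition zero_or_succ x := is_empty x \/' (\ex j, is_succ x j).

(** Natural numbers are the ordinals such that they and all their members are
    zero or a successor. *)
Definition is_nat n :=
  is_trans n /\' zero_or_succ n /\'
  (\all k, k \e n ->' (is_trans k /\' zero_or_succ k)).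

Fixpoint is_num (k : nat) x : fo L :=
  if k is k'.+1 then \ex y, is_num k' y /\' is_succ x y else is_empty x.

Definition at_ a i x := \ex z, is_pair z i x /\' z \e a.

(** [a] is a sequence of length [n], i.e. a function with domain the natural
    number [n]. *)
Definition is_seq a n :=
  is_nat n /\'
  (\all z, z \e a ->' \ex i x, i \e n /\' is_pair z i x) /\'
  (\all i, i \e n ->' \ex x, at_ a i x) /\'
  (\all i x y, at_ a i x ->' at_ a i y ->' x =' y).

(** [c] is [a] with [b] put in front. *)
Definition is_cons c b a :=
  \ex n n', is_seq a n /\' is_succ n' n /\' is_seq c n' /\'
    (\ex o, is_empty o /\' at_ c o b) /\'
    (\all i, i \e n ->' \ex j x, is_succ j i /\' at_ a i x /\' at_ c j x).

Fixpoint any_below (k : nat) (A : nat -> fo L) : fo L :=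
  if k is k'.+1 then any_below k' A \/' A k' else \ex x, ~' (x =' x).

Fixpoint all_below (k : nat) (A : nat -> fo L) : fo L :=
  if k is k'.+1 then all_below k' A /\' A k' else \all x, x =' x.

(** Coding of formulas by sets, with de Bruijn indices: equality, membership,
    predicate (index of the symbol, then variable), conjunction, negation and
    universal quantification carry the tags 0, ..., 5. *)
Definition is_node (t : nat) c x y :=
  \ex o w, is_num t o /\' is_pair w x y /\' is_pair c o w.

Definition c_eq c i j := is_node 0 c i j.
Definition c_mem c i j := is_node 1 c i j.
Definition c_pred (k : nat) c i := \ex p, is_num k p /\' is_node 2 c p i.
Definition c_and c f g := is_node 3 c f g.
Definition c_not c f := is_node 4 c f f.
Definition c_all c f := is_node 5 c f f.

(** [f] codes a formula in the language with the predicate symbols [0 .. k-1]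
    and all of its free variables are below [n].  The set [s] is closed under
    passing to immediate subformulas. *)
Definition is_formula (k : nat) f n :=
  \ex s, (\ex e, is_pair e f n /\' e \e s) /\'
  \all e, e \e s ->' \ex c l, is_pair e c l /\' is_nat l /\'
    ((\ex i j, i \e l /\' j \e l /\' c_eq c i j) \/'
     (\ex i j, i \e l /\' j \e l /\' c_mem c i j) \/'
     any_below k (fun p => \ex i, i \e l /\' c_pred p c i) \/'
     (\ex g h e1 e2, c_and c g h /\' is_pair e1 g l /\' e1 \e s /\'
        is_pair e2 h l /\' e2 \e s) \/'
     (\ex g e1, c_not c g /\' is_pair e1 g l /\' e1 \e s) \/'
     (\ex g l' e1, c_all c g /\' is_succ l' l /\' is_pair e1 g l' /\' e1 \e s)).

(** The predicate symbol [k] is a truth predicate for the language with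
    membership and the predicate symbols [0 .. k-1]. *)
Definition truth_predicate (k : nat) : fo L :=
  let T c a := \ex z, is_pair z c a /\' l_pred k z in
  let inst c a := \ex n, is_seq a n /\' is_formula k c n in
  (\all z, l_pred k z ->' \ex c a, is_pair z c a /\' inst c a) /\'
  (\all c a i j x y, inst c a ->' c_eq c i j ->' at_ a i x ->' at_ a j y ->'
     (T c a <->' x =' y)) /\'
  (\all c a i j x y, inst c a ->' c_mem c i j ->' at_ a i x ->' at_ a j y ->'
     (T c a <->' x \e y)) /\'
  all_below k (fun p => \all c a i x, inst c a ->' c_pred p c i ->' at_ a i x ->'
     (T c a <->' l_pred p x)) /\'
  (\all c f g a, inst c a ->' c_and c f g ->' (T c a <->' (T f a /\' T g a))) /\'
  (\all c f a, inst c a ->' c_not c f ->' (T c a <->' ~' T f a)) /\'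
  (\all c f a, inst c a ->' c_all c f ->'
     (T c a <->' \all b, \ex a', is_cons a' b a /\' T f a')).

End SetNotions.

Definition truth_statement (k : nat) : fm := @truth_predicate syn k 0.

(** The formal statement means what [truth_predicate] says when read directly. *)
Section Adequacy.
Variables (V : Type) (E : V -> V -> Prop) (X : nat -> V -> Prop).
Let S := sem E X.

Let tmr (d : nat) (rho : nat -> V) (l : tm syn) (x : tm S) :=
  (l < d)%N /\ rho (d - l.+1) = x.
Let rep (d : nat) (rho : nat -> V) (f : fo syn) (A : fo S) :=
  sat E X (f d) rho <-> A.

Let tmr0 d rho x : tmr d.+1 (scons x rho) d x.
Proof. by split; rewrite // subSS subnn. Qed.

Let tmrS d rho l x y : tmr d rho l x -> tmr d.+1 (scons y rho) l x.
Proof. by case=> ld <-; split; [exact: ltnW | rewrite subSn]. Qed.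

Let rep_eq d rho l m x y : tmr d rho l x -> tmr d rho m y ->
  rep d rho (l_eq l m) (l_eq x y).
Proof. by case=> _ <- [_ <-]. Qed.

Let rep_mem d rho l m x y : tmr d rho l x -> tmr d rho m y ->
  rep d rho (l_mem l m) (l_mem x y).
Proof. by case=> _ <- [_ <-]. Qed.

Let rep_pred d rho k l x : tmr d rho l x -> rep d rho (l_pred k l) (l_pred k x).
Proof. by case=> _ <-. Qed.

Let rep_and d rho f g A B : rep d rho f A -> rep d rho g B ->
  rep d rho (l_and f g) (l_and A B).
Proof. by rewrite /rep /=; tauto. Qed.

Let rep_or d rho f g A B : rep d rho f A -> rep d rho g B ->
  rep d rho (l_or f g) (l_or A B).
Proof. by rewrite /rep /=; have := classic A; have := classic B; tauto. Qed.

Let rep_imp d rho f g A B : rep d rho f A -> rep d rho g B ->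
  rep d rho (l_imp f g) (l_imp A B).
Proof. by rewrite /rep /=; have := classic B; tauto. Qed.

Let rep_iff d rho f g A B : rep d rho f A -> rep d rho g B ->
  rep d rho (l_iff f g) (l_iff A B).
Proof. by rewrite /rep /=; have := classic A; have := classic B; tauto. Qed.

Let rep_not d rho f A : rep d rho f A -> rep d rho (l_not f) (l_not A).
Proof. by rewrite /rep /=; tauto. Qed.

Let rep_all d rho (f : tm syn -> fo syn) (A : tm S -> fo S) :
  (forall x, rep d.+1 (scons x rho) (f d) (A x)) ->
  rep d rho (l_all f) (l_all A).
Proof. by rewrite /rep /= => h; split=> H x; apply/h. Qed.

Let rep_ex d rho (f : tm syn -> fo syn) (A : tm S -> fo S) :
  (forall x, rep d.+1 (scons x rho) (f d) (A x)) ->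
  rep d rho (l_ex f) (l_ex A).
Proof.
rewrite /rep /= => h; split=> [H|[x Ax] H]; last by apply: (H x); apply/h.
by apply: NNPP => nA; apply: H => x fx; apply: nA; exists x; apply/h.
Qed.

Ltac rep_step := lazymatch goal with
  | |- rep _ _ (l_and _ _) _ => apply: rep_and
  | |- rep _ _ (l_or _ _) _ => apply: rep_or
  | |- rep _ _ (l_imp _ _) _ => apply: rep_imp
  | |- rep _ _ (l_iff _ _) _ => apply: rep_iff
  | |- rep _ _ (l_not _) _ => apply: rep_not
  | |- rep _ _ (l_all _) _ => apply: rep_all => ?
  | |- rep _ _ (l_ex _) _ => apply: rep_ex => ?
  | |- rep _ _ (l_eq _ _) _ => apply: rep_eq
  | |- rep _ _ (l_mem _ _) _ => apply: rep_mem
  | |- rep _ _ (l_pred _ _) _ => apply: rep_pred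
  | |- tmr _ _ _ _ => first [assumption | apply: tmr0 | apply: tmrS]
  end.
Ltac rep_tac := cbv beta; repeat rep_step.

Let rep_num d rho k l x : tmr d rho l x -> rep d rho (is_num k l) (is_num k x).
Proof.
elim: k d rho l x => [|k IH] d rho l x h; cbn [is_num];
  first by rewrite /is_empty; rep_tac.
by apply: rep_ex => y; apply: rep_and; [apply: IH; rep_tac | rewrite /is_succ; rep_tac].
Qed.

Let rep_any d rho k f A : (forall i, rep d rho (f i) (A i)) ->
  rep d rho (any_below k f) (any_below k A).
Proof. by move=> h; elim: k => [|k IH]; cbn [any_below]; [rep_tac | apply: rep_or]. Qed.

Let rep_allb d rho k f A : (forall i, rep d rho (f i) (A i)) ->
  rep d rho (all_below k f) (all_below k A).
Proof. by move=> h; elim: k => [|k IH]; cbn [all_below]; [rep_tac | apply: rep_and]. Qed.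

Let rep_pair d rho l m n x y z : tmr d rho l x -> tmr d rho m y -> tmr d rho n z ->
  rep d rho (is_pair l m n) (is_pair x y z).
Proof. by move=> *; rewrite /is_pair /is_upair; rep_tac. Qed.

Ltac rep_step' := lazymatch goal with
  | |- rep _ _ (is_num _ _) _ => apply: rep_num
  | |- rep _ _ (is_pair _ _ _) _ => apply: rep_pair
  | |- rep _ _ (any_below _ _) _ => apply: rep_any => ?
  | |- rep _ _ (all_below _ _) _ => apply: rep_allb => ?
  | |- _ => rep_step
  end.

Lemma truth_statementP k rho :
  sat E X (truth_statement k) rho <-> @truth_predicate S k.
Proof.
change (rep 0 rho (truth_predicate k) (truth_predicate k)).
rewrite /truth_predicate /is_formula /is_cons /c_eq /c_mem /c_pred /c_and /c_not
  /c_all /is_node /is_seq /at_ /is_nat /zero_or_succ /is_trans /is_subset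
  /is_succ /is_empty.
by cbv beta; repeat rep_step'.
Qed.

End Adequacy.

(** A two-sorted structure; its classes are identified with their extensions. *)
Record class_structure := ClassStructure {
  carrier :> Type;
  cs_mem : carrier -> carrier -> Prop;
  cs_class : (carrier -> Prop) -> Prop }.

Canonical sets (M : class_structure) : logic :=
  Eval hnf in sem (@cs_mem M) (fun _ _ => False).

Section InStructure.
Variable M : class_structure.
Local Notation mem := (@cs_mem M).
Implicit Types (x y z a b c p q r : M) (R : M -> Prop).

Definition rel2 R x y := exists z, is_pair z x y /\ R z.
Definition rel3 R x y z := exists w, is_pair w y z /\ rel2 R x w.

Record GBC : Prop := {
  gbc_ext : forall x y, (forall z, mem z x <-> mem z y) -> x = y;
  gbc_foundation : forall R, cs_class R -> (exists x, R x) ->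
    exists x, R x /\ forall y, mem y x -> ~ R y;
  gbc_pairing : forall x y, exists z, is_upair z x y;
  gbc_union : forall x, exists u, forall z,
    mem z u <-> exists y, mem y x /\ mem z y;
  gbc_power : forall x, exists u, forall z, mem z u <-> is_subset z x;
  gbc_infinity : exists w, (exists o, is_empty o /\ mem o w) /\
    forall x, mem x w -> exists y, is_succ y x /\ mem y w;
  gbc_replacement : forall R, cs_class R ->
    (forall x y y', rel2 R x y -> rel2 R x y' -> y = y') ->
    forall a, exists b, forall y, mem y b <-> exists x, mem x a /\ rel2 R x y;
  gbc_comprehension : forall (f : fm) (rho : nat -> M) (X : nat -> M -> Prop),
    (forall i, cs_class (X i)) ->
    cs_class (fun x => sat mem X f (scons x rho));
  gbc_choice : exists R, cs_class R /\
    (forall x y y', rel2 R x y -> rel2 R x y' -> y = y') /\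
    (forall x, (exists y, mem y x) -> exists y, mem y x /\ rel2 R x y) }.

Section Forcing.
Variables (P Le : M -> Prop) (one : M).
Local Notation le := (rel2 Le).

Record class_forcing_notion : Prop := {
  cf_class : cs_class P;
  cf_le_class : cs_class Le;
  cf_le_dom : forall p q, le p q -> P p /\ P q;
  cf_refl : forall p, P p -> le p p;
  cf_trans : forall p q r, le p q -> le q r -> le p r;
  cf_one : P one;
  cf_top : forall p, P p -> le p one;
  cf_separative : forall p q, P p -> P q -> ~ le p q ->
    exists r, le r p /\ ~ exists s, le s r /\ le s q }.

(** A name is defined by recursion inside [M]; membership in a set closed
    under constituents expresses this correctly even if [M] is ill-founded. *)
Definition is_name x := exists s, mem x s /\
  forall y, mem y s -> forall z, mem z y ->
    exists u p, is_pair z u p /\ mem u s /\ P p.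

Definition class_name R := cs_class R /\
  forall z, R z -> exists u p, is_pair z u p /\ is_name u /\ P p.

Definition name_seq a :=
  (exists n, is_seq a n) /\ forall i x, at_ a i x -> is_name x.

(** Sentences of the forcing language with [k] predicate symbols: a pair of a
    (code of a) formula and a sequence of names, the latter being the constants
    that are substituted for the free variables. *)
Definition sentence (k : nat) c a :=
  name_seq a /\ exists n, is_seq a n /\ is_formula k c n.

Fixpoint codes c (f : fm) : Prop :=
  match f with
  | FEq i j => exists u v : M, is_num i u /\ is_num j v /\ c_eq c u v
  | FMem i j => exists u v : M, is_num i u /\ is_num j v /\ c_mem c u v
  | FPred k i => exists u : M, is_num i u /\ c_pred k c u
  | FAnd g h => exists u v : M, codes u g /\ codes v h /\ c_and c u v
  | FNot g => exists u : M, codes u g /\ c_not c u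
  | FAll g => exists u : M, codes u g /\ c_all c u
  end.

Fixpoint is_list a (l : seq M) : Prop :=
  if l is x :: l' then exists a', is_list a' l' /\ is_cons a x a' else is_empty a.

Definition dense_below p (A : M -> Prop) :=
  forall p', le p' p -> exists q, le q p' /\ A q.

Section Clauses.
Variables (k : nat) (G : nat -> M -> Prop) (D : M -> M -> Prop) (F : M -> Prop).
Local Notation "p ||- c [ a ]" := (rel3 F p c a) (at level 70, c at next level).

Definition forces p (f : fm) (l : seq M) :=
  exists c a, codes c f /\ is_list a l /\ p ||- c [a].

Definition forces_eq p x y := forces p (FEq 0 1) [:: x; y].
Definition forces_mem p x y := forces p (FMem 0 1) [:: x; y].

Definition forces_sub p x y := forall u r q', rel2 (fun z => mem z x) u r ->
  le q' p -> le q' r -> exists q, le q q' /\ forces_mem q u y.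

(** [F], as a class of triples (condition, formula, sequence of names), is a
    forcing relation on the collection [D] of sentences of the forcing language
    whose predicate symbols [0 .. k-1] are interpreted by the class names [G]. *)
Record forcing_relation_on : Prop := {
  fr_sentences : forall c a, D c a -> sentence k c a;
  fr_atomic : forall c a, sentence k c a ->
    (exists i j : M, c_eq c i j \/ c_mem c i j) \/
    (exists n (i : M), n < k /\ c_pred n c i) -> D c a;
  fr_sub_and : forall c f g a, D c a -> c_and c f g -> D f a /\ D g a;
  fr_sub_not : forall c f a, D c a -> c_not c f -> D f a;
  fr_sub_all : forall c f a x a', D c a -> c_all c f -> is_name x ->
    is_cons a' x a -> D f a';
  fr_mem : forall c a i j x y, D c a -> c_mem c i j -> at_ a i x -> at_ a j y ->
    forall p, P p -> (p ||- c [a] <-> dense_below p (fun q =>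
      exists u r, rel2 (fun z => mem z y) u r /\ le q r /\ forces_eq q x u));
  fr_eq : forall c a i j x y, D c a -> c_eq c i j -> at_ a i x -> at_ a j y ->
    forall p, P p -> (p ||- c [a] <-> forces_sub p x y /\ forces_sub p y x);
  fr_pred : forall c a n i x, D c a -> n < k -> c_pred n c i -> at_ a i x ->
    forall p, P p -> (p ||- c [a] <-> dense_below p (fun q =>
      exists u r, rel2 (G n) u r /\ le q r /\ forces_eq q x u));
  fr_and : forall c f g a, D c a -> c_and c f g ->
    forall p, P p -> (p ||- c [a] <-> p ||- f [a] /\ p ||- g [a]);
  fr_not : forall c f a, D c a -> c_not c f ->
    forall p, P p -> (p ||- c [a] <-> ~ exists q, le q p /\ q ||- f [a]);
  fr_all : forall c f a, D c a -> c_all c f ->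
    forall p, P p -> (p ||- c [a] <->
      forall x a', is_name x -> is_cons a' x a -> p ||- f [a']) }.

End Clauses.

Definition admits_uniform_forcing (k : nat) (G : nat -> M -> Prop) :=
  exists F, cs_class F /\ forcing_relation_on k G (sentence k) F.

Definition forcing_relation_for (k : nat) (G : nat -> M -> Prop) (f : fm)
    (F : M -> Prop) :=
  cs_class F /\ exists D, cs_class D /\ forcing_relation_on k G (rel2 D) F /\
    exists c a, codes c f /\ is_list a [::] /\ rel2 D c a.

End Forcing.
End InStructure.

Definition add_pred (V : Type) (k : nat) (G : nat -> V -> Prop) (T : V -> Prop)
    (i : nat) : V -> Prop :=
  if i == k then T else G i.

(* Main.v *)
(** Given a uniform forcing relation, let [T] consist of the pairs <op(phi-check, a), p>
    with [p] forcing [phi(a)], where op(phi-check, a) names the pair of the formula [phi]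
    and the sequence with the names in [a] as entries.  Below any condition forcing that
    [c] codes a formula and [a] is a valuation for it, densely many conditions decide [c]
    to be some phi-check and [a] to be named by a sequence of names of the ground model
    (epsilon-induction on names, and induction on the length); so the Tarski clauses of
    [T] reduce to the clauses of the given relation.  Conversely, if [T] is forced to be
    a truth predicate, then "[p] forces that op(phi-check, a) is in [T]" is a uniform
    forcing relation, because the forced Tarski clauses are its defining clauses.

    There are no generic extensions, as the class structure may be ill-founded.  Forced
    statements are manipulated directly: a forced formula denotes a regular open class of
    conditions, and is reasoned about by Kripke-Joyal semantics with names as terms. *)

Require Import Defs.
From mathcomp Require Import all_boot.
From Stdlib Require Import Classical ClassicalEpsilon FunctionalExtensionality PropExtensionality.

Set Implicit Arguments.
Unset Strict Implicit.
Unset Printing Implicit Defensive.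

Existing Class GBC.

(** * Definability *)

Fixpoint fm_ren (s u : nat -> nat) (f : fm) : fm :=
  match f with
  | FEq i j => FEq (u i) (u j)
  | FMem i j => FMem (u i) (u j)
  | FPred k i => FPred (s k) (u i)
  | FAnd g h => FAnd (fm_ren s u g) (fm_ren s u h)
  | FNot g => FNot (fm_ren s u g)
  | FAll g => FAll (fm_ren s (fun i => if i is j.+1 then (u j).+1 else 0) g)
  end.

Lemma sat_ren (V : Type) (E : V -> V -> Prop) (X : nat -> V -> Prop) s f :
  forall u r, sat E X (fm_ren s u f) r <->
    sat E (fun k => X (s k)) f (fun i => r (u i)).
Proof.
elim: f => [i j|i j|k i|g IHg h IHh|g IH|g IH] u r //=.
- by rewrite IHg IHh.
- by rewrite IH.
- have e b : (fun i => scons b r (if i is j.+1 then (u j).+1 else 0)) =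
      scons b (fun i => r (u i)).
    by apply: functional_extensionality => -[|i].
  by split=> H b; move: (H b); rewrite IH e.
Qed.

Section Definability.
Context {M : class_structure}.
Local Notation mem := (@cs_mem M).
Implicit Types (A B : (nat -> M) -> Prop) (t u : (nat -> M) -> M).

Definition dfn A := exists f (X : nat -> M -> Prop),
  (forall i, cs_class (X i)) /\ forall r, A r <-> sat mem X f r.

Definition trm t := dfn (fun r => r 0 = t (fun i => r i.+1)).

Definition def1 (R : M -> Prop) := dfn (fun r => R (r 0)).
Definition def2 (R : M -> M -> Prop) := dfn (fun r => R (r 0) (r 1)).
Definition def3 (R : M -> M -> M -> Prop) := dfn (fun r => R (r 0) (r 1) (r 2)).
Definition def4 (R : M -> M -> M -> M -> Prop) :=
  dfn (fun r => R (r 0) (r 1) (r 2) (r 3)).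
Definition fun1 (f : M -> M) := def2 (fun z x => z = f x).
Definition fun2 (f : M -> M -> M) := def3 (fun z x y => z = f x y).

Context {hM : GBC M}.

Lemma cls_ext (R S : M -> Prop) :
  (forall x, R x <-> S x) -> cs_class R -> cs_class S.
Proof.
move=> h; suff -> : R = S by [].
by apply: functional_extensionality => x; apply: propositional_extensionality.
Qed.

Lemma dfn_ext A B : (forall r, A r <-> B r) -> dfn A -> dfn B.
Proof. by move=> h [f [X [cX H]]]; exists f, X; split=> // r; rewrite -h H. Qed.

Lemma some_class : exists R : M -> Prop, cs_class R.
Proof. by have [R [cR _]] := gbc_choice hM; exists R. Qed.

Lemma cls_dfn (R : M -> Prop) : def1 R -> cs_class R.
Proof.
case=> f [X [cX H]]; have [x0|nx] := classic (exists x : M, True); last first.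
  have [S cS] := some_class; apply: cls_ext cS => x.
  by case: nx; exists x.
case: x0 => x0 _.
apply: cls_ext (gbc_comprehension hM f (fun _ => x0) cX) => x.
by rewrite -(H (scons x (fun _ => x0))).
Qed.

Lemma dfn_ren v A : dfn A -> dfn (fun r => A (fun i => r (v i))).
Proof.
case=> f [X [cX H]]; exists (fm_ren id v f), X; split=> // r.
by rewrite H sat_ren.
Qed.

Lemma dfn_not A : dfn A -> dfn (fun r => ~ A r).
Proof. by case=> f [X [cX H]]; exists (FNot f), X; split=> // r /=; rewrite H. Qed.

Lemma dfn_and A B : dfn A -> dfn B -> dfn (fun r => A r /\ B r).
Proof.
case=> f [X [cX H]] [g [Y [cY K]]].
exists (FAnd (fm_ren double id f) (fm_ren (fun i => i.*2.+1) id g)).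
exists (fun i => if odd i then Y i./2 else X i./2); split=> [i|r /=].
  by case: ifP.
rewrite !sat_ren H K.
have -> : (fun k => if odd k.*2 then Y k.*2./2 else X k.*2./2) = X.
  by apply: functional_extensionality => i; rewrite odd_double doubleK.
have -> : (fun k => if odd k.*2.+1 then Y k.*2.+1./2 else X k.*2.+1./2) = Y.
  apply: functional_extensionality => i.
  by rewrite oddS odd_double /= uphalf_double.
by [].
Qed.

Lemma dfn_or A B : dfn A -> dfn B -> dfn (fun r => A r \/ B r).
Proof.
move=> hA hB; apply: dfn_ext (dfn_not (dfn_and (dfn_not hA) (dfn_not hB))) => r.
by have := classic (A r); have := classic (B r); tauto.
Qed.

Lemma dfn_imp A B : dfn A -> dfn B -> dfn (fun r => A r -> B r).
Proof.
move=> hA hB; apply: dfn_ext (dfn_not (dfn_and hA (dfn_not hB))) => r.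
by have := classic (A r); have := classic (B r); tauto.
Qed.

Lemma dfn_iff A B : dfn A -> dfn B -> dfn (fun r => A r <-> B r).
Proof. by move=> hA hB; apply: dfn_and; apply: dfn_imp. Qed.

Lemma dfn_all (A : (nat -> M) -> M -> Prop) :
  dfn (fun r => A (fun i => r i.+1) (r 0)) -> dfn (fun r => forall b, A r b).
Proof.
case=> f [X [cX H]]; exists (FAll f), X; split=> // r /=.
by split=> h b; apply/(H (scons b r)); apply: h.
Qed.

Lemma dfn_ex (A : (nat -> M) -> M -> Prop) :
  dfn (fun r => A (fun i => r i.+1) (r 0)) -> dfn (fun r => exists b, A r b).
Proof.
move=> h; apply: dfn_ext (dfn_not (dfn_all (A := fun r b => ~ A r b) (dfn_not h))) => r.
split=> [H|[b Ab] H]; last exact: (H b).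
by apply: NNPP => H'; apply: H => b Ab; apply: H'; exists b.
Qed.

Lemma dfn_cls (R : M -> Prop) i : cs_class R -> dfn (fun r => R (r i)).
Proof. by move=> cR; exists (FPred 0 i), (fun _ => R). Qed.

Lemma def1_cls R : cs_class R -> def1 R.
Proof. exact: dfn_cls. Qed.

Lemma dfn_meta (Q : Prop) : dfn (fun _ => Q).
Proof.
have [R cR] := some_class; have [q|nq] := classic Q.
  exists (FEq 0 0), (fun _ => R); split=> // r /=; tauto.
exists (FNot (FEq 0 0)), (fun _ => R); split=> // r /=; tauto.
Qed.

Lemma trm_var i : trm (fun r => r i).
Proof. by have [R cR] := some_class; exists (FEq 0 i.+1), (fun _ => R). Qed.

Lemma trm_const c : trm (fun _ => c).
Proof.
have [R cR] := some_class.
apply: (dfn_cls (R := fun x => x = c)).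
exact: (gbc_comprehension hM (FEq 0 1) (fun _ => c) (fun _ => cR)).
Qed.

Lemma trm_shift t : trm t -> trm (fun r => t (fun i => r i.+1)).
Proof. by move/(dfn_ren (fun i => if i is j.+1 then j.+2 else 0)). Qed.

Lemma dfn_app1 (R : M -> Prop) t : def1 R -> trm t -> dfn (fun r => R (t r)).
Proof.
move=> hR ht.
apply: (dfn_ext (A := fun r => exists x, x = t r /\ R x)) => [r|].
  by split=> [[x [->]]|] //; exists (t r).
by apply: dfn_ex; apply: dfn_and.
Qed.

Lemma dfn_app2 (R : M -> M -> Prop) t u : def2 R -> trm t -> trm u ->
  dfn (fun r => R (t r) (u r)).
Proof.
move=> hR ht hu.
apply: (dfn_ext (A := fun r => exists y, y = u r /\ exists x, x = t r /\ R x y)) => [r|].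
  by split=> [[y [-> [x [->]]]]|] //; exists (u r); split=> //; exists (t r).
by apply: dfn_ex; apply: dfn_and => //; apply: dfn_ex; apply: dfn_and => //;
  apply: trm_shift.
Qed.

Lemma dfn_app3 (R : M -> M -> M -> Prop) t u v : def3 R -> trm t -> trm u ->
  trm v -> dfn (fun r => R (t r) (u r) (v r)).
Proof.
move=> hR ht hu hv.
apply: (dfn_ext (A := fun r => exists z, z = v r /\ exists y, y = u r /\
  exists x, x = t r /\ R x y z)) => [r|].
  split=> [[z [-> [y [-> [x [->]]]]]]|] // h.
  by exists (v r); split=> //; exists (u r); split=> //; exists (t r).
apply: dfn_ex; apply: dfn_and => //; apply: dfn_ex; apply: dfn_and.
  exact: (trm_shift hu).
apply: dfn_ex; apply: dfn_and => //.
exact: (trm_shift (trm_shift ht)).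
Qed.

Lemma dfn_app4 (R : M -> M -> M -> M -> Prop) t u v w : def4 R -> trm t ->
  trm u -> trm v -> trm w -> dfn (fun r => R (t r) (u r) (v r) (w r)).
Proof.
move=> hR ht hu hv hw.
apply: (dfn_ext (A := fun r => exists z', z' = w r /\ exists z, z = v r /\
  exists y, y = u r /\ exists x, x = t r /\ R x y z z')) => [r|].
  split=> [[z' [-> [z [-> [y [-> [x [->]]]]]]]]|] // h.
  exists (w r); split=> //; exists (v r); split=> //; exists (u r); split=> //.
  by exists (t r).
apply: dfn_ex; apply: dfn_and => //; apply: dfn_ex; apply: dfn_and.
  exact: (trm_shift hv).
apply: dfn_ex; apply: dfn_and; first exact: (trm_shift (trm_shift hu)).
apply: dfn_ex; apply: dfn_and => //.
exact: (trm_shift (trm_shift (trm_shift ht))).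
Qed.

Lemma def2_eq : def2 eq.
Proof. by have [R cR] := some_class; exists (FEq 0 1), (fun _ => R). Qed.

Lemma def2_mem : def2 mem.
Proof. by have [R cR] := some_class; exists (FMem 0 1), (fun _ => R). Qed.

Lemma trm_app1 f t : fun1 f -> trm t -> trm (fun r => f (t r)).
Proof.
move=> hf ht.
exact: (@dfn_app2 (fun z x => z = f x) _ _ hf (trm_var 0) (trm_shift ht)).
Qed.

Lemma trm_app2 f t u : fun2 f -> trm t -> trm u -> trm (fun r => f (t r) (u r)).
Proof.
move=> hf ht hu.
exact: (@dfn_app3 (fun z x y => z = f x y) _ _ _ hf
  (trm_var 0) (trm_shift ht) (trm_shift hu)).
Qed.

End Definability.

Create HintDb def discriminated.
#[export] Hint Resolve def1_cls def2_eq def2_mem : def.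

Ltac logic_unfold :=
  cbv [sets sem tm fo l_eq l_mem l_pred l_and l_or l_imp l_iff l_not l_all l_ex].

Ltac def_leaf := solve [assumption | eauto with def nocore].

Ltac dfn_step := match goal with
  | |- def1 _ => apply: def1_cls; assumption
  | |- def1 _ => rewrite /def1
  | |- def2 _ => rewrite /def2
  | |- def3 _ => rewrite /def3
  | |- def4 _ => rewrite /def4
  | |- fun1 _ => rewrite /fun1 /def2
  | |- fun2 _ => rewrite /fun2 /def3
  | |- dfn (fun r => ?Q) => apply: dfn_meta
  | |- dfn (fun r => ~ @?A r) => apply: (dfn_not (A := A))
  | |- dfn (fun r => @?A r /\ @?B r) => apply: (dfn_and (A := A) (B := B))
  | |- dfn (fun r => @?A r \/ @?B r) => apply: (dfn_or (A := A) (B := B))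
  | |- dfn (fun r => @?A r <-> @?B r) => apply: (dfn_iff (A := A) (B := B))
  | |- dfn (fun r => @?A r -> @?B r) => apply: (dfn_imp (A := A) (B := B))
  | |- dfn (fun r => forall b, @?A r b) => apply: (dfn_all (A := A))
  | |- dfn (fun r => exists b, @?A r b) => apply: (dfn_ex (A := A))
  | |- dfn (fun r => ?R (@?t r) (@?u r) (@?v r) (@?w r)) =>
      apply: (dfn_app4 (R := R) (t := t) (u := u) (v := v) (w := w)); [def_leaf|..]
  | |- dfn (fun r => ?R (@?t r) (@?u r) (@?v r)) =>
      apply: (dfn_app3 (R := R) (t := t) (u := u) (v := v)); [def_leaf|..]
  | |- dfn (fun r => ?R (@?t r) (@?u r)) =>
      apply: (dfn_app2 (R := R) (t := t) (u := u)); [def_leaf|..]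
  | |- dfn (fun r => ?R (@?t r)) => apply: (dfn_app1 (R := R) (t := t)); [def_leaf|..]
  | |- trm (fun r => r ?i) => apply: trm_var
  | |- trm (fun r => ?c) => apply: trm_const
  | |- trm (fun r => ?f (@?t r) (@?u r)) =>
      apply: (trm_app2 (f := f) (t := t) (u := u)); [def_leaf|..]
  | |- trm (fun r => ?f (@?t r)) => apply: (trm_app1 (f := f) (t := t)); [def_leaf|..]
  end; cbv beta.
Ltac dfn_tac := logic_unfold; cbv beta; repeat dfn_step.

(** * Set theory inside the class structure *)

Lemma def3_pair M {hM : GBC M} : def3 (@is_pair (sets M)).
Proof. by rewrite /is_pair /is_upair; dfn_tac. Qed.
#[export] Hint Resolve def3_pair : def.

Lemma def2_rel2 M {hM : GBC M} (R : M -> Prop) : cs_class R -> def2 (rel2 R).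
Proof. by move=> cR; rewrite /rel2; dfn_tac. Qed.
#[export] Hint Resolve def2_rel2 : def.

Lemma def3_rel3 M {hM : GBC M} (R : M -> Prop) : cs_class R -> def3 (rel3 R).
Proof. by move=> cR; rewrite /rel3; dfn_tac. Qed.
#[export] Hint Resolve def3_rel3 : def.

Section Sets.
Context {M : class_structure} {hM : GBC M}.
Local Notation mem := (@cs_mem M).
Implicit Types (x y z a b c u v w i j n s t : M).

Lemma inhM : inhabited M.
Proof. by have [w [[o _] _]] := gbc_infinity hM. Qed.

Definition collect (A : M -> Prop) : M :=
  epsilon inhM (fun b => forall y, mem y b <-> A y).

Definition is_set (A : M -> Prop) := exists b, forall y, mem y b <-> A y.

Lemma collectE A : is_set A -> forall y, mem y (collect A) <-> A y.
Proof. by move=> h y; have := epsilon_spec inhM _ h; apply. Qed.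

Lemma ext x y : (forall z, mem z x <-> mem z y) -> x = y.
Proof. exact: (gbc_ext hM). Qed.

Lemma collect_eq A b : (forall y, mem y b <-> A y) -> collect A = b.
Proof.
by move=> h; apply: ext => z; rewrite collectE ?h //; exists b.
Qed.

Lemma eq_collect (A : M -> Prop) b :
  is_set A -> b = collect A <-> forall y, mem y b <-> A y.
Proof. by move=> h; split=> [->|/collect_eq ->] //; apply: collectE. Qed.

Definition upr x y := collect (fun w => w = x \/ w = y).
Definition op x y := upr (upr x x) (upr x y).

Lemma mem_upr x y w : mem w (upr x y) <-> w = x \/ w = y.
Proof. by apply: collectE; have [z] := gbc_pairing hM x y; exists z. Qed.

Lemma is_upairE z x y : @is_upair (sets M) z x y <-> z = upr x y.
Proof.
rewrite /is_upair; logic_unfold; split=> [h|-> w]; last exact: mem_upr.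
by apply: ext => w; rewrite h mem_upr.
Qed.

Lemma is_pairE z x y : @is_pair (sets M) z x y <-> z = op x y.
Proof.
rewrite /is_pair; logic_unfold; split=> [[u [v]]|->].
  by move=> [/is_upairE -> [/is_upairE -> /is_upairE ->]].
by exists (upr x x), (upr x y); rewrite !is_upairE.
Qed.

Lemma upr_inj x y z : upr x y = upr x z -> y = z.
Proof.
move=> e.
have /mem_upr[h|//] : mem y (upr x z) by rewrite -e; apply/mem_upr; right.
have /mem_upr[h'|//] : mem z (upr x y) by rewrite e; apply/mem_upr; right.
by rewrite h h'.
Qed.

Lemma op_inj x y x' y' : op x y = op x' y' -> x = x' /\ y = y'.
Proof.
rewrite /op => e.
have xx : x = x'.
  have /mem_upr[h|h] : mem (upr x' x') (upr (upr x x) (upr x y)).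
  - by rewrite e; apply/mem_upr; left.
  - have /mem_upr[] // : mem x (upr x' x') by rewrite h; apply/mem_upr; left.
  - have /mem_upr[] // : mem x (upr x' x') by rewrite h; apply/mem_upr; left.
by subst x'; split=> //; do 2!move/upr_inj: e => e.
Qed.

Lemma rel2E (R : M -> Prop) x y : rel2 R x y <-> R (op x y).
Proof.
split=> [[z [/is_pairE ->]]|h] //; by exists (op x y); split=> //; apply/is_pairE.
Qed.

Lemma rel3E (R : M -> Prop) x y z : rel3 R x y z <-> R (op x (op y z)).
Proof.
split=> [[w [/is_pairE -> /rel2E]]|h] //; exists (op y z); split.
  exact/is_pairE.
exact/rel2E.
Qed.

Lemma def_upr : fun2 upr.
Proof.
apply: (dfn_ext (A := fun r => forall w, mem w (r 0) <-> w = r 1 \/ w = r 2)).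
  move=> r; split=> [h|-> w]; last exact: mem_upr.
  by apply: ext => w; rewrite h mem_upr.
dfn_tac.
Qed.
Hint Resolve def_upr : def.

Lemma def_op : fun2 op.
Proof. by rewrite /op; dfn_tac. Qed.
Hint Resolve def_op : def.

Lemma def1_fun1 (A : M -> M -> Prop) : (forall x, is_set (A x)) ->
  def2 A -> fun1 (fun x => collect (A x)).
Proof.
move=> hs hA; apply: (dfn_ext (A := fun r => forall w, mem w (r 0) <-> A (r 1) w)).
  by move=> r; rewrite eq_collect.
dfn_tac.
Qed.

Lemma def2_fun2 (A : M -> M -> M -> Prop) : (forall x y, is_set (A x y)) ->
  def3 A -> fun2 (fun x y => collect (A x y)).
Proof.
move=> hs hA.
apply: (dfn_ext (A := fun r => forall w, mem w (r 0) <-> A (r 1) (r 2) w)).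
  by move=> r; rewrite eq_collect.
dfn_tac.
Qed.

Lemma replacement (R : M -> M -> Prop) a : def2 R ->
  (forall x y y', mem x a -> R x y -> R x y' -> y = y') ->
  is_set (fun y => exists x, mem x a /\ R x y).
Proof.
move=> dR fR.
set S := fun z => exists x y, z = op x y /\ mem x a /\ R x y.
have cS : cs_class S by apply: cls_dfn; rewrite /S; dfn_tac.
have SE x y : rel2 S x y <-> mem x a /\ R x y.
  rewrite rel2E /S; split=> [[x' [y' [/op_inj[-> ->]]]]|h] //.
  by exists x, y.
have [|b hb] := gbc_replacement hM cS _ a.
  by move=> x y y' /SE[xa Rxy] /SE[_]; apply: fR.
exists b => y; rewrite hb; split=> [[x [xa /SE[_ h]]]|[x [xa h]]].
  by exists x.
by exists x; split=> //; apply/SE.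
Qed.

Lemma separation (A : M -> Prop) a : def1 A -> is_set (fun y => mem y a /\ A y).
Proof.
move=> dA; have [||b hb] := @replacement (fun x y => y = x /\ A x) a.
- by dfn_tac.
- by move=> x y y' _ [-> _] [].
exists b => y; rewrite hb; split=> [[x [xa [-> h]]]|[ya h]] //.
by exists y.
Qed.

Lemma sub_set (A : M -> Prop) a : def1 A -> (forall y, A y -> mem y a) -> is_set A.
Proof.
move=> dA h; have [b hb] := separation a dA; exists b => y.
by rewrite hb; split=> [[]|Ay] //; split=> //; apply: h.
Qed.

Lemma union_set (A : M -> Prop) : is_set A -> is_set (fun z => exists y, A y /\ mem z y).
Proof.
case=> a ha; have [u hu] := gbc_union hM a; exists u => z; rewrite hu.
by split=> -[y [h zy]]; exists y; split=> //; apply/ha.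
Qed.

Lemma or_set (A B : M -> Prop) : is_set A -> is_set B -> is_set (fun z => A z \/ B z).
Proof.
move=> [a ha] [b hb].
have [c hc] : is_set (fun z => exists y, (y = a \/ y = b) /\ mem z y).
  by apply: union_set; exists (upr a b) => y; rewrite mem_upr.
exists c => z; rewrite hc -ha -hb; split=> [[y [[->|->]]]|[h|h]]; auto.
  by exists a; auto.
by exists b; auto.
Qed.

Lemma set_ext (A B : M -> Prop) : (forall z, A z <-> B z) -> is_set A -> is_set B.
Proof. by move=> h [a ha]; exists a => z; rewrite ha. Qed.

Lemma one_set x : is_set (fun z => z = x).
Proof. by exists (upr x x) => z; rewrite mem_upr; tauto. Qed.

Lemma mem_set x : is_set (fun z => mem z x).
Proof. by exists x. Qed.

Definition emp := collect (fun _ => False).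
Definition suc x := collect (fun z => mem z x \/ z = x).
Definition cup x y := collect (fun z => mem z x \/ mem z y).

Lemma mem_emp z : ~ mem z emp.
Proof.
have [b hb] : is_set (fun _ : M => False).
  have [w [[o [ho _]] _]] := gbc_infinity hM; exists o => y.
  by split=> // h; case: (ho y).
by rewrite /emp (collect_eq hb) hb.
Qed.

Lemma is_emptyE x : @is_empty (sets M) x <-> x = emp.
Proof.
rewrite /is_empty; logic_unfold; split=> [h|-> w]; last exact: mem_emp.
by apply: ext => w; split=> [/h|/mem_emp].
Qed.

Lemma mem_suc x z : mem z (suc x) <-> mem z x \/ z = x.
Proof. by apply: collectE; apply: or_set; [apply: mem_set|apply: one_set]. Qed.

Lemma mem_cup x y z : mem z (cup x y) <-> mem z x \/ mem z y.
Proof. by apply: collectE; apply: or_set; apply: mem_set. Qed.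

Lemma is_succE y x : @is_succ (sets M) y x <-> y = suc x.
Proof.
rewrite /is_succ; logic_unfold; split=> [h|-> w]; last exact: mem_suc.
by apply: ext => w; rewrite h mem_suc.
Qed.

Lemma def_suc : fun1 suc.
Proof.
apply: def1_fun1 => [x|]; last by dfn_tac.
by apply: or_set; [apply: mem_set|apply: one_set].
Qed.

Lemma def_cup : fun2 cup.
Proof.
apply: def2_fun2 => [x y|]; last by dfn_tac.
by apply: or_set; apply: mem_set.
Qed.
Hint Resolve def_suc def_cup : def.

Lemma eps_ind (A : M -> Prop) : def1 A ->
  (forall x, (forall y, mem y x -> A y) -> A x) -> forall x, A x.
Proof.
move=> dA step x; apply: NNPP => nAx.
have [||y [ny hy]] := gbc_foundation hM (R := fun x => ~ A x).
- by apply: cls_dfn; dfn_tac.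
- by exists x.
by apply: ny; apply: step => z /hy /NNPP.
Qed.

Fixpoint below (A : M -> Prop) (d : nat) x : Prop :=
  if d is d'.+1 then A x /\ forall y, mem y x -> below A d' y else A x.

Lemma def_below A d : def1 A -> def1 (below A d).
Proof. by move=> dA; elim: d => [|d IH] //=; dfn_tac. Qed.

Lemma below0 A d x : below A d x -> A x.
Proof. by case: d => [|d] //= []. Qed.

Lemma belowS A d x y : below A d.+1 x -> mem y x -> below A d y.
Proof. by case=> _; apply. Qed.

Lemma below_pred A d x : below A d.+1 x -> below A d x.
Proof.
elim: d x => [|d IH] x; first by case.
by move=> [Ax h]; split=> // y /h; apply: IH.
Qed.

(** The immediate subformulas of a coded formula lie a few membership steps below it. *)
Lemma eps_ind_deep d (A : M -> Prop) : def1 A ->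
  (forall x, (forall y, mem y x -> below A d y) -> A x) -> forall x, A x.
Proof.
move=> dA step x; suff /below0 : below A d.+1 x by [].
move: x; apply: eps_ind => [|x IH]; first exact: def_below.
split=> [|y /IH/below_pred] //.
by apply: step => y /IH/below_pred.
Qed.

Lemma below_upr A d x y z : below A d.+1 (upr x y) -> z = x \/ z = y -> below A d z.
Proof. by move=> h zz; apply: (belowS h); apply/mem_upr. Qed.

Lemma below_op A d x y z : below A d.+2 (op x y) -> z = x \/ z = y -> below A d z.
Proof.
by move=> h zz; apply: (below_upr (x := x) (y := y)) zz; apply: (below_upr h); right.
Qed.

Lemma mem_irrefl x : ~ mem x x.
Proof.
move: x; apply: eps_ind => [|x IH h]; first by dfn_tac.
exact: (IH _ h h).
Qed.

Lemma mem_asym x y : mem x y -> ~ mem y x.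
Proof.
move: x y; apply: eps_ind => [|x IH y xy yx]; first by dfn_tac.
exact: (IH _ yx _ yx xy).
Qed.

Lemma suc_inj x y : suc x = suc y -> x = y.
Proof.
move=> e.
have /mem_suc[h|//] : mem x (suc y) by rewrite -e; apply/mem_suc; right.
have /mem_suc[h'|//] : mem y (suc x) by rewrite e; apply/mem_suc; right.
by case: (mem_asym h).
Qed.

Lemma suc_neq x : suc x <> emp.
Proof. by move=> e; apply: (@mem_emp x); rewrite -e; apply/mem_suc; right. Qed.

Lemma trans_sup x : exists t, (forall y z, mem z y -> mem y t -> mem z t) /\
  forall y, mem y x -> mem y t.
Proof.
move: x; apply: eps_ind => [|x IH]; first by dfn_tac.
pose trn t := forall y z, mem z y -> mem y t -> mem z t.
pose tc y w := forall t, trn t -> (forall v, mem v y -> mem v t) -> mem w t.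
have tcs y : mem y x -> is_set (tc y).
  move=> /IH[t [ht yt]]; apply: (@sub_set _ t) => [|w]; last by apply.
  by rewrite /tc /trn; dfn_tac.
have [||U hU] := @replacement (fun y v => forall w, mem w v <-> tc y w) x.
- by rewrite /tc /trn; dfn_tac.
- by move=> y v v' _ hv hv'; apply: ext => w; rewrite hv hv'.
have [t ht] : is_set (fun z => mem z x \/ exists v, mem v U /\ mem z v).
  by apply: or_set; [apply: mem_set|apply: union_set; apply: mem_set].
exists t; split=> [y z zy|y yx]; last by apply/ht; left.
move=> /ht[yx|[v [/hU[y' [yx hv]] /hv yv]]]; apply/ht; right.
  have [v hv] := tcs _ yx; exists v; split; last by apply/hv => t' _; apply.
  by apply/hU; exists y.
exists v; split; first by apply/hU; exists y'.
apply/hv => t' tt ht'; apply: (tt _ _ zy).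
exact: yv.
Qed.

Lemma cons_set a b i : is_set (fun z => z = op emp b \/
  exists i x, z = op (suc i) x /\ mem (op i x) a).
Proof.
apply: or_set; first exact: one_set.
apply: (set_ext (A := fun z => exists e, mem e a /\
  exists i x, e = op i x /\ z = op (suc i) x)) => [z|].
  split=> [[e [ea [k [x [ek ->]]]]]|[k [x [-> h]]]]; first by exists k, x; rewrite -ek.
  by exists (op k x); split=> //; exists k, x.
apply: replacement; first by dfn_tac.
by move=> x y y' _ [k [z [-> ->]]] [k' [z' [/op_inj[-> ->] ->]]].
Qed.

End Sets.
#[export] Hint Resolve def_upr def_op def_suc def_cup : def.

(** * Numbers, sequences and codes of formulas *)

Section Codes.
Context {M : class_structure} {hM : GBC M}.
Local Notation mem := (@cs_mem M).
Local Notation isnat := (@is_nat (sets M)).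
Local Notation isseq := (@is_seq (sets M)).
Local Notation at_ := (@at_ (sets M)).
Local Notation isform := (@is_formula (sets M)).
Implicit Types (x y z a b c f g u v w i j n s t : M).

Lemma natE n : isnat n <->
  (forall y z, mem z y -> mem y n -> mem z n) /\ (n = emp \/ exists j, n = suc j) /\
  (forall k, mem k n -> (forall y z, mem z y -> mem y k -> mem z k) /\
    (k = emp \/ exists j, k = suc j)).
Proof.
have zs x : @zero_or_succ (sets M) x <-> x = emp \/ exists j, x = suc j.
  rewrite /zero_or_succ; logic_unfold; split.
    by move=> [/is_emptyE|[j /is_succE]]; [left|right; exists j].
  by move=> [/is_emptyE|[j /is_succE]]; [left|right; exists j].
have tr x : @is_trans (sets M) x <-> forall y z, mem z y -> mem y x -> mem z x.
  rewrite /is_trans /is_subset; logic_unfold.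
  by split=> h y z ? ?; apply: (h y).
rewrite /is_nat; logic_unfold; rewrite -zs -tr.
split=> -[t [z h]]; split=> //; split=> // k /h [hk zk].
  by split; [apply/tr|apply/zs].
by split; [apply/tr|apply/zs].
Qed.

Lemma nat_mem n i : isnat n -> mem i n -> isnat i.
Proof.
move=> /natE[t [_ h]] i_n; apply/natE; have [ti zi] := h i i_n.
by split=> //; split=> // k ki; apply: h; apply: (t i).
Qed.

Lemma nat_trans n i j : isnat n -> mem i n -> mem j i -> mem j n.
Proof. by move=> /natE[t _] i_n ji; apply: (t i). Qed.

Lemma nat0 : isnat emp.
Proof.
apply/natE; split=> [y z _ /mem_emp|] //; split; first by left.
by move=> k /mem_emp.
Qed.

Lemma natS n : isnat n -> isnat (suc n).
Proof.
move=> nn; have := nn => /natE[t [z h]]; apply/natE; split.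
  by move=> x y yx /mem_suc[xn|xn]; apply/mem_suc; left; [apply: (t x)|rewrite -xn].
split=> [|k /mem_suc[/h|->]] //; by right; exists n.
Qed.

Lemma nat_suc n : isnat (suc n) -> isnat n.
Proof. by move=> h; apply: (nat_mem h); apply/mem_suc; right. Qed.

Lemma nat_case n : isnat n -> n = emp \/ exists j, n = suc j /\ isnat j.
Proof.
move=> nn; have /natE[_ [[->|[j e]] _]] := nn; first by left.
by right; exists j; split=> //; apply: nat_suc; rewrite -e.
Qed.

Lemma nat_ind_def (A : M -> Prop) : def1 A -> A emp ->
  (forall n, isnat n -> A n -> A (suc n)) -> forall n, isnat n -> A n.
Proof.
move=> dA A0 AS.
apply: eps_ind => [|n IH nn].
  by rewrite /is_nat /zero_or_succ /is_trans /is_subset /is_empty /is_succ; dfn_tac.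
have [->|[j [e nj]]] := nat_case nn; first by [].
by rewrite e; apply: (AS _ nj); apply: IH => //; rewrite e; apply/mem_suc; right.
Qed.

Lemma mem_sucS n i : isnat n -> mem i n -> mem (suc i) (suc n).
Proof.
move=> nn; move: n nn i; apply: nat_ind_def => [|i /mem_emp|n nn IH i] //.
  by dfn_tac.
move=> /mem_suc[/IH h|->]; apply/mem_suc; [by left|by right].
Qed.

Lemma suc_mem n i : isnat n -> mem (suc i) (suc n) -> mem i n.
Proof.
move=> nn /mem_suc[h|<-]; last by apply/mem_suc; right.
by apply: (nat_trans nn h); apply/mem_suc; right.
Qed.

Lemma emp_mem n : isnat n -> mem emp (suc n).
Proof.
move: n; apply: nat_ind_def => [||n nn IH]; first by dfn_tac.
  by apply/mem_suc; right.
by apply/mem_suc; left.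
Qed.

Lemma mem_suc_case n i : isnat n -> mem i (suc n) ->
  i = emp \/ exists j, i = suc j /\ mem j n.
Proof.
move=> nn i_n; have [->|[j [e nj]]] := nat_case (nat_mem (natS nn) i_n); first by left.
by right; exists j; split=> //; apply: suc_mem => //; rewrite -e.
Qed.

Fixpoint num (k : nat) : M := if k is k'.+1 then suc (num k') else emp.

Lemma is_numE k x : @is_num (sets M) k x <-> x = num k.
Proof.
elim: k x => [|k IH] x /=; first exact: is_emptyE.
split=> [[y [/IH -> /is_succE ->]]|->] //.
by exists (num k); split; [apply/IH|apply/is_succE].
Qed.

Lemma nat_num k : isnat (num k).
Proof. by elim: k => [|k IH] /=; [apply: nat0|apply: natS]. Qed.

Lemma num_inj k l : num k = num l -> k = l.
Proof.
elim: k l => [|k IH] [|l] //=.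
- by move/esym/suc_neq.
- by move/suc_neq.
- by move/suc_inj/IH ->.
Qed.

Lemma mem_num k l : mem (num k) (num l) <-> k < l.
Proof.
elim: k l => [|k IH] [|l] /=.
- by split=> [/mem_emp|].
- by split=> // _; apply: emp_mem; apply: nat_num.
- by split=> [/mem_emp|].
- split=> [/(suc_mem (nat_num l))/IH|] //.
  by rewrite ltnS => /IH/mem_sucS; apply; apply: nat_num.
Qed.

Lemma at_E a i x : at_ a i x <-> mem (op i x) a.
Proof.
rewrite /Defs.at_; logic_unfold; split=> [[z [/is_pairE ->]]|h] //.
by exists (op i x); split=> //; apply/is_pairE.
Qed.

Lemma seqE a n : isseq a n <-> isnat n /\
  (forall z, mem z a -> exists i x, mem i n /\ z = op i x) /\
  (forall i, mem i n -> exists x, mem (op i x) a) /\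
  (forall i x y, mem (op i x) a -> mem (op i y) a -> x = y).
Proof.
rewrite /is_seq; logic_unfold; split=> -[nn [h1 [h2 h3]]]; split=> //; split.
- by move=> z /h1[i [x [i_n /is_pairE]]]; exists i, x.
- split=> [i /h2[x /at_E]|i x y /at_E h /at_E]; first by exists x.
  exact: h3 h.
- by move=> z /h1[i [x [i_n e]]]; exists i, x; split=> //; apply/is_pairE.
- split=> [i /h2[x]|i x y /at_E h /at_E]; first by exists x; apply/at_E.
  exact: h3 h.
Qed.

Lemma seq_nat a n : isseq a n -> isnat n.
Proof. by case/seqE. Qed.

Lemma seq_fun a n i x y : isseq a n -> mem (op i x) a -> mem (op i y) a -> x = y.
Proof. by case/seqE => _ [_ [_ h]]; apply: h. Qed.

Lemma seq_dom a n i x : isseq a n -> mem (op i x) a -> mem i n.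
Proof. by case/seqE => _ [h _] /h[j [y [jn /op_inj[-> _]]]]. Qed.

Lemma seq_total a n i : isseq a n -> mem i n -> exists x, mem (op i x) a.
Proof. by case/seqE => _ [_ [h _]]; apply: h. Qed.

Lemma seq_len a n n' : isseq a n -> isseq a n' -> n = n'.
Proof.
move=> h h'; apply: ext => i; split=> hi.
  by have [x /(seq_dom h')] := seq_total h hi.
by have [x /(seq_dom h)] := seq_total h' hi.
Qed.

Lemma seq_emp : isseq emp emp.
Proof.
apply/seqE; split; first exact: nat0.
by split=> [z /mem_emp|] //; split=> [i /mem_emp|i x y /mem_emp].
Qed.

Definition cons x a := collect (fun z => z = op emp x \/
  exists i y, z = op (suc i) y /\ mem (op i y) a).

Lemma mem_cons x a z : mem z (cons x a) <-> z = op emp x \/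
  exists i y, z = op (suc i) y /\ mem (op i y) a.
Proof. exact: (collectE (cons_set a x emp)). Qed.

Lemma at_cons0 x a y : mem (op emp y) (cons x a) <-> y = x.
Proof.
rewrite mem_cons; split=> [[/op_inj[] //|[i [z [/op_inj[/esym/suc_neq[]]]]]]|->] //.
by left.
Qed.

Lemma at_consS x a i y : mem (op (suc i) y) (cons x a) <-> mem (op i y) a.
Proof.
rewrite mem_cons; split=> [[/op_inj[/suc_neq[]]|]|h]; last by right; exists i, y.
by move=> [j [z [/op_inj[/suc_inj -> ->]]]].
Qed.

Lemma seq_cons a n x : isseq a n -> isseq (cons x a) (suc n).
Proof.
move=> h; have nn := seq_nat h; apply/seqE; split; first exact: natS.
split=> [z /mem_cons[->|[i [y [-> iy]]]]|].
- by exists emp, x; split=> //; apply: emp_mem.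
- by exists (suc i), y; split=> //; apply: mem_sucS => //; apply: seq_dom iy.
split=> [i|i y z].
  move=> /(mem_suc_case nn)[->|[j [-> /(seq_total h)[y hy]]]].
    by exists x; apply/at_cons0.
  by exists y; apply/at_consS.
move=> hy; have [e|[j [e jn]]] : i = emp \/ exists j, i = suc j /\ mem j n.
- apply: mem_suc_case => //; have /mem_cons[/op_inj[-> _]|[j [w [/op_inj[-> _] jw]]]] := hy.
    exact: emp_mem.
  by apply: mem_sucS => //; apply: seq_dom jw.
- by move: hy; rewrite e => /at_cons0 -> /at_cons0 ->.
by move: hy; rewrite e => /at_consS h1 /at_consS; exact: (seq_fun h h1).
Qed.

Lemma mem_snoc a n x i y : mem (op i y) (cup a (upr (op n x) (op n x))) <->
  mem (op i y) a \/ (i = n /\ y = x).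
Proof. by rewrite mem_cup mem_upr; split=> [[|[]/op_inj]|[|[-> ->]]]; auto. Qed.

Lemma seq_snoc a n x : isseq a n -> isseq (cup a (upr (op n x) (op n x))) (suc n).
Proof.
move=> h; have nn := seq_nat h.
apply/seqE; split; first exact: natS.
split=> [z /mem_cup[za|/mem_upr zn]|].
- have /seqE[_ [/(_ _ za)[i [y [i_n e]]] _]] := h; exists i, y; split=> //.
  by apply/mem_suc; left.
- by exists n, x; split; [apply/mem_suc; right|case: zn].
split=> [i /mem_suc[/(seq_total h)[y hy]|->]|i y z /mem_snoc[h1|[e1 ->]] /mem_snoc[h2|[e2 ->]]] //.
- by exists y; apply/mem_snoc; left.
- by exists x; apply/mem_snoc; right.
- exact: seq_fun h h1 h2.
- by have := seq_dom h h1; rewrite e2 => /mem_irrefl.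
- by have := seq_dom h h2; rewrite e1 => /mem_irrefl.
Qed.

Lemma seq_ext a b n : isseq a n -> isseq b n ->
  (forall i x, mem i n -> mem (op i x) a -> mem (op i x) b) -> a = b.
Proof.
move=> ha hb h; apply: ext => z; split=> hz.
  by have /seqE[_ [/(_ _ hz)[i [x [i_n e]]] _]] := ha; rewrite e in hz *; apply: h.
have /seqE[_ [/(_ _ hz)[i [x [i_n e]]] _]] := hb; rewrite e in hz *.
have [y hy] := seq_total ha i_n.
by rewrite (seq_fun hb hz (h _ _ i_n hy)).
Qed.

Lemma is_consE a n c x : isseq a n -> @is_cons (sets M) c x a <-> c = cons x a.
Proof.
move=> h; have nn := seq_nat h; rewrite /is_cons; logic_unfold; split; last first.
  move=> ->; exists n, (suc n); split=> //; split; first exact/is_succE.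
  split; first exact: seq_cons.
  split; first by exists emp; split; [apply/is_emptyE|apply/at_E/at_cons0].
  move=> i /(seq_total h)[y hy]; exists (suc i), y.
  by split; [apply/is_succE|split; apply/at_E => //; apply/at_consS].
move=> [k [k' [hk [/is_succE -> [hc [[o [/is_emptyE -> /at_E h0]] hS]]]]]].
have e := seq_len h hk; subst k; apply: esym.
apply: (seq_ext (seq_cons x h) hc) => i y /(mem_suc_case nn)[->|[j [-> jn]]].
  by move/at_cons0 ->.
have [_ [z [/is_succE -> [/at_E hz /at_E hz']]]] := hS _ jn.
by move/at_consS/(seq_fun h hz) <-.
Qed.

Lemma def_cons : fun2 cons.
Proof.
apply: def2_fun2 => [x a|]; first exact: cons_set.
by dfn_tac.
Qed.

Fixpoint lst (l : seq M) : M := if l is x :: l' then cons x (lst l') else emp.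

Lemma seq_lst l : isseq (lst l) (num (size l)).
Proof. by elim: l => [|x l IH] /=; [apply: seq_emp|apply: seq_cons]. Qed.

Lemma is_listE a l : is_list a l <-> a = lst l.
Proof.
elim: l a => [|x l IH] a /=; first exact: is_emptyE.
split=> [[b [/IH -> /(is_consE _ _ (seq_lst l))]]|->] //.
by exists (lst l); split; [apply/IH|apply/(is_consE _ _ (seq_lst l))].
Qed.

Definition node (t : nat) x y := op (num t) (op x y).

Lemma node_inj (t t' : nat) x x' y y' :
  node t x y = node t' x' y' -> [/\ t = t', x = x' & y = y'].
Proof. by move=> /op_inj[/num_inj -> /op_inj[-> ->]]. Qed.

Lemma is_nodeE (t : nat) c x y : @is_node (sets M) t c x y <-> c = node t x y.
Proof.
rewrite /is_node; logic_unfold; split.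
  by move=> [o [w [/is_numE -> [/is_pairE -> /is_pairE ->]]]].
by move=> ->; exists (num t), (op x y); rewrite is_numE !is_pairE.
Qed.

Lemma c_predE p c i : @c_pred (sets M) p c i <-> c = node 2 (num p) i.
Proof.
rewrite /c_pred; logic_unfold; split=> [[x [/is_numE -> /is_nodeE]]|/is_nodeE h] //.
by exists (num p); rewrite is_numE.
Qed.

Lemma def_node (t : nat) : fun2 (node t).
Proof. by rewrite /node; dfn_tac. Qed.

Fixpoint code (f : fm) : M :=
  match f with
  | FEq i j => node 0 (num i) (num j)
  | FMem i j => node 1 (num i) (num j)
  | FPred k i => node 2 (num k) (num i)
  | FAnd g h => node 3 (code g) (code h)
  | FNot g => node 4 (code g) (code g)
  | FAll g => node 5 (code g) (code g)
  end.

Lemma codesE c (f : fm) : codes c f <-> c = code f.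
Proof.
elim: f c => [i j|i j|k i|g IHg h IHh|g IH|g IH] c;
  cbn [codes code]; rewrite /c_eq /c_mem /c_and /c_not /c_all.
- split=> [[u [v [/is_numE -> [/is_numE -> /is_nodeE]]]]|/is_nodeE h] //.
  by exists (num i), (num j); rewrite !is_numE.
- split=> [[u [v [/is_numE -> [/is_numE -> /is_nodeE]]]]|/is_nodeE h] //.
  by exists (num i), (num j); rewrite !is_numE.
- split=> [[u [/is_numE -> /c_predE]]|/c_predE h] //.
  by exists (num i); rewrite is_numE.
- split=> [[u [v [/IHg -> [/IHh -> /is_nodeE]]]]|/is_nodeE e] //.
  by exists (code g), (code h); rewrite IHg IHh.
- split=> [[u [/IH -> /is_nodeE]]|/is_nodeE e] //.
  by exists (code g); rewrite IH.
- split=> [[u [/IH -> /is_nodeE]]|/is_nodeE e] //.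
  by exists (code g); rewrite IH.
Qed.

Lemma code_inj : injective code.
Proof.
elim=> [i j|i j|k i|g IHg h IHh|g IH|g IH] [i' j'|i' j'|k' i'|g' h'|g'|g'] /= /node_inj [] //.
- by move=> _ /num_inj -> /num_inj ->.
- by move=> _ /num_inj -> /num_inj ->.
- by move=> _ /num_inj -> /num_inj ->.
- by move=> _ /IHg -> /IHh ->.
- by move=> _ /IH ->.
- by move=> _ /IH ->.
Qed.

Lemma any_belowE k (A : nat -> Prop) :
  @any_below (sets M) k A <-> exists i : nat, i < k /\ A i.
Proof.
elim: k => [|k IH] /=; first by split=> [[x]|[i []]].
rewrite IH; split=> [[[i [ik Ai]]|Ak]|[i [ik Ai]]].
- by exists i; split=> //; apply: ltnW.
- by exists k.
- move: ik; rewrite ltnS leq_eqVlt => /orP[/eqP <-|ik]; first by right.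
  by left; exists i.
Qed.

Definition fstep k (S : M -> M -> Prop) c l : Prop := isnat l /\
  ((exists i j, mem i l /\ mem j l /\ c = node 0 i j) \/
   (exists i j, mem i l /\ mem j l /\ c = node 1 i j) \/
   (exists p i, p < k /\ mem i l /\ c = node 2 (num p) i) \/
   (exists g h, c = node 3 g h /\ S g l /\ S h l) \/
   (exists g, c = node 4 g g /\ S g l) \/
   (exists g, c = node 5 g g /\ S g (suc l))).

Lemma fstep_mono k (S S' : M -> M -> Prop) c l :
  (forall c l, S c l -> S' c l) -> fstep k S c l -> fstep k S' c l.
Proof.
move=> h [nl H]; split=> //.
by case: H => [?|[?|[?|[[g [g' [? [? ?]]]]|[[g [? ?]]|[g [? ?]]]]]]]; auto 6;
  do 3 right; [left; exists g, g'; auto | right; left | do 2 right]; exists g; auto.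
Qed.

Lemma formE k f n : isform k f n <-> exists s, mem (op f n) s /\
  forall e, mem e s -> exists c l, e = op c l /\
    fstep k (fun c l => mem (op c l) s) c l.
Proof.
rewrite /is_formula /c_eq /c_mem /c_and /c_not /c_all; logic_unfold; split.
  move=> [s [[e [/is_pairE -> es]] h]]; exists s; split=> // e' /h{h}.
  move=> [c [l [/is_pairE -> [nl H]]]]; exists c, l; split=> //; split=> //.
  case: H => [[i [j [? [? /is_nodeE ?]]]]|H]; first by left; exists i, j.
  right; case: H => [[i [j [? [? /is_nodeE ?]]]]|H]; first by left; exists i, j.
  right; case: H => [/any_belowE[p [pk [i [il /c_predE ->]]]]|H].
    by left; exists p, i.
  right; case: H => [[g [h [e1 [e2 [/is_nodeE -> [/is_pairE -> [? [/is_pairE -> ?]]]]]]]]|H].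
    by left; exists g, h.
  right; case: H => [[g [e1 [/is_nodeE -> [/is_pairE -> ?]]]]|H]; first by left; exists g.
  by case: H => g [l' [e1 [/is_nodeE -> [/is_succE -> [/is_pairE -> ?]]]]]; right; exists g.
move=> [s [fs h]]; exists s; split; first by exists (op f n); split=> //; apply/is_pairE.
move=> e /h{h}[c [l [-> [nl H]]]]; exists c, l; split; first exact/is_pairE.
split=> //.
case: H => [[i [j [? [? /is_nodeE ?]]]]|H]; first by left; exists i, j.
right; case: H => [[i [j [? [? /is_nodeE ?]]]]|H]; first by left; exists i, j.
right; case: H => [[p [i [pk [il /c_predE e']]]]|H].
  by left; apply/any_belowE; exists p; split=> //; exists i.
right; case: H => [[g [h [/is_nodeE e' [? ?]]]]|H].
  by left; exists g, h, (op g l), (op h l); rewrite !is_pairE.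
right; case: H => [[g [/is_nodeE e' ?]]|[g [/is_nodeE e' ?]]].
  by left; exists g, (op g l); rewrite is_pairE.
by right; exists g, (suc l), (op g (suc l)); rewrite is_pairE is_succE.
Qed.

Lemma form_inv k f n : isform k f n -> fstep k (isform k) f n.
Proof.
case/formE => s [fs h]; have [c [l [/op_inj[-> ->]]]] := h _ fs.
by apply: fstep_mono => g m gs; apply/formE; exists s.
Qed.

Lemma form_intro k f n : fstep k (isform k) f n -> isform k f n.
Proof.
move=> H.
have [s [hs hs']] : exists s, fstep k (fun c l => mem (op c l) s) f n /\
  forall e, mem e s -> exists c l, e = op c l /\
    fstep k (fun c l => mem (op c l) s) c l.
  have ne e : mem e emp -> exists c l, e = op c l /\
    fstep k (fun c l => mem (op c l) emp) c l by move/mem_emp.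
  case: H => nn [?|[?|[?|[[g [h [e [/formE[s [gs hs]] /formE[t [ht ht']]]]]]|H]]]].
  - by exists emp; split=> //; split; auto 7.
  - by exists emp; split=> //; split; auto 7.
  - by exists emp; split=> //; split; auto 7.
  - exists (cup s t); split.
      split=> //; do 3 right; left; exists g, h; split=> //.
      by split; apply/mem_cup; auto.
    move=> z /mem_cup[/hs|/ht'] [c [l [-> hz]]]; exists c, l; split=> //;
      by apply: fstep_mono hz => ? ? ?; apply/mem_cup; auto.
  case: H => [[g [e /formE[s [gs hs]]]]|[g [e /formE[s [gs hs]]]]]; exists s; split=> //.
    by split=> //; do 4 right; left; exists g.
  by split=> //; do 5 right; exists g.
have su c l : mem (op c l) s -> mem (op c l) (cup s (upr (op f n) (op f n))).
  by move=> ?; apply/mem_cup; left.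
apply/formE; exists (cup s (upr (op f n) (op f n))); split.
  by apply/mem_cup; right; apply/mem_upr; left.
move=> e /mem_cup[/hs'[c [l [-> hc]]]|/mem_upr ee].
  by exists c, l; split=> //; apply: fstep_mono hc.
exists f, n; split; first by case: ee.
exact: fstep_mono hs.
Qed.

Lemma form_nat k f n : isform k f n -> isnat n.
Proof. by move/form_inv => []. Qed.

Lemma form_eq k i j n : isform k (node 0 i j) n -> mem i n /\ mem j n.
Proof.
move/form_inv=> [nn [[u [v [? [? /node_inj[_ -> ->]]]]]|]] //.
by case=> [[? [? [_ [_ /node_inj[]]]]]|[[? [? [_ [_ /node_inj[]]]]]|
  [[? [? [/node_inj[]]]]|[[? [/node_inj[]]]|[? [/node_inj[]]]]]]].
Qed.

Lemma form_mem k i j n : isform k (node 1 i j) n -> mem i n /\ mem j n.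
Proof.
move/form_inv=> [nn [[? [? [_ [_ /node_inj[]]]]]|[[u [v [? [? /node_inj[_ -> ->]]]]]|]]] //.
by case=> [[? [? [_ [_ /node_inj[]]]]]|
  [[? [? [/node_inj[]]]]|[[? [/node_inj[]]]|[? [/node_inj[]]]]]].
Qed.

Lemma form_pred k p i n : isform k (node 2 (num p) i) n -> p < k /\ mem i n.
Proof.
move/form_inv=> [nn [[? [? [_ [_ /node_inj[]]]]]|[[u [v [? [? /node_inj[]]]]]|]]] //.
by case=> [[? [? [? [? /node_inj[_ /num_inj -> ->]]]]]|
  [[? [? [/node_inj[]]]]|[[? [/node_inj[]]]|[? [/node_inj[]]]]]].
Qed.

Lemma form_and k g h n : isform k (node 3 g h) n <-> isform k g n /\ isform k h n.
Proof.
split=> [/form_inv|[hg hh]]; last first.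
  apply: form_intro; split; first exact: form_nat hg.
  by do 3 right; left; exists g, h.
move=> [nn [[? [? [_ [_ /node_inj[]]]]]|[[u [v [? [? /node_inj[]]]]]|]]] //.
by case=> [[? [? [? [? /node_inj[]]]]]|
  [[? [? [/node_inj[_ -> ->]]]]|[[? [/node_inj[]]]|[? [/node_inj[]]]]]].
Qed.

Lemma form_not k g n : isform k (node 4 g g) n <-> isform k g n.
Proof.
split=> [/form_inv|hg]; last first.
  apply: form_intro; split; first exact: form_nat hg.
  by do 4 right; left; exists g.
move=> [nn [[? [? [_ [_ /node_inj[]]]]]|[[u [v [? [? /node_inj[]]]]]|]]] //.
by case=> [[? [? [? [? /node_inj[]]]]]|
  [[? [? [/node_inj[]]]]|[[? [/node_inj[_ -> _]]]|[? [/node_inj[]]]]]].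
Qed.

Lemma form_all k g n : isform k (node 5 g g) n <-> isnat n /\ isform k g (suc n).
Proof.
split=> [/form_inv|[hn hg]]; last first.
  by apply: form_intro; split=> //; do 5 right; exists g.
move=> [nn [[? [? [_ [_ /node_inj[]]]]]|[[u [v [? [? /node_inj[]]]]]|]]] //.
by case=> [[? [? [? [? /node_inj[]]]]]|
  [[? [? [/node_inj[]]]]|[[? [/node_inj[]]]|[? [/node_inj[_ -> _]]]]]].
Qed.

Lemma dfn_any_below k (B : nat -> (nat -> M) -> Prop) :
  (forall p, dfn (B p)) -> dfn (fun r => @any_below (sets M) k (fun p => B p r)).
Proof. by move=> hB; elim: k => [|k IH] /=; dfn_tac => //; apply: hB. Qed.

Lemma def_nat : def1 isnat.
Proof.
rewrite /is_nat /zero_or_succ /is_trans /is_subset /is_empty /is_succ.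
by dfn_tac.
Qed.
Hint Resolve def_nat : def.

Lemma def_at : def3 at_.
Proof. by rewrite /Defs.at_; dfn_tac. Qed.
Hint Resolve def_at : def.

Lemma def_seq : def2 isseq.
Proof. by rewrite /is_seq; dfn_tac. Qed.
Hint Resolve def_seq def_node def_cons : def.

Lemma def_form k : def2 (isform k).
Proof.
apply: (dfn_ext (A := fun r => exists s, mem (op (r 0) (r 1)) s /\
  forall e, mem e s -> exists c l, e = op c l /\
    fstep k (fun c l => mem (op c l) s) c l)) => [r|]; first by rewrite formE.
rewrite /fstep.
have e (n : nat) (c l : M) : (exists p i, p < n /\ mem i l /\ c = node 2 (num p) i) <->
    @any_below (sets M) n (fun p => exists i, mem i l /\ c = node 2 (num p) i).
  rewrite any_belowE; split=> [[p [i [? ?]]]|[p [? [i ?]]]]; first by exists p; split=> //; exists i.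
  by exists p, i.
have dp : def2 (fun c l => exists p i, p < k /\ mem i l /\ c = node 2 (num p) i).
  apply: (dfn_ext (A := fun r => @any_below (sets M) k
    (fun p => exists i, mem i (r 1) /\ r 0 = node 2 (num p) i))) => [r|].
    by rewrite e.
  by apply: dfn_any_below => p; dfn_tac.
dfn_tac.
exact: (dfn_app2 dp (trm_var 1) (trm_var 0)).
Qed.
Hint Resolve def_form : def.

Lemma below_node (A : M -> Prop) (t : nat) x y :
  (forall z, mem z (node t x y) -> below A 3 z) -> A x /\ A y.
Proof.
rewrite /node => h.
have h2 : below A 2 (op x y).
  by apply: (below_upr (x := num t) (y := op x y)); [apply: h; apply/mem_upr|]; right.
by split; apply: (below_op (d := 0) h2); auto.
Qed.

Lemma form_ind_def k (A : M -> M -> Prop) : def2 A ->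
  (forall c n, fstep k (fun c n => isform k c n /\ A c n) c n -> A c n) ->
  forall c n, isform k c n -> A c n.
Proof.
move=> dA step; apply: (eps_ind_deep (d := 3)) => [|c IH n]; first by dfn_tac.
move=> /form_inv[nn H]; apply: step; split=> //.
case: H => [?|[?|[?|[[g [h [e [fg fh]]]]|[[g [e fg]]|[g [e fg]]]]]]]; auto 6;
  rewrite e in IH; have [hg hh] := below_node IH.
- by do 3 right; left; exists g, h; auto.
- by do 4 right; left; exists g; auto.
- by do 5 right; exists g; auto.
Qed.

End Codes.
#[export] Hint Resolve def_nat def_at def_seq def_cons def_node def_form : def.

(** * Names and the atomic forcing relation *)

Section Names.
Context {M : class_structure} {hM : GBC M}.
Local Notation mem := (@cs_mem M).
Variables (P : M -> Prop) (one : M).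
Hypotheses (cP : cs_class P) (P1 : P one).
Local Notation name := (is_name P).
Implicit Types (x y z u v w p : M).

Lemma def_name : def1 name.
Proof. by rewrite /is_name; dfn_tac. Qed.
Hint Resolve def_name : def.

Lemma name_mem x z : name x -> mem z x ->
  exists u p, z = op u p /\ name u /\ P p.
Proof.
move=> [s [xs hs]] zx; have [u [p [/is_pairE -> [us Pp]]]] := hs _ xs _ zx.
by exists u, p; split=> //; split=> //; exists s.
Qed.

Lemma name_dom x u p : name x -> mem (op u p) x -> name u /\ P p.
Proof. by move=> nx /(name_mem nx)[v [q [/op_inj[-> ->]]]]. Qed.

Lemma name_intro x :
  (forall z, mem z x -> exists u p, z = op u p /\ name u /\ P p) -> name x.
Proof.
move=> h; have [t [tt xt]] := trans_sup x.
have [s hs] : is_set (fun y => (mem y t /\ name y) \/ y = x).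
  apply: or_set; last exact: one_set.
  by apply: separation; dfn_tac.
exists s; split; first by apply/hs; right.
have sub u p z y : z = op u p -> mem z y -> mem y t \/ y = x -> mem u t.
  move=> e zy yt; have zt : mem z t by case: yt zy => [yt /tt|->]; [apply|apply: xt].
  apply: (tt (upr u u)); first by apply/mem_upr; left.
  by apply: (tt z) => //; rewrite e; apply/mem_upr; left.
move=> y /hs ys z zy.
have [u [p [e [nu Pp]]]] : exists u p, z = op u p /\ name u /\ P p.
  by case: ys zy => [[_ ny]|->]; [apply: name_mem|apply: h].
exists u, p; split; first by apply/is_pairE.
split=> //; apply/hs; left; split=> //.
by apply: (sub _ _ _ _ e zy); case: ys => [[]|]; auto.
Qed.

Lemma name_ind (A : M -> Prop) : def1 A ->
  (forall x, name x -> (forall u p, mem (op u p) x -> A u) -> A x) ->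
  forall x, name x -> A x.
Proof.
move=> dA step; apply: (eps_ind_deep (d := 2)) => [|x IH nx]; first by dfn_tac.
apply: step => // u p h; have [nu _] := name_dom nx h.
exact: (below_op (d := 0) (IH _ h) (or_introl erefl)).
Qed.

Definition nup x y := upr (op x one) (op y one).
Definition nop x y := nup (nup x x) (nup x y).
Definition nsuc x := cup x (upr (op x one) (op x one)).

Lemma def_nup : fun2 nup.
Proof. by rewrite /nup; dfn_tac. Qed.
Hint Resolve def_nup : def.

Lemma def_nop : fun2 nop.
Proof. by rewrite /nop; dfn_tac. Qed.

Lemma name_nup x y : name x -> name y -> name (nup x y).
Proof.
by move=> nx ny; apply: name_intro => z /mem_upr[] ->; [exists x, one|exists y, one].
Qed.

Lemma name_nop x y : name x -> name y -> name (nop x y).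
Proof. by move=> *; apply: name_nup; apply: name_nup. Qed.

Lemma name_nsuc x : name x -> name (nsuc x).
Proof.
move=> nx; apply: name_intro => z /mem_cup[/(name_mem nx)|/mem_upr zz] //.
by exists x, one; split=> //; case: zz.
Qed.

Lemma name_emp : name emp.
Proof. by apply: name_intro => z /mem_emp. Qed.

(** [chk x] is the check name of [x]; as classes are not objects, the recursion goes
    through set-sized attempts. *)
Definition attempt f := forall e, mem e f -> exists x v, e = op x v /\
  (forall y, mem y x -> exists u, mem (op y u) f) /\
  (forall z, mem z v <-> exists y u, mem y x /\ mem (op y u) f /\ z = op u one).

Definition is_chk x v := exists f, attempt f /\ mem (op x v) f.

Lemma def_is_chk : def2 is_chk.
Proof. by rewrite /is_chk /attempt; dfn_tac. Qed.
Hint Resolve def_is_chk : def.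

Lemma is_chk_uniq x v v' : is_chk x v -> is_chk x v' -> v = v'.
Proof.
move: x v v'; apply: eps_ind => [|x IH v1 v2]; first by dfn_tac.
have half v v' : is_chk x v -> is_chk x v' -> forall z, mem z v -> mem z v'.
  move=> [f [af xf]] [f' [af' xf']] z.
  have [x1 [v1' [/op_inj[<- <-] [_ h]]]] := af _ xf.
  have [x2 [v2' [/op_inj[<- <-] [t' h']]]] := af' _ xf'.
  move=> /h[y [u [yx [yu ->]]]]; apply/h'; have [u' yu'] := t' _ yx.
  exists y, u'; split=> //; split=> //; congr op.
  by apply: (IH _ yx); [exists f|exists f'].
by move=> c1 c2; apply: ext => z; split; apply: half.
Qed.

Lemma is_chkE x v : is_chk x v -> (forall y, mem y x -> exists u, is_chk y u) /\
  (forall z, mem z v <-> exists y u, mem y x /\ is_chk y u /\ z = op u one).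
Proof.
move=> [f [af xf]]; have [x1 [v1 [/op_inj[<- <-] [t h]]]] := af _ xf.
split=> [y /t[u yu]|z]; first by exists u, f.
rewrite h; split=> -[y [u [yx [yu ->]]]].
  by exists y, u; split=> //; split=> //; exists f; split.
have [u' yu'] := t _ yx; exists y, u'; split=> //; split=> //.
by congr op; apply: (is_chk_uniq yu); exists f; split.
Qed.

Lemma is_chk_ex x : exists v, is_chk x v.
Proof.
move: x; apply: eps_ind => [|x IH]; first by dfn_tac.
have [t [tt xt]] := trans_sup x.
have [f hf] : is_set (fun e => exists y, mem y t /\ exists v, is_chk y v /\ e = op y v).
  apply: replacement; first by dfn_tac.
  by move=> y e e' _ [v [h ->]] [v' [h' ->]]; rewrite (is_chk_uniq h h').
have fE y v : mem (op y v) f <-> mem y t /\ is_chk y v.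
  rewrite hf; split=> [[y' [h [v' [h' /op_inj[-> ->]]]]]|[h h']] //.
  by exists y; split=> //; exists v.
have [v hv] : is_set (fun z => exists y, mem y x /\ exists u, is_chk y u /\ z = op u one).
  apply: replacement; first by dfn_tac.
  by move=> y e e' _ [u [h ->]] [u' [h' ->]]; rewrite (is_chk_uniq h h').
exists v, (cup f (upr (op x v) (op x v))); split; last first.
  by apply/mem_cup; right; apply/mem_upr; left.
have xx : ~ mem x x by exact: mem_irrefl.
have up y u : mem y x -> mem (op y u) (cup f (upr (op x v) (op x v))) <-> is_chk y u.
  move=> yx; rewrite mem_cup fE mem_upr; split=> [[[_ c]|ee]|c] //.
    by have /op_inj[e _] : op y u = op x v by [case: ee]; rewrite e in yx.
  by left; split=> //; apply: xt.
have up' y u : mem y t -> is_chk y u -> mem (op y u) (cup f (upr (op x v) (op x v))).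
  by move=> *; apply/mem_cup; left; apply/fE.
move=> e /mem_cup[/hf[y [yt [u [cu ->]]]]|/mem_upr ee].
  exists y, u; split=> //; have [h h'] := is_chkE cu; split.
    move=> y' y'y; have [u' cu'] := h _ y'y; exists u'; apply: up' => //.
    exact: tt yt.
  move=> z; rewrite h'; split=> -[y' [u' [y'y [hu' ->]]]]; exists y', u'; split=> //; split=> //.
    by apply: up' => //; apply: tt yt.
  case/mem_cup: hu' => [/fE[]|/mem_upr hu'] //.
  have {hu'}/op_inj[e1 e2] : op y' u' = op x v by case: hu'.
  have [w cw] := h _ y'y; move: (cw); rewrite e1 e2 => /is_chkE[k1 k2].
  suff -> : v = w by rewrite -e1.
  apply: ext => z'; rewrite hv k2; split=> [[a [ax [b [ab ->]]]]|[a [b [ax [ab ->]]]]].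
    by exists a, b.
  by exists a; split=> //; exists b.
exists x, v; split; first by case: ee.
split=> [y yx|z].
  by have [u cu] := IH _ yx; exists u; apply/up.
rewrite hv; split=> [[y [yx [u [cu ->]]]]|[y [u [yx [/(up _ _ yx) cu ->]]]]].
  by exists y, u; split=> //; split=> //; apply/up.
by exists y; split=> //; exists u.
Qed.

Definition chk x := epsilon inhM (is_chk x).

Lemma chkP x : is_chk x (chk x).
Proof. by apply: epsilon_spec; apply: is_chk_ex. Qed.

Lemma mem_chk x z : mem z (chk x) <-> exists y, mem y x /\ z = op (chk y) one.
Proof.
have [_ ->] := is_chkE (chkP x); split=> [[y [u [yx [cu ->]]]]|[y [yx ->]]].
  by exists y; rewrite (is_chk_uniq cu (chkP y)).
by exists y, (chk y); split=> //; split=> //; apply: chkP.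
Qed.

Lemma def_chk : fun1 chk.
Proof.
apply: (dfn_ext (A := fun r => is_chk (r 1) (r 0))) => [r|]; last by dfn_tac.
by split=> [/is_chk_uniq|->]; [apply; apply: chkP|apply: chkP].
Qed.
Hint Resolve def_chk : def.

Lemma name_chk x : name (chk x).
Proof.
move: x; apply: eps_ind => [|x IH]; first by dfn_tac.
apply: name_intro => z /mem_chk[y [yx ->]]; exists (chk y), one.
by split=> //; split=> //; apply: IH.
Qed.

Lemma chk_upr x y : chk (upr x y) = nup (chk x) (chk y).
Proof.
apply: ext => z; rewrite mem_chk mem_upr; split.
  by move=> [w [/mem_upr[] -> ->]]; auto.
by case=> ->; [exists x|exists y]; rewrite mem_upr; auto.
Qed.

Lemma chk_op x y : chk (op x y) = nop (chk x) (chk y).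
Proof. by rewrite /op !chk_upr. Qed.

Lemma chk_emp : chk emp = emp.
Proof. by apply: ext => z; rewrite mem_chk; split=> [[y [/mem_emp]]|/mem_emp]. Qed.

Lemma chk_suc x : chk (suc x) = nsuc (chk x).
Proof.
apply: ext => z; rewrite mem_chk mem_cup mem_chk mem_upr; split.
  by move=> [y [/mem_suc[yx|->] ->]]; [left; exists y|right; left].
move=> [[y [yx ->]]|zz]; first by exists y; rewrite mem_suc; auto.
by exists x; split; [apply/mem_suc; right|case: zz].
Qed.

Lemma sq_set a : is_set (fun z => exists e, mem e a /\
  exists i x, e = op i x /\ z = op (nop (chk i) x) one).
Proof.
have dn := def_nop.
apply: replacement; first by dfn_tac.
by move=> y z z' _ [i [x [-> ->]]] [i' [x' [/op_inj[-> ->] ->]]].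
Qed.

(** [sq a] evaluates to the sequence of the values of the entries of [a]. *)
Definition sq a := collect (fun z => exists e, mem e a /\
  exists i x, e = op i x /\ z = op (nop (chk i) x) one).

Lemma mem_sq a z : mem z (sq a) <->
  exists i x, mem (op i x) a /\ z = op (nop (chk i) x) one.
Proof.
rewrite (collectE (sq_set a)); split=> [[e [ea [i [x [ee ->]]]]]|[i [x [h ->]]]].
  by exists i, x; rewrite -ee.
by exists (op i x); split=> //; exists i, x.
Qed.

Lemma def_sq : fun1 sq.
Proof.
have dn := def_nop.
apply: def1_fun1 => [a|]; [exact: sq_set|by dfn_tac].
Qed.

Lemma name_sq a : (forall i x, mem (op i x) a -> name x) -> name (sq a).
Proof.
move=> h; apply: name_intro => z /mem_sq[i [x [/h nx ->]]].
by exists (nop (chk i) x), one; split=> //; split=> //; apply: name_nop => //; apply: name_chk.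
Qed.

End Names.
#[export] Hint Resolve def_name def_nup def_nop def_chk def_sq : def.

(** * The forcing logic *)

Section AtomicClauses.
Context {M : class_structure} {hM : GBC M}.
Variables (Le : M -> Prop) (E : M -> M -> M -> Prop).

Definition amem p x y := dense_below Le p (fun q =>
  exists u r, cs_mem (op u r) y /\ rel2 Le q r /\ E q x u).

Definition asub p x y := forall u r q', cs_mem (op u r) x ->
  rel2 Le q' p -> rel2 Le q' r -> exists q, rel2 Le q q' /\ amem q u y.

End AtomicClauses.

Record atomic_forcing (M : class_structure) (hM : GBC M) := AtomicForcing {
  af_P : M -> Prop;
  af_Le : M -> Prop;
  af_one : M;
  af_notion : class_forcing_notion af_P af_Le af_one;
  af_eq : M -> M -> M -> Prop;
  af_def : def3 af_eq;
  af_eqP : forall p x y, is_name af_P x -> is_name af_P y -> af_P p ->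
    af_eq p x y <-> asub af_Le af_eq p x y /\ asub af_Le af_eq p y x }.

Section Forcing.
Context {M : class_structure} {hM : GBC M} (S : atomic_forcing hM).
Local Notation mem := (@cs_mem M).
Local Notation P := (af_P S).
Local Notation le := (rel2 (af_Le S)).
Local Notation one := (af_one S).
Local Notation aeq := (af_eq S).
Local Notation amem := (amem (af_Le S) aeq).
Local Notation asub := (asub (af_Le S) aeq).
Implicit Types (p q r : M).

Record name := Name { nv :> M; nvP : is_name P nv }.
Implicit Types (x y z w : name) (u v : M).

Let cP : cs_class P := cf_class (af_notion S).

Lemma le_l p q : le p q -> P p.
Proof. by move/(cf_le_dom (af_notion S)) => []. Qed.

Lemma le_r p q : le p q -> P q.
Proof. by move/(cf_le_dom (af_notion S)) => []. Qed.

Lemma le_refl p : P p -> le p p.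
Proof. exact: (cf_refl (af_notion S)). Qed.

Lemma le_trans p q r : le p q -> le q r -> le p r.
Proof. exact: (cf_trans (af_notion S)). Qed.

Lemma le_one p : P p -> le p one.
Proof. exact: (cf_top (af_notion S)). Qed.

(** Truth values of the forcing logic: classes of conditions closed downwards and
    under density.  With names as terms they form the [logic] [frcL] below, in which
    the notions of Defs.v can be read directly. *)
Record ro := Ro {
  ro_at :> M -> Prop;
  ro_mono : forall p q, le q p -> ro_at p -> ro_at q;
  ro_dense : forall p, P p ->
    (forall q, le q p -> exists r, le r q /\ ro_at r) -> ro_at p }.
Implicit Types (A B C : ro).

Lemma dense_mono (A : M -> Prop) p q : le q p ->
  dense_below (af_Le S) p A -> dense_below (af_Le S) q A.
Proof. by move=> qp h r rq; apply: h; apply: le_trans qp. Qed.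

Lemma dense_dense (A : M -> Prop) p :
  (forall q, le q p -> exists r, le r q /\ dense_below (af_Le S) r A) ->
  dense_below (af_Le S) p A.
Proof.
move=> h q /h[r [rq hr]]; have [t [tr At]] := hr r (le_refl (le_l rq)).
by exists t; split=> //; apply: le_trans rq.
Qed.

Definition denseR (A : M -> Prop) : ro.
Proof.
by exists (fun p => dense_below (af_Le S) p A) => [p q /dense_mono|p _]; [apply|apply: dense_dense].
Defined.

Lemma eqE p x y : P p -> aeq p x y <-> asub p x y /\ asub p y x.
Proof. by move=> pp; apply: af_eqP => //; apply: nvP. Qed.

Lemma aeq_mono p q x y : le q p -> aeq p x y -> aeq q x y.
Proof.
move=> qp; have pp := le_r qp; have pq := le_l qp.
rewrite !eqE //.
have h a b : asub p a b -> asub q a b.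
  by move=> h u r q' ur q'q q'r; apply: h ur _ q'r; apply: le_trans qp.
by case=> *; split; apply: h.
Qed.

Lemma aeq_dense p x y : P p ->
  (forall q, le q p -> exists r, le r q /\ aeq r x y) -> aeq p x y.
Proof.
move=> pp h; rewrite eqE //; split=> u r q' ur q'p q'r; have [q [qq' e]] := h _ q'p.
  move: e; rewrite (eqE _ _ (le_l qq')).
  case=> h' _; have [t [tq ut]] := h' u r q ur (le_refl (le_l qq')) (le_trans qq' q'r).
  by exists t; split=> //; apply: le_trans qq'.
move: e; rewrite (eqE _ _ (le_l qq')).
case=> _ h'; have [t [tq ut]] := h' u r q ur (le_refl (le_l qq')) (le_trans qq' q'r).
by exists t; split=> //; apply: le_trans qq'.
Qed.

Definition eqR x y : ro := @Ro (fun p => aeq p x y)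
  (fun p q h => @aeq_mono p q x y h) (fun p h => @aeq_dense p x y h).

Definition memR x y : ro := denseR (fun q =>
  exists u r, mem (op u r) y /\ le q r /\ aeq q x u).

Definition predR (R : M -> Prop) x : ro := denseR (fun q =>
  exists u r, R (op u r) /\ le q r /\ aeq q x u).

Definition andR A B : ro.
Proof.
exists (fun p => A p /\ B p) => [p q qp []|p pp h].
  by split; [apply: ro_mono qp _|apply: ro_mono qp _].
by split; apply: ro_dense => // q /h[r [rq []]]; exists r.
Defined.

Definition orR A B : ro := denseR (fun q => A q \/ B q).

Lemma imp_mono A B p q : le q p ->
  (forall r, le r p -> A r -> B r) -> forall r, le r q -> A r -> B r.
Proof. by move=> qp h r rq; apply: h; apply: le_trans qp. Qed.

Definition impR A B : ro.
Proof.
exists (fun p => forall q, le q p -> A q -> B q) => [p q|p pp h q qp Aq].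
  exact: imp_mono.
apply: ro_dense; first exact: le_l qp.
move=> r rq; have [t [tr ht]] := h r (le_trans rq qp).
exists t; split=> //; apply: ht; first exact: le_refl (le_l tr).
by apply: ro_mono (le_trans tr rq) Aq.
Defined.

Definition iffR A B : ro := andR (impR A B) (impR B A).

Definition notR A : ro.
Proof.
exists (fun p => forall q, le q p -> ~ A q) => [p q qp h r rq|p pp h q qp Aq].
  by apply: h; apply: le_trans qp.
have [r [rq nr]] := h q qp; apply: (nr r); first exact: le_refl (le_l rq).
exact: ro_mono rq Aq.
Defined.

Definition allR (A : name -> ro) : ro.
Proof.
exists (fun p => forall x, A x p) => [p q qp h x|p pp h x].
  by apply: ro_mono qp _.
by apply: ro_dense => // q /h[r [rq hr]]; exists r.
Defined.

Definition exR (A : name -> ro) : ro := denseR (fun q => exists x, A x q).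

Definition frcL (G : nat -> M -> Prop) : logic := @Logic name ro eqR memR
  (fun k => predR (G k)) andR orR impR iffR notR allR exR.

Lemma dense_elim (D : M -> Prop) B p : P p -> dense_below (af_Le S) p D ->
  (forall q, le q p -> D q -> B q) -> B p.
Proof.
move=> pp hD h; apply: ro_dense => // q qp; have [r [rq Dr]] := hD q qp.
by exists r; split=> //; apply: h => //; apply: le_trans qp.
Qed.

Lemma dense_intro (D : M -> Prop) p : P p -> (forall q, le q p -> D q) ->
  dense_below (af_Le S) p D.
Proof. by move=> pp h q qp; exists q; split; [apply: le_refl (le_l qp)|apply: h]. Qed.

Lemma ex_elim (A : name -> ro) B p : P p -> exR A p ->
  (forall q, le q p -> forall x, A x q -> B q) -> B p.
Proof. by move=> pp h k; apply: (dense_elim pp h) => q qp [x]; apply: k. Qed.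

Lemma or_elim A B C p : P p -> orR A B p ->
  (forall q, le q p -> A q -> C q) -> (forall q, le q p -> B q -> C q) -> C p.
Proof. by move=> pp h k l; apply: (dense_elim pp h) => q qp []; [apply: k|apply: l]. Qed.

Lemma ex_intro (A : name -> ro) x p : P p -> A x p -> exR A p.
Proof. by move=> pp h; apply: dense_intro => // q qp; exists x; apply: ro_mono h. Qed.

Lemma or_introl A B p : P p -> A p -> orR A B p.
Proof. by move=> pp h; apply: dense_intro => // q qp; left; apply: ro_mono h. Qed.

Lemma or_intror A B p : P p -> B p -> orR A B p.
Proof. by move=> pp h; apply: dense_intro => // q qp; right; apply: ro_mono h. Qed.

Lemma iff_intro A B p : (forall q, le q p -> A q -> B q) ->
  (forall q, le q p -> B q -> A q) -> iffR A B p.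
Proof. by []. Qed.

Lemma iff_l A B p : P p -> iffR A B p -> A p -> B p.
Proof. by move=> pp [h _]; apply: h; apply: le_refl. Qed.

Lemma iff_r A B p : P p -> iffR A B p -> B p -> A p.
Proof. by move=> pp [_ h]; apply: h; apply: le_refl. Qed.

(** ** Equality *)

Lemma eq_sym x y p : P p -> eqR x y p -> eqR y x p.
Proof. by move=> pp /(eqE _ _ pp)[h1 h2]; apply/(eqE _ _ pp). Qed.

Lemma name_ind_R (A : M -> Prop) : def1 A ->
  (forall x, (forall u r, mem (op u r) x -> A u) -> A x) -> forall x, A x.
Proof.
move=> dA h [x nx] /=; move: x nx; apply: (name_ind cP) => // x nx IH.
by apply: (h (Name nx)).
Qed.

Lemma sub_name x u r : mem (op u r) x -> exists u' : name, u = u'.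
Proof. by move/(name_dom (nvP x)) => [nu _]; exists (Name nu). Qed.

Let def_eq : def3 aeq := af_def S.

Lemma eq_refl x p : P p -> eqR x x p.
Proof.
move: x p; apply: (name_ind_R (A := fun x : M => forall p, P p -> aeq p x x)).
  by dfn_tac.
move=> x IH p pp.
have h : asub p x x.
  move=> u r q' ur q'p q'r; exists q'; have pq := le_l q'r; split; first exact: le_refl.
  apply: dense_intro => // q qq'; exists u, r; split=> //.
  by split; [apply: le_trans q'r|apply: (IH u r ur); apply: le_l qq'].
by apply/(eqE _ _ pp).
Qed.

Lemma mem_sub x u r p : mem (op u r) x -> le p r -> amem p u x.
Proof.
move=> ur pr; have [u' eu] := sub_name ur; subst u; have pp := le_l pr.
apply: dense_intro => // q qp; exists u', r; split=> //; split; first exact: le_trans pr.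
exact: eq_refl (le_l qp).
Qed.

Lemma sub_elim x y u r p q : P p -> eqR x y p -> mem (op u r) x -> le q p -> le q r ->
  amem q u y.
Proof.
move=> pp /(eqE _ _ pp)[h _] ur qp qr.
apply: dense_dense => t tq; have [s [st hs]] := h u r t ur (le_trans tq qp) (le_trans tq qr).
by exists s.
Qed.

Lemma eq_trans y x z p : P p -> eqR x y p -> eqR y z p -> eqR x z p.
Proof.
suff H : forall x, forall y z : M, is_name P y -> is_name P z -> forall p, P p ->
    aeq p x y -> aeq p y z -> aeq p x z.
  by move=> pp; apply: H => //; apply: nvP.
move=> {x y z p}; apply: (name_ind_R (A := fun x : M => forall y z : M, is_name P y ->
  is_name P z -> forall p, P p -> aeq p x y -> aeq p y z -> aeq p x z)).
  by dfn_tac.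
move=> x IH y0 z0 ny nz p pp xy yz.
pose y := Name ny; pose z := Name nz.
have asub_le a c : (forall u : name, forall r q, mem (op u r) a -> le q p -> le q r ->
    amem q u c) -> is_name P a -> asub p a c.
  move=> h na u r q ur qp qr; have [u' e] := @sub_name (Name na) _ _ ur; subst u.
  by exists q; split; [apply: le_refl (le_l qp)|apply: h ur qp qr].
apply/(eqE x z pp); split.
  apply: (asub_le x z _ (nvP x)).
  move=> u r q ur qp qr.
  have hu : amem q u y by apply: (@sub_elim x y u r p).
  apply: dense_dense => t tq; have [s [st [v [r' [vr' [sr' uv]]]]]] := hu t tq.
  have sp := le_trans st (le_trans tq qp).
  have hv : amem s v z by apply: (@sub_elim y z v r' p).
  exists s; split=> // a as_; have [b [ba [w [r'' [wr'' [br'' vw]]]]]] := hv a as_.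
  have [v' ev] := @sub_name y _ _ vr'; have [w' ew] := @sub_name z _ _ wr''; subst v w.
  exists b; split=> //; exists w', r''; split=> //; split=> //.
  have uv' : aeq b u v' by apply: (@aeq_mono s b u v' (le_trans ba as_) uv).
  exact: (IH _ _ ur v' w' (nvP _) (nvP _) _ (le_l ba) uv' vw).
apply: (asub_le z x _ nz).
move=> w r q wr qp qr.
have zy : eqR z y p by apply: eq_sym.
have yx : eqR y x p by apply: (@eq_sym x y).
have hw : amem q w y by apply: (@sub_elim z y w r p).
apply: dense_dense => t tq; have [s [st [v [r' [vr' [sr' wv]]]]]] := hw t tq.
have sp := le_trans st (le_trans tq qp).
have hv : amem s v x by apply: (@sub_elim y x v r' p).
exists s; split=> // a as_; have [b [ba [u [r'' [ur'' [br'' vu]]]]]] := hv a as_.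
have [v' ev] := @sub_name y _ _ vr'; have [u' eu] := sub_name ur''; subst v u.
exists b; split=> //; exists u', r''; split=> //; split=> //.
apply: (@eq_sym u' w) (le_l ba) _.
have uv : aeq b u' v' := @eq_sym v' u' b (le_l ba) vu.
have vw : aeq b v' w.
  exact: (@eq_sym w v' b (le_l ba) (@aeq_mono s b w v' (le_trans ba as_) wv)).
exact: (IH _ _ ur'' v' w (nvP _) (nvP _) _ (le_l ba) uv vw).
Qed.

Definition names_only (R : M -> Prop) := forall u r, R (op u r) -> is_name P u.

Lemma predR_congr R x y p : names_only R -> P p -> eqR x y p ->
  predR R x p -> predR R y p.
Proof.
move=> hR pp xy h q qp; have [r [rq [u [t [ut [rt xu]]]]]] := h q qp.
exists r; split=> //; exists u, t; split=> //; split=> //.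
apply: (@eq_trans x y (Name (hR _ _ ut)) _ (le_l rq) _ xu).
by apply: eq_sym; [apply: le_l rq|apply: ro_mono xy; apply: le_trans qp].
Qed.

Lemma mem_congr_l x y z p : P p -> eqR x y p -> memR x z p -> memR y z p.
Proof.
move=> pp xy; apply: (predR_congr (R := fun e => mem e z)) pp xy.
by move=> u r /(name_dom (nvP z))[].
Qed.

Lemma mem_congr_r x y z p : P p -> eqR y z p -> memR x y p -> memR x z p.
Proof.
move=> pp yz h; apply: (dense_elim pp h) => q qp [u [r [ur [qr xu]]]].
have [u' e] := sub_name ur; subst u.
apply: (@mem_congr_l u' x); [exact: le_l qr|apply: eq_sym => //; exact: le_l qr|].
exact: (sub_elim pp yz ur qp qr).
Qed.

Lemma mem_elim x w B p : P p -> memR w x p ->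
  (forall q (u : name) r, le q p -> mem (op u r) x -> le q r -> eqR w u q -> B q) -> B p.
Proof.
move=> pp h k; apply: (dense_elim pp h) => q qp [u [r [ur [qr e]]]].
by have [u' eu] := sub_name ur; subst u; apply: k qp ur qr e.
Qed.

Lemma eq_ext x y p : P p -> (forall q w, le q p -> memR w x q -> memR w y q) ->
  (forall q w, le q p -> memR w y q -> memR w x q) -> eqR x y p.
Proof.
move=> pp h1 h2; apply/(eqE _ _ pp); split=> u r q ur qp qr.
  have [u' e] := sub_name ur; subst u; exists q; split; first exact: le_refl (le_l qp).
  by apply: h1 => //; apply: mem_sub ur qr.
have [u' e] := sub_name ur; subst u; exists q; split; first exact: le_refl (le_l qp).
by apply: h2 => //; apply: mem_sub ur qr.
Qed.

Lemma eq_nv x y p : P p -> nv x = nv y -> eqR x y p.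
Proof. by move=> pp e; have := eq_refl x pp; rewrite /= {2}e. Qed.

End Forcing.

(** * Set theory in the forcing logic *)

Ltac down qp := match type of qp with rel2 _ ?q ?p =>
  repeat match goal with H : ro_at _ p |- _ => apply (ro_mono qp) in H end end.

Section ForcedSets.
Context {M : class_structure} {hM : GBC M} {S : atomic_forcing hM}.
Context {G : nat -> M -> Prop}.
Local Notation L := (frcL S G).
Local Notation mem := (@cs_mem M).
Local Notation P := (af_P S).
Local Notation le := (rel2 (af_Le S)).
Local Notation one := (af_one S).
Local Notation name := (name S).
Local Notation eqR := (@eqR M hM S).
Local Notation memR := (@memR M hM S).
Implicit Types (p q r : M) (x y z w : name) (B : ro S).

Let cP : cs_class P := cf_class (af_notion S).
Let one_P : P one := cf_one (af_notion S).

Definition uprN x y : name := Name (name_nup cP one_P (nvP x) (nvP y)).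
Definition opN x y : name := Name (name_nop cP one_P (nvP x) (nvP y)).
Definition sucN x : name := Name (name_nsuc cP one_P (nvP x)).
Definition empN : name := Name (name_emp cP).
Definition chkN (a : M) : name := Name (name_chk cP one_P a).

Lemma mem_lit (u : name) x p : P p -> mem (op u one) x -> memR u x p.
Proof. by move=> pp h; apply: (mem_sub h); apply: le_one. Qed.

Lemma mem_uprN_l w x y p : P p -> eqR w x p -> memR w (uprN x y) p.
Proof.
move=> pp e; apply: (mem_congr_l pp (eq_sym pp e)); apply: mem_lit => //.
by apply/mem_upr; left.
Qed.

Lemma mem_uprN_r w x y p : P p -> eqR w y p -> memR w (uprN x y) p.
Proof.
move=> pp e; apply: (mem_congr_l pp (eq_sym pp e)); apply: mem_lit => //.
by apply/mem_upr; right.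
Qed.

Lemma mem_uprN_elim w x y B p : P p -> memR w (uprN x y) p ->
  (forall q, le q p -> eqR w x q -> B q) ->
  (forall q, le q p -> eqR w y q -> B q) -> B p.
Proof.
move=> pp h k l; apply: (mem_elim pp h) => q u r qp ur qr e.
have pq := le_l qp.
case/mem_upr: ur => /op_inj[e' _]; [apply: k|apply: l] => //;
  by apply: (eq_trans pq e); apply: eq_nv.
Qed.

Lemma uprN_sub x y x' y' w p : P p -> eqR x x' p -> eqR y y' p ->
  memR w (uprN x y) p -> memR w (uprN x' y') p.
Proof.
move=> pp e e' h; apply: (mem_uprN_elim pp h) => q qp e1; down qp.
  by apply: mem_uprN_l; [exact: le_l qp|apply: (eq_trans (le_l qp) e1)].
by apply: mem_uprN_r; [exact: le_l qp|apply: (eq_trans (le_l qp) e1)].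
Qed.

Lemma uprN_congr x y x' y' p : P p -> eqR x x' p -> eqR y y' p ->
  eqR (uprN x y) (uprN x' y') p.
Proof.
move=> pp e e'; apply: eq_ext => // q w qp; have pq := le_l qp; down qp.
  exact: uprN_sub.
by apply: uprN_sub => //; apply: eq_sym.
Qed.

Lemma opN_congr x y x' y' p : P p -> eqR x x' p -> eqR y y' p ->
  eqR (opN x y) (opN x' y') p.
Proof.
move=> pp e e'.
have : eqR (uprN (uprN x x) (uprN x y)) (uprN (uprN x' x') (uprN x' y')) p.
  by apply: uprN_congr => //; apply: uprN_congr.
by [].
Qed.

Lemma uprN_inj x y z p : P p -> eqR (uprN x y) (uprN x z) p -> eqR y z p.
Proof.
move=> pp e.
have h : memR y (uprN x z) p.
  by apply: (mem_congr_r pp e); apply: mem_uprN_r => //; apply: eq_refl.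
apply: (mem_uprN_elim pp h) => // q qp yx; have pq := le_l qp; down qp.
have h' : memR z (uprN x y) q.
  apply: (mem_congr_r pq (eq_sym pq e)).
  by apply: mem_uprN_r => //; apply: eq_refl.
apply: (mem_uprN_elim pq h') => r rq zz; have pr := le_l rq; down rq.
  by apply: (eq_trans pr yx); apply: eq_sym.
exact: eq_sym.
Qed.

Lemma opN_inj x y x' y' p : P p -> eqR (opN x y) (opN x' y') p ->
  eqR x x' p /\ eqR y y' p.
Proof.
move=> pp e.
have {}e : eqR (uprN (uprN x x) (uprN x y)) (uprN (uprN x' x') (uprN x' y')) p by [].
have exx : eqR x x' p.
  have h : memR (uprN x' x') (uprN (uprN x x) (uprN x y)) p.
    apply: (mem_congr_r pp (eq_sym pp e)).
    by apply: mem_uprN_l => //; apply: eq_refl.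
  have xu z q : P q -> memR x (uprN x z) q.
    by move=> pq; apply: mem_uprN_l => //; apply: eq_refl.
  apply: (mem_uprN_elim pp h) => q qp e'; have pq := le_l qp;
    apply: (mem_uprN_elim pq (mem_congr_r pq (eq_sym pq e') (xu _ _ pq))) => //.
split=> //; apply: (uprN_inj pp (x := x)).
apply: (eq_trans pp (y := uprN x' y')).
  apply: (uprN_inj pp (x := uprN x x)).
  apply: (eq_trans pp e); apply: uprN_congr => //; last exact: eq_refl.
  by apply: uprN_congr => //; apply: eq_sym.
by apply: uprN_congr; [|apply: eq_sym|apply: eq_refl].
Qed.

Lemma is_upairR z x y p : P p -> @is_upair L z x y p <-> eqR z (uprN x y) p.
Proof.
move=> pp; split=> [h|e w].
  apply: eq_ext => // q w qp hw; have pq := le_l qp; have [h1 h2] := h w.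
    apply: (or_elim pq (h1 _ qp hw)) => r rq e; have pr := le_l rq.
      exact: mem_uprN_l.
    exact: mem_uprN_r.
  apply: (h2 _ qp); apply: (mem_uprN_elim pq hw) => r rq e; have pr := le_l rq.
    exact: or_introl.
  exact: or_intror.
apply: iff_intro => q qp h; have pq := le_l qp; down qp.
  apply: (mem_uprN_elim pq (mem_congr_r pq e h)) => r rq e'; have pr := le_l rq.
    exact: or_introl.
  exact: or_intror.
apply: (mem_congr_r pq (eq_sym pq e)).
apply: (or_elim pq h) => r rq e'; have pr := le_l rq.
  exact: mem_uprN_l.
exact: mem_uprN_r.
Qed.

Lemma is_pairR z x y p : P p -> @is_pair L z x y p <-> eqR z (opN x y) p.
Proof.
move=> pp; split=> [h|e]; last first.
  apply: (ex_intro (x := uprN x x)) => //; apply: (ex_intro (x := uprN x y)) => //.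
  by split; [|split]; apply/is_upairR => //; apply: eq_refl.
apply: (ex_elim pp h) => q qp u h1; apply: (ex_elim (le_l qp) h1) => r rq v [h2 [h3 h4]].
have pr := le_l rq; move/(is_upairR _ _ _ pr): h2; move/(is_upairR _ _ _ pr): h3.
move/(is_upairR _ _ _ pr): h4 => h4 h3 h2.
exact: (eq_trans pr h4 (uprN_congr pr h2 h3)).
Qed.

Lemma at_R a i x p : P p -> @at_ L a i x p <-> memR (opN i x) a p.
Proof.
move=> pp; split=> [h|h]; last first.
  by apply: (ex_intro (x := opN i x)) => //; split=> //; apply/is_pairR => //; apply: eq_refl.
apply: (ex_elim pp h) => q qp z [/(is_pairR _ _ _ (le_l qp)) e zm].
exact: (mem_congr_l (le_l qp) e).
Qed.

Lemma mem_emp_elim w B p : P p -> memR w empN p -> B p.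
Proof. by move=> pp h; apply: (mem_elim pp h) => q u r _ /mem_emp. Qed.

Lemma is_emptyR x p : P p -> @is_empty L x p <-> eqR x empN p.
Proof.
move=> pp; split=> [h|e w q qp h].
  apply: eq_ext => // q w qp hw; first by case: (h w q qp hw).
  exact: (mem_emp_elim _ (le_l qp) hw).
have [r [_ [u [s [/mem_emp]]]]] //:= mem_congr_r (le_l qp) (ro_mono qp e) h (le_refl (le_l qp)).
Qed.

Lemma mem_sucN_l w x p : P p -> memR w x p -> memR w (sucN x) p.
Proof.
move=> pp h; apply: (mem_elim pp h) => q u r qp ur qr e; have pq := le_l qp.
apply: (mem_congr_l pq (eq_sym pq e)); apply: (mem_sub (r := r)) => //.
by apply/mem_cup; left.
Qed.

Lemma mem_sucN_r w x p : P p -> eqR w x p -> memR w (sucN x) p.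
Proof.
move=> pp e; apply: (mem_congr_l pp (eq_sym pp e)); apply: mem_lit => //.
by apply/mem_cup; right; apply/mem_upr; left.
Qed.

Lemma mem_sucN_elim w x B p : P p -> memR w (sucN x) p ->
  (forall q, le q p -> memR w x q -> B q) ->
  (forall q, le q p -> eqR w x q -> B q) -> B p.
Proof.
move=> pp h k l; apply: (mem_elim pp h) => q u r qp ur qr e; have pq := le_l qp.
case/mem_cup: ur => [ur|/mem_upr ur].
  by apply: k => //; apply: (mem_congr_l pq (eq_sym pq e)); apply: mem_sub ur qr.
have /op_inj[e' _] : op u r = op x one by case: ur.
by apply: l => //; apply: (eq_trans pq e); apply: eq_nv.
Qed.

Lemma is_succR y x p : P p -> @is_succ L y x p <-> eqR y (sucN x) p.
Proof.
move=> pp; split=> [h|e w].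
  apply: eq_ext => // q w qp hw; have pq := le_l qp; have [h1 h2] := h w.
    apply: (or_elim pq (h1 _ qp hw)) => r rq e; have pr := le_l rq.
      exact: mem_sucN_l.
    exact: mem_sucN_r.
  apply: (h2 _ qp); apply: (mem_sucN_elim pq hw) => r rq e; have pr := le_l rq.
    exact: or_introl.
  exact: or_intror.
apply: iff_intro => q qp h; have pq := le_l qp; down qp.
  apply: (mem_sucN_elim pq (mem_congr_r pq e h)) => r rq e'; have pr := le_l rq.
    exact: or_introl.
  exact: or_intror.
apply: (mem_congr_r pq (eq_sym pq e)).
apply: (or_elim pq h) => r rq e'; have pr := le_l rq.
  exact: mem_sucN_l.
exact: mem_sucN_r.
Qed.

Lemma sucN_sub x y w p : P p -> eqR x y p -> memR w (sucN x) p -> memR w (sucN y) p.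
Proof.
move=> pp e h; apply: (mem_sucN_elim pp h) => q qp h'; have pq := le_l qp; down qp.
  by apply: mem_sucN_l => //; apply: mem_congr_r e _.
by apply: mem_sucN_r => //; apply: eq_trans e.
Qed.

Lemma sucN_congr x y p : P p -> eqR x y p -> eqR (sucN x) (sucN y) p.
Proof.
move=> pp e; apply: eq_ext => // q w qp; have pq := le_l qp; down qp.
  exact: sucN_sub.
by apply: sucN_sub => //; apply: eq_sym.
Qed.

(** ** Check names *)

Lemma chk_intro (a b : M) p : P p -> mem a b -> memR (chkN a) (chkN b) p.
Proof. by move=> pp ab; apply: mem_lit => //; apply/mem_chk => //; exists a. Qed.

Lemma chk_elim w (a : M) B p : P p -> memR w (chkN a) p ->
  (forall q b, le q p -> mem b a -> eqR w (chkN b) q -> B q) -> B p.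
Proof.
move=> pp h k; apply: (mem_elim pp h) => q u r qp /mem_chk ur qr e.
have [b [ba /op_inj[e' _]]] := ur.
apply: (k q b) => //; apply: (eq_trans (le_l qp) e); apply: eq_nv => //.
exact: le_l qp.
Qed.

Lemma chk_mem_dense w (a : M) p : P p -> memR w (chkN a) p ->
  exists q b, le q p /\ mem b a /\ eqR w (chkN b) q.
Proof.
move=> pp h; have [q [qp [u [r [/mem_chk ur [qr e]]]]]] := h p (le_refl pp).
have [b [ba /op_inj[e' _]]] := ur.
by exists q, b; split=> //; split=> //; move: e; rewrite e'.
Qed.

Lemma chk_inj (a b : M) p : P p -> eqR (chkN a) (chkN b) p -> a = b.
Proof.
have dE := af_def S.
move: a b p; apply: (eps_ind (A := fun a => forall b p, P p ->
  af_eq S p (chk one a) (chk one b) -> a = b)).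
  by dfn_tac.
move=> a IH b p pp e0; have e : eqR (chkN a) (chkN b) p by exact: e0.
apply: ext => c; split=> hc.
  have h := mem_congr_r pp e (chk_intro pp hc).
  have [q [d [qp [db e']]]] := chk_mem_dense pp h.
  by rewrite (IH c hc d q (le_l qp) e').
have h := mem_congr_r pp (eq_sym pp e) (chk_intro pp hc).
have [q [d [qp [da e']]]] := chk_mem_dense pp h.
by rewrite -(IH d da c q (le_l qp) (eq_sym (le_l qp) e')).
Qed.

Lemma chkN_op (a b : M) p : P p -> eqR (chkN (op a b)) (opN (chkN a) (chkN b)) p.
Proof. by move=> pp; apply: eq_nv => //; apply: chk_op. Qed.

Lemma chkN_suc (a : M) p : P p -> eqR (chkN (suc a)) (sucN (chkN a)) p.
Proof. by move=> pp; apply: eq_nv => //; apply: chk_suc. Qed.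

Lemma chkN_emp p : P p -> eqR (chkN emp) empN p.
Proof. by move=> pp; apply: eq_nv => //; apply: chk_emp. Qed.

Definition nodeN (t : nat) x y := opN (chkN (num t)) (opN x y).

Lemma is_numR k x p : P p -> @is_num L k x p <-> eqR x (chkN (num k)) p.
Proof.
elim: k x p => [|k IH] x p pp.
  split=> [/(is_emptyR _ pp) h|h].
    exact: (eq_trans pp h (eq_sym pp (chkN_emp pp))).
  by apply/(is_emptyR _ pp); apply: (eq_trans pp h (chkN_emp pp)).
split=> [h|h]; last first.
  apply: (ex_intro (x := chkN (num k))) => //; split; first by apply/IH => //; apply: eq_refl.
  by apply/(is_succR _ _ pp); apply: (eq_trans pp h (chkN_suc _ pp)).
apply: (ex_elim pp h) => q qp y [/(IH _ _ (le_l qp)) h1 /(is_succR _ _ (le_l qp)) h2].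
apply: (eq_trans (le_l qp) h2); apply: (eq_trans (le_l qp) (sucN_congr (le_l qp) h1)).
by apply: eq_sym (chkN_suc _ _); apply: le_l qp.
Qed.

Lemma is_nodeR (t : nat) c x y p : P p -> @is_node L t c x y p <-> eqR c (nodeN t x y) p.
Proof.
move=> pp; split=> [h|h]; last first.
  apply: (ex_intro (x := chkN (num t))) => //; apply: (ex_intro (x := opN x y)) => //.
  split; first by apply/is_numR => //; apply: eq_refl.
  by split; apply/is_pairR => //; apply: eq_refl.
apply: (ex_elim pp h) => q qp o h1; apply: (ex_elim (le_l qp) h1) => r rq u [h2 [h3 h4]].
have pr := le_l rq; move/(is_numR _ _ pr): h2 => h2.
move/(is_pairR _ _ _ pr): h3 => h3; move/(is_pairR _ _ _ pr): h4 => h4.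
exact: (eq_trans pr h4 (opN_congr pr h2 h3)).
Qed.

Lemma c_predR k c x p : P p -> @c_pred L k c x p <-> eqR c (nodeN 2 (chkN (num k)) x) p.
Proof.
move=> pp; split=> [h|h]; last first.
  apply: (ex_intro (x := chkN (num k))) => //; split.
    by apply/is_numR => //; apply: eq_refl.
  exact/is_nodeR.
apply: (ex_elim pp h) => q qp y [/(is_numR _ _ (le_l qp)) h1 /(is_nodeR _ _ _ _ (le_l qp)) h2].
have pq := le_l qp; apply: (eq_trans pq h2).
by apply: opN_congr; [|exact: eq_refl|apply: opN_congr; [| |exact: eq_refl]].
Qed.

Lemma nodeN_congr (t : nat) x y x' y' p : P p -> eqR x x' p -> eqR y y' p ->
  eqR (nodeN t x y) (nodeN t x' y') p.
Proof. by move=> pp e e'; apply: opN_congr => //; [apply: eq_refl|apply: opN_congr]. Qed.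

Lemma nodeN_inj (t t' : nat) x y x' y' p : P p -> eqR (nodeN t x y) (nodeN t' x' y') p ->
  [/\ t = t', eqR x x' p & eqR y y' p].
Proof.
move=> pp /(opN_inj pp)[/(chk_inj pp)/num_inj e /(opN_inj pp)[]].
by split.
Qed.

Lemma chkN_node (t : nat) (a b : M) p : P p ->
  eqR (chkN (node t a b)) (nodeN t (chkN a) (chkN b)) p.
Proof.
move=> pp; apply: (eq_trans pp (chkN_op _ _ pp)).
by apply: opN_congr => //; [apply: eq_refl|apply: chkN_op].
Qed.

Lemma any_belowR_intro k (A : nat -> ro S) (i : nat) p : P p -> i < k -> A i p ->
  @any_below L k A p.
Proof.
move=> pp; elim: k => [|k IH] //; rewrite ltnS leq_eqVlt => /orP[/eqP <-|ik] h.
  exact: or_intror.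
by apply: or_introl => //; apply: IH.
Qed.

Lemma any_belowR_elim k (A : nat -> ro S) B p : P p -> @any_below L k A p ->
  (forall q (i : nat), le q p -> i < k -> A i q -> B q) -> B p.
Proof.
elim: k p => [|k IH] p pp h K.
  apply: (ex_elim pp h) => q qp x h'; case: (h' q (le_refl (le_l qp))).
  exact: eq_refl (le_l qp).
apply: (or_elim pp h) => q qp h'.
  apply: (IH q (le_l qp) h') => r i rq ik; apply: (K r i); last exact: ltnW.
  exact: le_trans qp.
exact: (K q k).
Qed.

Lemma all_belowR k (A : nat -> ro S) p : P p ->
  @all_below L k A p <-> forall i : nat, i < k -> A i p.
Proof.
move=> pp; elim: k => [|k IH].
  by split=> // _ x; apply: eq_refl.
split=> [[/IH h1 h2] i|h].
  by rewrite ltnS leq_eqVlt => /orP[/eqP ->|] //; apply: h1.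
by split; [apply/IH => i ik; apply: h; apply: ltnW|apply: h].
Qed.

End ForcedSets.

(** * Numbers, sequences and formulas in the forcing logic *)

Record name_sequence (M : class_structure) (hM : GBC M) (S : atomic_forcing hM) := NameSeq {
  sv :> M;
  slen : M;
  sv_seq : @is_seq (sets M) sv slen;
  sv_name : forall i x, cs_mem (op i x) sv -> is_name (af_P S) x }.

Section ForcedCodes.
Context {M : class_structure} {hM : GBC M} {S : atomic_forcing hM}.
Context {G : nat -> M -> Prop}.
Local Notation L := (frcL S G).
Local Notation mem := (@cs_mem M).
Local Notation P := (af_P S).
Local Notation le := (rel2 (af_Le S)).
Local Notation one := (af_one S).
Local Notation name := (name S).
Local Notation nseq := (name_sequence S).
Local Notation eqR := (@eqR M hM S).
Local Notation memR := (@memR M hM S).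
Local Notation isnat := (@is_nat (sets M)).
Local Notation isseq := (@is_seq (sets M)).
Implicit Types (p q r : M) (x y z w : name) (B : ro S) (s : nseq).

Let cP : cs_class P := cf_class (af_notion S).
Let one_P : P one := cf_one (af_notion S).
Let cLe : cs_class (af_Le S) := cf_le_class (af_notion S).

Lemma is_transR x (a : M) p : P p -> (forall b c, mem c b -> mem b a -> mem c a) ->
  eqR x (chkN a) p -> @is_trans L x p.
Proof.
move=> pp h e y q qp yx w r rq wy; have pq := le_l qp; have pr := le_l rq.
have yb := mem_congr_r pq (ro_mono qp e) yx; down rq.
apply: (chk_elim pr yb) => t b tr ba yb'; have pt := le_l tr.
have wb := mem_congr_r pt yb' (ro_mono tr wy).
apply: (chk_elim pt wb) => v c vt cb wc; have pv := le_l vt.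
apply: (mem_congr_r pv (y := chkN a)).
  by apply: (eq_sym pv); apply: ro_mono e; apply: le_trans (le_trans vt tr) (le_trans rq qp).
apply: (mem_congr_l pv (eq_sym pv wc)); apply: chk_intro => //; exact: h ba.
Qed.

Lemma zero_or_succR x (a : M) p : P p -> (a = emp \/ exists j, a = suc j) ->
  eqR x (chkN a) p -> @zero_or_succ L x p.
Proof.
move=> pp h e; case: h => [h|[j h]]; rewrite h in e.
  apply: or_introl => //; apply/is_emptyR => //.
  exact: (eq_trans pp e (chkN_emp pp)).
apply: or_intror => //; apply: (ex_intro (x := chkN j)) => //; apply/is_succR => //.
exact: (eq_trans pp e (chkN_suc _ pp)).
Qed.

Lemma is_natR_up x (n : M) p : P p -> isnat n -> eqR x (chkN n) p -> @is_nat L x p.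
Proof.
move=> pp /natE[t [z h]] e; split; first exact: is_transR e.
split; first exact: zero_or_succR e.
move=> k q qp kx; have pq := le_l qp; down qp.
apply: (chk_elim pq (mem_congr_r pq e kx)) => r b rq /h[t' z'] e'; have pr := le_l rq.
by split; [exact: is_transR e'|exact: zero_or_succR e'].
Qed.

Lemma is_natR_down x B p : P p -> @is_nat L x p ->
  (forall q n, le q p -> isnat n -> eqR x (chkN n) q -> B q) -> B p.
Proof.
move=> pp [t [z h]] K.
have dE := af_def S.
have zs w q : le q p -> P q -> @zero_or_succ L w q ->
    (forall y q, le q p -> memR y x q -> memR y w q ->
      exists r n, le r q /\ isnat n /\ eqR y (chkN n) r) ->
    (forall y r, le r q -> memR y w r -> memR y x r) ->
    exists r n, le r q /\ isnat n /\ eqR w (chkN n) r.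
  move=> qp pq hz IH sub; have [r [rq []]] := hz q (le_refl pq).
    move=> /(is_emptyR _ (le_l rq)) e; exists r, emp; split=> //; split; first exact: nat0.
    exact: eq_trans (le_l rq) e (eq_sym (le_l rq) (chkN_emp (le_l rq))).
  move=> hj; have [r' [rr' [j /(is_succR _ _ (le_l rr')) e]]] := hj r (le_refl (le_l rq)).
  have pr' := le_l rr'; have r'p := le_trans rr' (le_trans rq qp).
  have jw : memR j w r'.
    by apply: (mem_congr_r pr' (eq_sym pr' e)); apply: mem_sucN_r => //; apply: eq_refl.
  have [r'' [n [h1 [nn e']]]] := IH j r' r'p (sub _ _ (le_trans rr' rq) jw) jw; have pr := le_l h1.
  exists r'', (suc n); split; first by apply: le_trans h1 (le_trans rr' rq).
  split; first exact: natS.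
  apply: (eq_trans pr (ro_mono h1 e)); apply: (eq_trans pr (sucN_congr pr e')).
  exact: eq_sym (chkN_suc _ pr).
have main : forall w, forall q, le q p -> memR w x q ->
    exists r n, le r q /\ isnat n /\ eqR w (chkN n) r.
  apply: (name_ind_R (A := fun w : M => forall q, le q p -> amem (af_Le S) (af_eq S) q w x ->
    exists r n, le r q /\ isnat n /\ af_eq S r w (chk one n))).
    by rewrite /amem /dense_below; dfn_tac.
  move=> w IH q qp wx0; have wx : memR w x q by exact: wx0.
  have pq := le_l qp.
  have [t' z'] := h w q qp wx.
  apply: (zs w q qp pq z') => [y r rp yx yw|y r rp yw].
    have pr := le_l rp.
    have [r' [rr' [u [v [uv [h1 e]]]]]] := yw r (le_refl pr); have pr' := le_l rr'.
    have [u' eu] := sub_name uv; subst u.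
    have ux : memR u' x r' by apply: (mem_congr_l pr' e); apply: ro_mono rr' yx.
    have [r'' [n [h2 [nn e']]]] := IH _ _ uv r' (le_trans rr' rp) ux.
    exists r'', n; split; first exact: le_trans h2 rr'.
    split=> //; apply: (@eq_trans _ _ S u' y (chkN n) r'' (le_l h2) _ e').
    exact: (aeq_mono h2 e).
  exact: (t w r (le_trans rp qp) (ro_mono rp wx) y r (le_refl (le_l rp)) yw).
apply: ro_dense => // q qp; have pq := le_l qp.
have [|r [n [rq [nn e]]]] := zs x q qp pq (ro_mono qp z) _ (fun _ _ _ h => h).
  by move=> y r rp yx _; apply: main.
by exists r; split=> //; apply: K nn e; apply: le_trans qp.
Qed.

(** ** Sequences *)

Definition sqN s : name := Name (name_sq cP one_P (@sv_name _ _ _ s)).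

Lemma nseq_name s i (a : M) : mem (op i a) s -> exists x : name, a = x.
Proof. by move/sv_name => h; exists (Name h). Qed.

Lemma sq_intro s i x p : P p -> mem (op i x) s -> memR (opN (chkN i) x) (sqN s) p.
Proof. by move=> pp h; apply: mem_lit => //; apply/mem_sq; exists i, x. Qed.

Lemma sq_elim s w B p : P p -> memR w (sqN s) p ->
  (forall q i x, le q p -> mem (op i x) s -> eqR w (opN (chkN i) x) q -> B q) -> B p.
Proof.
move=> pp h k; apply: (mem_elim pp h) => q u r qp /mem_sq [i [a [ia /op_inj[e' _]]]] qr e.
have [x ex] := nseq_name ia; subst a; apply: (k q i x qp ia).
by apply: (eq_trans (le_l qp) e); apply: eq_nv => //; apply: le_l qp.
Qed.

Lemma sq_at s w x B p : P p -> memR (opN w x) (sqN s) p ->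
  (forall q i y, le q p -> mem (op i y) s -> eqR w (chkN i) q -> eqR x y q -> B q) -> B p.
Proof.
move=> pp h k; apply: (sq_elim pp h) => q i y qp iy /(opN_inj (le_l qp))[e e'].
exact: k iy e e'.
Qed.

Lemma sq_val s i x y p : P p -> mem (op i y) s -> memR (opN (chkN i) x) (sqN s) p ->
  eqR x y p.
Proof.
move=> pp iy h; apply: (sq_at pp h) => q j z qp jz /(chk_inj (le_l qp)) ij e.
subst j; apply: (eq_trans (le_l qp) e); apply: eq_nv; first exact: le_l qp.
exact: seq_fun (sv_seq s) jz iy.
Qed.

Lemma is_seqR_up x y s p : P p -> eqR x (sqN s) p -> eqR y (chkN (slen s)) p ->
  @is_seq L x y p.
Proof.
move=> pp ex ey; split; first by apply: is_natR_up ey => //; apply: seq_nat (sv_seq s).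
split=> [z q qp zx|].
  have pq := le_l qp; down qp.
  apply: (sq_elim pq (mem_congr_r pq ex zx)) => r i w rq iw e; have pr := le_l rq; down rq.
  apply: (ex_intro (x := chkN i)) => //; apply: (ex_intro (x := w)) => //; split.
    apply: (mem_congr_r pr (eq_sym pr ey)); apply: chk_intro => //.
    exact: seq_dom (sv_seq s) iw.
  exact/is_pairR.
split=> [w q qp wy|w u v q qp /(at_R _ _ _ (le_l qp)) h1 r rq /(at_R _ _ _ (le_l rq)) h2].
  have pq := le_l qp; down qp.
  apply: (chk_elim pq (mem_congr_r pq ey wy)) => r i rq ii e; have pr := le_l rq; down rq.
  have [a ia] := seq_total (sv_seq s) ii; have [u eu] := nseq_name ia; subst a.
  apply: (ex_intro (x := u)) => //; apply/at_R => //.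
  apply: (mem_congr_r pr (eq_sym pr ex)).
  apply: (mem_congr_l pr (opN_congr pr (eq_sym pr e) (eq_refl u pr))).
  exact: sq_intro.
have pr := le_l rq; down qp; down rq.
apply: (sq_at pr (mem_congr_r pr ex h1)) => t i a tr ia ew eu; have pt := le_l tr; down tr.
apply: (eq_trans pt eu); apply: (eq_sym pt); apply: (sq_val pt ia).
apply: (mem_congr_l pt (opN_congr pt ew (eq_refl v pt))).
exact: mem_congr_r ex h2.
Qed.

Lemma is_seqR_down x y B p : P p -> @is_seq L x y p ->
  (forall q s, le q p -> eqR x (sqN s) q -> eqR y (chkN (slen s)) q -> B q) -> B p.
Proof.
move=> pp [h1 [h2 [h3 h4]]] K.
apply: (is_natR_down pp h1) => q0 n q0p nn ey0; apply: ro_dense; first exact: le_l q0p.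
move=> q qq0; have qp := le_trans qq0 q0p; have ey := ro_mono qq0 ey0; have pq := le_l qp.
have dE := af_def S.
have step : forall j, isnat j -> (forall i, mem i j -> mem i n) -> exists r b, le r q /\
    isseq b j /\ forall i a, mem (op i a) b -> is_name P a /\
      amem (af_Le S) (af_eq S) r (nop one (chk one i) a) x.
  apply: nat_ind_def.
  - by rewrite /amem /dense_below; dfn_tac.
  - move=> _; exists q, emp; split; first exact: le_refl.
    by split; [apply: seq_emp|move=> i a /mem_emp].
  move=> j nj IH sub; have [|r [b [rq [sb hb]]]] := IH.
    by move=> i ij; apply: sub; apply/mem_suc; left.
  have pr := le_l rq; have rp := le_trans rq qp.
  have jy : memR (chkN j) y r.
    apply: (mem_congr_r pr (eq_sym pr (ro_mono rq ey))); apply: chk_intro => //.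
    by apply: sub; apply/mem_suc; right.
  have [t [tr [u /(at_R _ _ _ (le_l tr)) hu]]] := h3 (chkN j) r rp jy r (le_refl pr).
  exists t, (cup b (upr (op j u) (op j u))); split; first exact: le_trans rq.
  split; first exact: seq_snoc.
  move=> i a /mem_snoc[/hb[na ia]|[-> ->]]; last by split; [apply: nvP|].
  by split=> //; apply: dense_mono ia.
have [//|r [b [rq [sb hb]]]] := step n nn.
have pr := le_l rq; have rp := le_trans rq qp.
pose s := @NameSeq _ _ S b n sb (fun i a h => (hb i a h).1).
exists r; split=> //; apply: (K r s rp); last exact: ro_mono rq ey.
have hs i u t : le t r -> mem (op i (nv u)) b -> memR (opN (chkN i) u) x t.
  by move=> tr /hb[_]; apply: dense_mono.
apply: eq_ext => // t w tr hw; have pt := le_l tr; have tp := le_trans tr rp; last first.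
  apply: (sq_elim pt hw) => v i u vt iu e.
  apply: (mem_congr_l (le_l vt) (eq_sym (le_l vt) e)).
  by apply: hs iu; apply: le_trans tr.
apply: (ex_elim pt (h2 w t tp hw)) => v vt i hv.
apply: (ex_elim (le_l vt) hv) => v' v'v u [iy /(is_pairR _ _ _ (le_l v'v)) e].
have pv := le_l v'v; have vr := le_trans v'v (le_trans vt tr).
have iy' := mem_congr_r pv (ro_mono (le_trans vr rq) ey) iy.
apply: (chk_elim pv iy') => o k ov kn ei; have po := le_l ov; down ov.
have oq := le_trans ov vr.
have [a ka] := seq_total sb kn; have [u' eu] := @nseq_name s _ _ ka; subst a.
have ku := hs k u' o oq ka.
have ew : eqR w (opN (chkN k) u) o.
  by apply: (eq_trans po e); apply: opN_congr => //; apply: eq_refl.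
have wx : memR w x o by apply: ro_mono hw; apply: le_trans ov (le_trans v'v vt).
have ku' := mem_congr_l po ew wx.
have uu : eqR u u' o.
  have H := h4 (chkN k) u u' o (le_trans oq rp).
  by apply: (H _ o (le_refl po)); apply/at_R.
apply: (mem_congr_l po (eq_sym po ew)).
apply: (mem_congr_l po (opN_congr po (eq_refl _ po) (eq_sym po uu))).
exact: (sq_intro (s := s)).
Qed.

Lemma sq_congr s s' p : P p -> slen s = slen s' ->
  (forall i x y, mem (op i x) s -> mem (op i y) s' -> eqR x y p) ->
  eqR (sqN s) (sqN s') p.
Proof.
move=> pp el h.
apply: eq_ext => // q w qp hw; have pq := le_l qp.
  apply: (sq_elim pq hw) => r i x rq ix e; have pr := le_l rq.
  have [|a ia] := @seq_total _ _ _ _ i (sv_seq s').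
    by rewrite -el; apply: seq_dom ix; apply: sv_seq.
  have [y ey] := nseq_name ia; subst a.
  apply: (mem_congr_l pr (eq_sym pr e)).
  have xy : eqR x y r by apply: ro_mono (h i x y ix ia); apply: le_trans qp.
  apply: (mem_congr_l pr (opN_congr pr (eq_refl _ pr) (eq_sym pr xy))).
  exact: sq_intro.
apply: (sq_elim pq hw) => r i y rq iy e; have pr := le_l rq.
have [|a ia] := @seq_total _ _ _ _ i (sv_seq s).
  by rewrite el; apply: seq_dom iy; apply: sv_seq.
have [x ex] := nseq_name ia; subst a.
apply: (mem_congr_l pr (eq_sym pr e)).
have xy : eqR x y r by apply: ro_mono (h i x y ia iy); apply: le_trans qp.
apply: (mem_congr_l pr (opN_congr pr (eq_refl _ pr) xy)).
exact: sq_intro.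
Qed.

Lemma sq_inj_val s s' i x y p : P p -> eqR (sqN s) (sqN s') p ->
  mem (op i x) s -> mem (op i y) s' -> eqR x y p.
Proof.
move=> pp e ix iy; apply: (sq_val pp iy).
exact: mem_congr_r e (sq_intro pp ix).
Qed.

Lemma sq_inj_len s s' p : P p -> eqR (sqN s) (sqN s') p -> slen s = slen s'.
Proof.
have half s1 s2 i : P p -> eqR (sqN s1) (sqN s2) p -> mem i (slen s1) -> mem i (slen s2).
  move=> pp e i1; have [a ia] := seq_total (sv_seq s1) i1.
  have [x ex] := nseq_name ia; subst a.
  have h := mem_congr_r pp e (sq_intro pp ia).
  have [q [qp [u [r [/mem_sq [j [b [jb /op_inj[eu _]]]] [qr e']]]]]] := h p (le_refl pp).
  have pq := le_l qp.
  have [y ey] := nseq_name jb; subst b u.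
  have [/(chk_inj pq) ij _] := @opN_inj _ _ _ (chkN i) x (chkN j) y q pq e'.
  by subst j; apply: seq_dom jb; apply: sv_seq.
move=> pp e; apply: ext => i; split; apply: half => //.
exact: eq_sym.
Qed.

Lemma consS_name s x i (a : M) : mem (op i a) (cons x s) -> is_name P a.
Proof.
by case/mem_cons=> [/op_inj[_ ->]|[j [y [/op_inj[_ ->] /sv_name]]]] //; apply: nvP.
Qed.

Definition consS x s : nseq := NameSeq (seq_cons x (sv_seq s)) (@consS_name s x).

Lemma is_consR c x a s p : P p -> eqR a (sqN s) p ->
  @is_cons L c x a p <-> eqR c (sqN (consS x s)) p.
Proof.
move=> pp ea; have nn : isnat (slen s) by exact: seq_nat (sv_seq s).
split=> [h|ec]; last first.
  apply: (ex_intro (x := chkN (slen s))) => //.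
  apply: (ex_intro (x := chkN (suc (slen s)))) => //.
  split; first by apply: is_seqR_up ea _ => //; apply: eq_refl.
  split; first by apply/is_succR => //; apply: chkN_suc.
  split; first by apply: is_seqR_up ec _ => //; apply: eq_refl.
  split.
    apply: (ex_intro (x := empN)) => //; split; first by apply/is_emptyR => //; apply: eq_refl.
    apply/at_R => //; apply: (mem_congr_r pp (eq_sym pp ec)).
    apply: (mem_congr_l pp (opN_congr pp (chkN_emp pp) (eq_refl x pp))).
    by apply: sq_intro => //; apply/at_cons0.
  move=> w q qp wn; have pq := le_l qp; down qp.
  apply: (chk_elim pq wn) => r i rq il e; have pr := le_l rq; down rq.
  have [b ib] := seq_total (sv_seq s) il; have [y ey] := nseq_name ib; subst b.
  apply: (ex_intro (x := sucN w)) => //; apply: (ex_intro (x := y)) => //.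
  split; first by apply/is_succR => //; apply: eq_refl.
  split; apply/at_R => //.
    apply: (mem_congr_r pr (eq_sym pr ea)).
    apply: (mem_congr_l pr (opN_congr pr (eq_sym pr e) (eq_refl y pr))).
    exact: sq_intro.
  apply: (mem_congr_r pr (eq_sym pr ec)).
  have ew : eqR (chkN (suc i)) (sucN w) r.
    apply: (eq_trans pr (chkN_suc _ pr)); apply: sucN_congr => //; exact: eq_sym.
  apply: (mem_congr_l pr (opN_congr pr ew (eq_refl y pr))).
  by apply: sq_intro => //; apply/at_consS.
apply: (ex_elim pp h) => q qp n h1; apply: (ex_elim (le_l qp) h1) => r rq n'.
have pr := le_l rq; move=> [h2 [/(is_succR _ _ pr) en [h3 [h4 h5]]]].
have ear := ro_mono (le_trans rq qp) ea.
apply: (is_seqR_down pr h2) => t s1 tr e1 e2; have pt := le_l tr.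
apply: (is_seqR_down pt (ro_mono tr h3)) => v s2 vt e3 e4; have pv := le_l vt.
have vr := le_trans vt tr; down vr; down vt.
have l1 : slen s = slen s1 by apply: (sq_inj_len pv (eq_trans pv (eq_sym pv ear) e1)).
have e2' : eqR n (chkN (slen s)) v by rewrite l1.
have l2 : suc (slen s) = slen s2.
  apply: (chk_inj pv); apply: (eq_trans pv _ e4).
  apply: (eq_trans pv (chkN_suc _ pv)); apply: eq_sym => //.
  exact: (eq_trans pv en (sucN_congr pv e2')).
apply: (eq_trans pv e3); apply: eq_sym => //; apply: sq_congr => // i y z iy iz.
have il : mem i (suc (slen s)) by exact: seq_dom (sv_seq (consS x s)) iy.
have [e0|[j [ej jl]]] := mem_suc_case nn il; subst i.
  move/at_cons0: iy => yx.
  apply: (ex_elim pv h4) => w wv o [/(is_emptyR _ (le_l wv)) eo /(at_R _ _ _ (le_l wv)) h'].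
  have pw := le_l wv; down wv; apply: (eq_trans pw (eq_nv pw yx)).
  apply: (sq_val pw iz); apply: (mem_congr_r pw e3).
  apply: (mem_congr_l pw (opN_congr pw _ (eq_refl x pw)) h').
  exact: (eq_trans pw eo (eq_sym pw (chkN_emp pw))).
move/at_consS: iy => iy.
have h6 := h5 (chkN j) v (le_refl pv) (mem_congr_r pv (eq_sym pv e2') (chk_intro pv jl)).
apply: (ex_elim pv h6) => w wv o h7; have pw := le_l wv.
apply: (ex_elim pw h7) => w' ww u [h8 [h9 h10]]; have pw' := le_l ww.
move/(is_succR _ _ pw'): h8 => h8; move/(at_R _ _ _ pw'): h9 => h9.
move/(at_R _ _ _ pw'): h10 => h10; have wv' := le_trans ww wv; down wv'.
apply: (eq_trans pw' (y := u)).
  by apply: eq_sym => //; apply: (sq_val pw' iy); apply: mem_congr_r ear h9.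
apply: (sq_val pw' iz); apply: (mem_congr_r pw' e3).
apply: (mem_congr_l pw' (opN_congr pw' _ (eq_refl u pw')) h10).
exact: (eq_trans pw' h8 (eq_sym pw' (chkN_suc _ pw'))).
Qed.

End ForcedCodes.

Section ForcedFormulas.
Context {M : class_structure} {hM : GBC M} {S : atomic_forcing hM}.
Context {G : nat -> M -> Prop}.
Local Notation L := (frcL S G).
Local Notation mem := (@cs_mem M).
Local Notation P := (af_P S).
Local Notation le := (rel2 (af_Le S)).
Local Notation one := (af_one S).
Local Notation name := (name S).
Local Notation nseq := (name_sequence S).
Local Notation eqR := (@eqR M hM S).
Local Notation memR := (@memR M hM S).
Local Notation isform := (@is_formula (sets M)).
Implicit Types (p q r : M) (x y z w : name) (B : ro S) (s : nseq).

Let cP : cs_class P := cf_class (af_notion S).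
Let cLe : cs_class (af_Le S) := cf_le_class (af_notion S).

Lemma chkN_node_eq (t : nat) (c a b : M) x y p : P p -> c = node t a b ->
  eqR x (chkN a) p -> eqR y (chkN b) p -> eqR (chkN c) (nodeN t x y) p.
Proof.
move=> pp -> ex ey; apply: (eq_trans pp (chkN_node t a b pp)).
by apply: nodeN_congr => //; apply: eq_sym.
Qed.

Lemma is_formulaR_up k (c n : M) x y p : P p -> isform k c n ->
  eqR x (chkN c) p -> eqR y (chkN n) p -> @is_formula L k x y p.
Proof.
move=> pp /formE[s [cs hs]] ex ey.
apply: (ex_intro (x := chkN s)) => //; split.
  apply: (ex_intro (x := chkN (op c n))) => //; split; last exact: chk_intro.
  apply/is_pairR => //; apply: (eq_trans pp (chkN_op _ _ pp)).
  by apply: opN_congr => //; apply: eq_sym.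
move=> e q qp hes; have pq := le_l qp; clear ex ey.
apply: (chk_elim pq hes) => r e0 rq e0s e_e; have pr := le_l rq.
have [d [l [ed [nl H]]]] := hs _ e0s; subst e0.
apply: (ex_intro (x := chkN d)) => //; apply: (ex_intro (x := chkN l)) => //.
split; first by apply/is_pairR => //; apply: (eq_trans pr e_e); apply: chkN_op.
split; first by apply: is_natR_up nl _ => //; apply: eq_refl.
have N (t : nat) (a b : M) : d = node t a b -> @is_node L t (chkN d) (chkN a) (chkN b) r.
  by move=> ->; apply/is_nodeR => //; apply: chkN_node.
have Pr (a b : M) : @is_pair L (chkN (op a b)) (chkN a) (chkN b) r.
  by apply/is_pairR => //; apply: chkN_op.
case: H => [[i [j [il [jl /N h]]]]|H].
  apply: or_introl => //; apply: (ex_intro (x := chkN i)) => //.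
  apply: (ex_intro (x := chkN j)) => //.
  by split; [apply: chk_intro|split; [apply: chk_intro|]].
apply: or_intror => //; case: H => [[i [j [il [jl /N h]]]]|H].
  apply: or_introl => //; apply: (ex_intro (x := chkN i)) => //.
  apply: (ex_intro (x := chkN j)) => //.
  by split; [apply: chk_intro|split; [apply: chk_intro|]].
apply: or_intror => //; case: H => [[a [i [ak [il e']]]]|H].
  apply: or_introl => //; apply: (any_belowR_intro pr ak).
  apply: (ex_intro (x := chkN i)) => //; split; first exact: chk_intro.
  by apply/c_predR => //; rewrite e'; apply: chkN_node.
apply: or_intror => //; case: H => [[g [h [/N e' [gs hs']]]]|H].
  apply: or_introl => //; apply: (ex_intro (x := chkN g)) => //.
  apply: (ex_intro (x := chkN h)) => //; apply: (ex_intro (x := chkN (op g l))) => //.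
  apply: (ex_intro (x := chkN (op h l))) => //; split=> //; split; first exact: Pr.
  by split; [exact: chk_intro|split; [exact: Pr|exact: chk_intro]].
apply: or_intror => //; case: H => [[g [/N e' gs]]|[g [/N e' gs]]].
  apply: or_introl => //; apply: (ex_intro (x := chkN g)) => //.
  apply: (ex_intro (x := chkN (op g l))) => //; split=> //; split; first exact: Pr.
  exact: chk_intro.
apply: or_intror => //; apply: (ex_intro (x := chkN g)) => //.
apply: (ex_intro (x := chkN (suc l))) => //.
apply: (ex_intro (x := chkN (op g (suc l)))) => //; split=> //.
split; first by apply/is_succR => //; apply: chkN_suc.
by split; [exact: Pr|exact: chk_intro].
Qed.

Fixpoint nbelow (A : M -> Prop) (d : nat) (a : M) : Prop :=
  if d is d'.+1 then A a /\ forall u r, mem (op u r) a -> nbelow A d' u else A a.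

Lemma def_nbelow A d : def1 A -> def1 (nbelow A d).
Proof. by move=> dA; elim: d => [|d IH] //=; dfn_tac. Qed.

Lemma nbelow_pred A d a : nbelow A d.+1 a -> nbelow A d a.
Proof.
elim: d a => [|d IH] a; first by case.
by move=> [Aa h]; split=> // u r /h; apply: IH.
Qed.

Lemma nbelow0 A d a : nbelow A d a -> A a.
Proof. by case: d => [|d] //= []. Qed.

Lemma name_ind_deep d (A : M -> Prop) : def1 A ->
  (forall x, (forall u r, mem (op u r) x -> nbelow A d u) -> A x) -> forall x, A x.
Proof.
move=> dA step x; suff /nbelow0 : nbelow A d.+1 x by [].
move: x; apply: name_ind_R => [|x IH]; first exact: def_nbelow.
split=> [|u r /IH/nbelow_pred] //.
by apply: step => u r /IH/nbelow_pred.
Qed.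

Lemma nbelow_mem A d w x B p : P p -> (forall u r, mem (op u r) x -> nbelow A d.+1 u) ->
  memR w x p ->
  (forall q z, le q p -> eqR w z q -> A z ->
    (forall u r, mem (op u r) z -> nbelow A d u) -> B q) -> B p.
Proof.
move=> pp hx h k; apply: (mem_elim pp h) => q z r qp zr qr e.
by have [? ?] := hx _ _ zr; apply: k e _ _.
Qed.

Lemma nbelow_node A (t : nat) (c : name) x y B p : P p ->
  (forall u r, mem (op u r) c -> nbelow A 4 u) -> eqR c (nodeN t x y) p ->
  (forall q z w, le q p -> eqR x z q -> A z -> eqR y w q -> A w -> B q) -> B p.
Proof.
move=> pp hc e K.
have h1 : memR (uprN (chkN (num t)) (opN x y)) c p.
  apply: (mem_congr_r pp (eq_sym pp e)).
  have : memR (uprN (chkN (num t)) (opN x y)) (uprN (uprN (chkN (num t)) (chkN (num t)))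
    (uprN (chkN (num t)) (opN x y))) p by apply: mem_uprN_r => //; apply: eq_refl.
  by [].
apply: (nbelow_mem pp hc h1) => q z1 qp e1 _ h2; have pq := le_l qp.
have m1 : memR (opN x y) z1 q.
  by apply: (mem_congr_r pq e1); apply: mem_uprN_r => //; apply: eq_refl.
apply: (nbelow_mem pq h2 m1) => r z2 rq e2 _ h3; have pr := le_l rq.
have m2 : memR (uprN x y) z2 r.
  apply: (mem_congr_r pr e2).
  have : memR (uprN x y) (uprN (uprN x x) (uprN x y)) r.
    by apply: mem_uprN_r => //; apply: eq_refl.
  by [].
apply: (nbelow_mem pr h3 m2) => t1 z3 tr e3 _ h4; have pt := le_l tr.
have m3 : memR x z3 t1.
  by apply: (mem_congr_r pt e3); apply: mem_uprN_l => //; apply: eq_refl.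
have m4 : memR y z3 t1.
  by apply: (mem_congr_r pt e3); apply: mem_uprN_r => //; apply: eq_refl.
apply: (nbelow_mem pt h4 m3) => v z vt ez Az _; have pv := le_l vt.
apply: (nbelow_mem pv h4 (ro_mono vt m4)) => o w ov ew Aw _.
apply: (K o z w _ (ro_mono ov ez) Az ew Aw).
by apply: le_trans ov (le_trans vt (le_trans tr (le_trans rq qp))).
Qed.

Lemma is_formulaR_down k x y B p : P p -> @is_formula L k x y p ->
  (forall q c n, le q p -> isform k c n -> eqR x (chkN c) q -> eqR y (chkN n) q -> B q) -> B p.
Proof.
move=> pp hform K; apply: (ex_elim pp hform) => p1 p1p s [h1 h2]; have pp1 := le_l p1p.
apply: (ex_elim pp1 h1) => p2 p21 e [/(is_pairR _ _ _ (le_l p21)) ee es].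
have pp2 := le_l p21.
pose D (c l : M) := denseR S (fun q => exists c0 l0, isform k c0 l0 /\
  af_eq S q c (@chk M hM one c0) /\ af_eq S q l (@chk M hM one l0)).
have Dintro (c l : name) c0 l0 q : P q -> isform k c0 l0 -> eqR c (chkN c0) q ->
    eqR l (chkN l0) q -> D c l q.
  move=> pq f e1 e2; apply: dense_intro => // r rq; exists c0, l0; split=> //.
  by split; [apply: (aeq_mono (x := c) (y := chkN c0) rq)|
             apply: (aeq_mono (x := l) (y := chkN l0) rq)].
have Delim (c l : name) B' q : P q -> D c l q -> (forall r c0 l0, le r q -> isform k c0 l0 ->
    eqR c (chkN c0) r -> eqR l (chkN l0) r -> B' r) -> B' q.
  move=> pq hD hk; apply: (dense_elim pq hD) => r rq [c0 [l0 [f [e1 e2]]]].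
  exact: (hk r c0 l0).
have main : forall c : name, forall q, le q p1 -> forall l, is_name P l ->
    amem (af_Le S) (af_eq S) q (nop one c l) s -> D c l q.
  have dE := af_def S.
  apply: (name_ind_deep (d := 4) (A := fun c => forall q, le q p1 -> forall l, is_name P l ->
    amem (af_Le S) (af_eq S) q (nop one c l) s -> D c l q)).
    by rewrite /D /denseR /ro_at /amem /dense_below; dfn_tac.
  move=> c IH q qp l0 nl; set l := Name nl; have -> : l0 = l by [].
  move=> cl0; have {cl0} cl : memR (opN c l) s q by exact: cl0.
  have pq := le_l qp.
  have sub t (g u : name) r : le r p1 -> eqR g u r -> (forall q, le q p1 -> forall l, is_name P l ->
    amem (af_Le S) (af_eq S) q (nop one u l) s -> D u l q) -> memR (opN g t) s r -> D g t r.
    move=> rp e' hu gs; have pr := le_l rp.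
    have us : memR (opN u t) s r.
      by apply: (mem_congr_l pr (opN_congr pr e' (eq_refl t pr)) gs).
    apply: (Delim u t _ r pr (hu r rp t (nvP t) us)) => v c0 l1 vr f e1 e2.
    apply: (Dintro g t c0 l1 v (le_l vr) f _ e2).
    exact: (eq_trans (le_l vr) (ro_mono vr e') e1).
  have {}h2 := h2 (opN c l) q qp cl.
  apply: (ex_elim pq h2) => r rq c' h3; apply: (ex_elim (le_l rq) h3) => r' rr l'.
  have pr := le_l rr; move=> [/(is_pairR _ _ _ pr)/(opN_inj pr)[ec el] [nl' H]].
  apply: (is_natR_down pr nl') => t n tr nn en; have pt := le_l tr; down tr.
  have eln : eqR l (chkN n) t by apply: eq_trans en.
  have tp : le t p1 by apply: le_trans qp; apply: le_trans rq; apply: le_trans rr.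
  have at_below v i : le v t -> memR i l' v -> forall B' : ro S, (forall o j, le o v ->
      mem j n -> eqR i (chkN j) o -> B' o) -> B' v.
    move=> vt il B' hk; apply: (chk_elim (le_l vt) (mem_congr_r (le_l vt) (ro_mono vt en) il)).
    by move=> *; apply: hk; eauto.
  have fin v c0 : le v t -> isform k c0 n -> eqR c' (chkN c0) v -> D c l v.
    move=> vt f e'; apply: (Dintro c l c0 n v (le_l vt) f _ (ro_mono vt eln)).
    exact: (eq_trans (le_l vt) (ro_mono vt ec) e').
  have fin_node v (m : nat) i j (a b : M) : le v t -> @is_node L m c' i j v ->
      eqR i (chkN a) v -> eqR j (chkN b) v -> isform k (node m a b) n -> D c l v.
    move=> vt /(is_nodeR _ _ _ _ (le_l vt)) e' ea eb f; apply: (fin _ _ vt f).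
    apply: (eq_trans (le_l vt) e'); apply: eq_sym; first exact: le_l vt.
    exact: (chkN_node_eq (le_l vt) _ ea eb).
  have atom (m : nat) v : m < 2 -> le v t ->
      exR (fun i => exR (fun j => andR (memR i l') (andR (memR j l')
        (@is_node L m c' i j)))) v -> D c l v.
    move=> m2 vt H1; apply: (ex_elim (le_l vt) H1) => v1 v1v i h4.
    apply: (ex_elim (le_l v1v) h4) => v2 v21 j [il [jl ej]].
    have v2t := le_trans v21 (le_trans v1v vt).
    apply: (at_below _ _ v2t il) => o a ov an ea; have ot := le_trans ov v2t.
    apply: (at_below _ _ ot (ro_mono ov jl)) => w b wo bn eb; have wt := le_trans wo ot.
    have wv := le_trans wo ov.
    apply: (fin_node w m i j a b wt (ro_mono wv ej) (ro_mono wo ea) eb).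
    apply: form_intro; split=> //.
    by case: m m2 {ej H1 h4} => [|[|]] // _; [left|right; left]; exists a, b.
  have subc (m : nat) v g h (B' : ro S) : le v t -> @is_node L m c' g h v ->
     (forall o, le o v -> (forall r l1, le r o -> memR (opN g l1) s r -> D g l1 r) ->
        (forall r l1, le r o -> memR (opN h l1) s r -> D h l1 r) -> B' o) -> B' v.
    move=> vt /(is_nodeR _ _ _ _ (le_l vt)) e' hk; have pv := le_l vt.
    apply: (nbelow_node pv IH (eq_trans pv (ro_mono vt ec) e')).
    move=> o z w ov egz Az ehw Aw; apply: hk => // o' l1 oo.
      by apply: (sub l1 g z) Az; [apply: le_trans tp; apply: le_trans oo (le_trans ov vt)|
        exact: ro_mono egz].
    by apply: (sub l1 h w) Aw; [apply: le_trans tp; apply: le_trans oo (le_trans ov vt)|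
        exact: ro_mono ehw].
  have len v l1 (m : M) c0 g : le v t -> eqR l1 (chkN m) v -> isform k g c0 ->
     eqR l1 (chkN c0) v -> isform k g m.
    move=> vt e1 f e2.
    by rewrite (chk_inj (le_l vt) (eq_trans (le_l vt) (eq_sym (le_l vt) e1) e2)).
  apply: (or_elim pt H) => v vt; first exact: (atom 0).
  move=> {}H; apply: (or_elim (le_l vt) H) => v1 v1v.
    by apply: (atom 1) => //; apply: le_trans vt.
  move=> {}H; have {}vt := le_trans v1v vt.
  apply: (or_elim (le_l vt) H) => v2 v21 {}H; have {}vt := le_trans v21 vt.
    apply: (any_belowR_elim (le_l vt) H) => o m ov mk H1; have ot := le_trans ov vt.
    apply: (ex_elim (le_l ot) H1) => o1 oo i [il /(c_predR _ _ _ (le_l oo)) e'].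
    have ot1 := le_trans oo ot.
    apply: (at_below _ _ ot1 il) => o2 a o21 an ea; have ot2 := le_trans o21 ot1.
    apply: (fin o2 (node 2 (num m) a) ot2); last first.
      apply: (eq_trans (le_l ot2) (ro_mono o21 e')); apply: eq_sym; first exact: le_l ot2.
      exact: (chkN_node_eq (le_l ot2) erefl (eq_refl (chkN (num m)) (le_l ot2)) ea).
    by apply: form_intro; split=> //; do 2 right; left; exists m, a.
  apply: (or_elim (le_l vt) H) => v3 v32 {}H; have {}vt := le_trans v32 vt.
    apply: (ex_elim (le_l vt) H) => w1 w1v g h4; apply: (ex_elim (le_l w1v) h4) => w2 w21 h h5.
    apply: (ex_elim (le_l w21) h5) => w3 w32 e1 h6; have pw := le_l w32.
    apply: (ex_elim pw h6) => w4 w43 e2 [cg [p1' [m1 [p2' m2]]]]; have {}pw := le_l w43.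
    move/(is_pairR _ _ _ pw): p1' => /(mem_congr_l pw)/(_ m1) m1'.
    move/(is_pairR _ _ _ pw): p2' => /(mem_congr_l pw)/(_ m2) m2'.
    have wt : le w4 t := le_trans w43 (le_trans w32 (le_trans w21 (le_trans w1v vt))).
    apply: (subc _ _ _ _ _ wt cg) => o ow Dg Dh; have po := le_l ow.
    apply: (Delim g l' _ o po (Dg o l' (le_refl po) (ro_mono ow m1'))) => o1 g0 n1 oo1 fg eg el1.
    have o1w := le_trans oo1 ow; have po1 := le_l oo1.
    apply: (Delim h l' _ o1 po1 (Dh o1 l' oo1 (ro_mono o1w m2'))) => o2 h0 n2 oo2 fh eh el2.
    have o2w := le_trans oo2 o1w; have o2t := le_trans o2w wt.
    apply: (fin_node o2 3 g h g0 h0 o2t (ro_mono o2w cg) (ro_mono oo2 eg) eh).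
    apply/form_and; split; first by apply: (len o2 l' _ n1) => //; [exact: ro_mono en|exact: ro_mono el1].
    by apply: (len o2 l' _ n2) => //; exact: ro_mono en.
  apply: (or_elim (le_l vt) H) => v4 v43 {}H; have {}vt := le_trans v43 vt.
    apply: (ex_elim (le_l vt) H) => w1 w1v g h4; apply: (ex_elim (le_l w1v) h4) => w4 w43 e1 [cg [p1' m1]].
    have pw := le_l w43.
    move/(is_pairR _ _ _ pw): p1' => /(mem_congr_l pw)/(_ m1) m1'.
    have wt : le w4 t := le_trans w43 (le_trans w1v vt).
    apply: (subc _ _ _ _ _ wt cg) => o ow Dg _; have po := le_l ow.
    apply: (Delim g l' _ o po (Dg o l' (le_refl po) (ro_mono ow m1'))) => o1 g0 n1 oo1 fg eg el1.
    have o1w := le_trans oo1 ow; have ot := le_trans o1w wt.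
    apply: (fin_node o1 4 g g g0 g0 ot (ro_mono o1w cg) eg eg).
    by apply/form_not; apply: (len o1 l' _ n1) => //; exact: ro_mono en.
  apply: (ex_elim (le_l vt) H) => w1 w1v g h4; apply: (ex_elim (le_l w1v) h4) => w2 w21 l2 h5.
  apply: (ex_elim (le_l w21) h5) => w4 w43 e1 [cg [sl [p1' m1]]].
  have pw := le_l w43; move/(is_succR _ _ pw): sl => sl.
  move/(is_pairR _ _ _ pw): p1' => /(mem_congr_l pw)/(_ m1) m1'.
  have wt : le w4 t := le_trans w43 (le_trans w21 (le_trans w1v vt)).
  apply: (subc _ _ _ _ _ wt cg) => o ow Dg _; have po := le_l ow.
  apply: (Delim g l2 _ o po (Dg o l2 (le_refl po) (ro_mono ow m1'))) => o1 g0 n1 oo1 fg eg el1.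
  have o1w := le_trans oo1 ow; have ot := le_trans o1w wt; have po1 := le_l oo1.
  apply: (fin_node o1 5 g g g0 g0 ot (ro_mono o1w cg) eg eg).
  apply/form_all; split=> //; apply: (len o1 l2 _ n1) => //.
  apply: (eq_trans po1 (ro_mono o1w sl)).
  apply: (eq_trans po1 (sucN_congr po1 (ro_mono ot en))).
  exact: eq_sym (chkN_suc _ po1).
have hD := main x p2 p21 y (nvP y) (mem_congr_l pp2 ee es).
apply: (Delim x y _ p2 pp2 hD) => q c n qp f e1 e2.
by apply: (K q c n) => //; apply: le_trans qp (le_trans p21 p1p).
Qed.

End ForcedFormulas.

(** * Forcing of formal formulas *)

Section Deep.
Context {M : class_structure} {hM : GBC M} {S : atomic_forcing hM}.
Variable G : nat -> M -> Prop.
Local Notation L := (frcL S G).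
Local Notation P := (af_P S).
Local Notation name := (name S).

Fixpoint frc (f : fm) (rho : nat -> name) : ro S :=
  match f with
  | FEq i j => eqR (rho i) (rho j)
  | FMem i j => memR (rho i) (rho j)
  | FPred k i => predR (G k) (rho i)
  | FAnd g h => andR (frc g rho) (frc h rho)
  | FNot g => notR (frc g rho)
  | FAll g => allR (fun x => frc g (scons x rho))
  end.

Let tmr (d : nat) (rho : nat -> name) (l : nat) (x : name) :=
  (l < d)%N /\ rho (d - l.+1) = x.
Let rep (d : nat) (rho : nat -> name) (f : fo syn) (A : fo L) :=
  forall p, P p -> frc (f d) rho p <-> (A : ro S) p.

Let tmr0 d rho x : tmr d.+1 (scons x rho) d x.
Proof. by split; rewrite // subSS subnn. Qed.

Let tmrS d rho l x y : tmr d rho l x -> tmr d.+1 (scons y rho) l x.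
Proof. by case=> ld <-; split; [exact: ltnW | rewrite subSn]. Qed.

Let rep_eq d rho l m x y : tmr d rho l x -> tmr d rho m y ->
  rep d rho (@l_eq syn l m) (@l_eq L x y).
Proof. by case=> _ <- [_ <-]. Qed.

Let rep_mem d rho l m x y : tmr d rho l x -> tmr d rho m y ->
  rep d rho (@l_mem syn l m) (@l_mem L x y).
Proof. by case=> _ <- [_ <-]. Qed.

Let rep_pred d rho k l x : tmr d rho l x -> rep d rho (@l_pred syn k l) (@l_pred L k x).
Proof. by case=> _ <-. Qed.

Let rep_and d rho f g A B : rep d rho f A -> rep d rho g B ->
  rep d rho (@l_and syn f g) (@l_and L A B).
Proof.
move=> hA hB p pp; have [a1 a2] := hA p pp; have [b1 b2] := hB p pp.
change (andR (frc (f d) rho) (frc (g d) rho) p <-> andR A B p).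
by split=> -[h1 h2]; split; [exact: a1|exact: b1|exact: a2|exact: b2].
Qed.

Let rep_not d rho f A : rep d rho f A -> rep d rho (@l_not syn f) (@l_not L A).
Proof.
move=> hA p pp; change (notR (frc (f d) rho) p <-> notR A p).
split=> h q qp Aq; have [a1 a2] := hA q (le_l qp).
  exact: (h q qp (a2 Aq)).
exact: (h q qp (a1 Aq)).
Qed.

Lemma not_andP (A B : ro S) p : P p -> notR (andR A (notR B)) p <-> impR A B p.
Proof.
move=> pp; split=> [h q qp Aq|h q qp [Aq nB]].
  apply: ro_dense => [|r rq]; first exact: le_l qp.
  apply: NNPP => nB; apply: (h r (le_trans rq qp)); split; first exact: ro_mono rq Aq.
  by move=> s sr Bs; apply: nB; exists s.
by apply: (nB q (le_refl (le_l qp))); apply: h.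
Qed.

Lemma not_and_notP (A B : ro S) p : P p -> notR (andR (notR A) (notR B)) p <-> orR A B p.
Proof.
move=> pp; split=> [h q qp|h q qp [nA nB]].
  apply: NNPP => nAB; apply: (h q qp); split=> r rq Ar; apply: nAB; exists r; split=> //.
    by left.
  by right.
by have [r [rq []]] := h q qp; [apply: nA|apply: nB].
Qed.

Lemma not_all_notP (A : name -> ro S) p : P p ->
  notR (allR (fun x => notR (A x))) p <-> exR A p.
Proof.
move=> pp; split=> [h q qp|h q qp nA].
  apply: NNPP => nx; apply: (h q qp) => x r rq Ar; apply: nx; exists r; split=> //.
  by exists x.
by have [r [rq [x Ax]]] := h q qp; apply: (nA x r rq).
Qed.

Let rep_or d rho f g A B : rep d rho f A -> rep d rho g B ->
  rep d rho (@l_or syn f g) (@l_or L A B).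
Proof.
move=> hA hB p pp; rewrite -(not_and_notP A B pp).
by apply: (rep_not (rep_and (rep_not hA) (rep_not hB))).
Qed.

Let rep_imp d rho f g A B : rep d rho f A -> rep d rho g B ->
  rep d rho (@l_imp syn f g) (@l_imp L A B).
Proof.
move=> hA hB p pp; rewrite -(not_andP A B pp).
by apply: (rep_not (rep_and hA (rep_not hB))).
Qed.

Let rep_iff d rho f g A B : rep d rho f A -> rep d rho g B ->
  rep d rho (@l_iff syn f g) (@l_iff L A B).
Proof. by move=> hA hB; apply: rep_and; apply: rep_imp. Qed.

Let rep_all d rho (f : nat -> fo syn) (A : name -> fo L) :
  (forall x, rep d.+1 (scons x rho) (f d) (A x)) ->
  rep d rho (@l_all syn f) (@l_all L A).
Proof.
move=> h p pp; change (allR (fun x => frc (f d d.+1) (scons x rho)) p <-> allR A p).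
by split=> H x; have [h1 h2] := h x p pp; [exact: h1 (H x)|exact: h2 (H x)].
Qed.

Let rep_ex d rho (f : nat -> fo syn) (A : name -> fo L) :
  (forall x, rep d.+1 (scons x rho) (f d) (A x)) ->
  rep d rho (@l_ex syn f) (@l_ex L A).
Proof.
move=> h p pp; rewrite -(not_all_notP A pp).
apply: (rep_not (f := @l_all syn (fun x => @l_not syn (f x)))) => //.
by apply: rep_all => x; apply: rep_not.
Qed.

Ltac rep_step := lazymatch goal with
  | |- rep _ _ (l_and _ _) _ => apply: rep_and
  | |- rep _ _ (l_or _ _) _ => apply: rep_or
  | |- rep _ _ (l_imp _ _) _ => apply: rep_imp
  | |- rep _ _ (l_iff _ _) _ => apply: rep_iff
  | |- rep _ _ (l_not _) _ => apply: rep_not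
  | |- rep _ _ (l_all _) _ => apply: rep_all => ?
  | |- rep _ _ (l_ex _) _ => apply: rep_ex => ?
  | |- rep _ _ (l_eq _ _) _ => apply: rep_eq
  | |- rep _ _ (l_mem _ _) _ => apply: rep_mem
  | |- rep _ _ (l_pred _ _) _ => apply: rep_pred
  | |- tmr _ _ _ _ => first [assumption | apply: tmr0 | apply: tmrS]
  end.
Ltac rep_tac := cbv beta; repeat rep_step.

Let rep_num d rho k l x : tmr d rho l x -> rep d rho (@is_num syn k l) (@is_num L k x).
Proof.
elim: k d rho l x => [|k IH] d rho l x h; cbn [is_num];
  first by rewrite /is_empty; rep_tac.
by apply: rep_ex => y; apply: rep_and; [apply: IH; rep_tac | rewrite /is_succ; rep_tac].
Qed.

Let rep_any d rho k f A : (forall i, rep d rho (f i) (A i)) ->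
  rep d rho (@any_below syn k f) (@any_below L k A).
Proof. by move=> h; elim: k => [|k IH]; cbn [any_below]; [rep_tac | apply: rep_or]. Qed.

Let rep_allb d rho k f A : (forall i, rep d rho (f i) (A i)) ->
  rep d rho (@all_below syn k f) (@all_below L k A).
Proof. by move=> h; elim: k => [|k IH]; cbn [all_below]; [rep_tac | apply: rep_and]. Qed.

Let rep_pair d rho l m n x y z : tmr d rho l x -> tmr d rho m y -> tmr d rho n z ->
  rep d rho (@is_pair syn l m n) (@is_pair L x y z).
Proof. by move=> *; rewrite /is_pair /is_upair; rep_tac. Qed.

Ltac rep_step' := lazymatch goal with
  | |- rep _ _ (is_num _ _) _ => apply: rep_num
  | |- rep _ _ (is_pair _ _ _) _ => apply: rep_pair
  | |- rep _ _ (any_below _ _) _ => apply: rep_any => ?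
  | |- rep _ _ (all_below _ _) _ => apply: rep_allb => ?
  | |- _ => rep_step
  end.

Lemma frc_truth_statement k rho p : P p ->
  frc (truth_statement k) rho p <-> (@truth_predicate L k : ro S) p.
Proof.
move: p; change (rep 0 rho (@truth_predicate syn k) (@truth_predicate L k)).
rewrite /truth_predicate /is_formula /is_cons /c_eq /c_mem /c_pred /c_and /c_not
  /c_all /is_node /is_seq /at_ /is_nat /zero_or_succ /is_trans /is_subset
  /is_succ /is_empty.
by cbv beta; repeat rep_step'.
Qed.

End Deep.

(** * Forcing relations on collections of sentences *)

Section Relation.
Context {M : class_structure} {hM : GBC M}.
Variables (P Le : M -> Prop) (one : M) (hP : class_forcing_notion P Le one).
Variables (k : nat) (G : nat -> M -> Prop) (D : M -> M -> Prop) (F : M -> Prop).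
Hypotheses (cF : cs_class F) (fr : forcing_relation_on P Le k G D F).
Local Notation mem := (@cs_mem M).
Local Notation le := (rel2 Le).
Local Notation isform := (@is_formula (sets M)).
Implicit Types (p q r x y z a c u : M).

Lemma forcesE p f l : forces F p f l <-> rel3 F p (code f) (lst l).
Proof.
split=> [[c [a [/codesE -> [/is_listE ->]]]]|h] //.
by exists (code f), (lst l); split; [apply/codesE|split; [apply/is_listE|]].
Qed.

Fixpoint wf (k n : nat) (f : fm) : bool :=
  match f with
  | FEq i j => (i < n) && (j < n)
  | FMem i j => (i < n) && (j < n)
  | FPred m i => (m < k) && (i < n)
  | FAnd g h => wf k n g && wf k n h
  | FNot g => wf k n g
  | FAll g => wf k n.+1 g
  end.

Lemma form_code n f : wf k n f -> isform k (code f) (num n).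
Proof.
elim: f n => [i j|i j|m i|g IHg h IHh|g IH|g IH] n /=.
- move=> /andP[ni nj]; apply: form_intro; split; first exact: nat_num.
  by left; exists (num i), (num j); split; [|split]; rewrite ?mem_num.
- move=> /andP[ni nj]; apply: form_intro; split; first exact: nat_num.
  by right; left; exists (num i), (num j); split; [|split]; rewrite ?mem_num.
- move=> /andP[nm ni]; apply: form_intro; split; first exact: nat_num.
  by do 2 right; left; exists m, (num i); split; [|split]; rewrite ?mem_num.
- by move=> /andP[/IHg ? /IHh ?]; apply/form_and.
- by move=> /IH ?; apply/form_not.
- by move=> /IH ?; apply/form_all; split=> //; apply: nat_num.
Qed.

Lemma lst_name l i x : (forall x, List.In x l -> is_name P x) ->
  mem (op i x) (lst l) -> is_name P x.
Proof.
elim: l i x => [|y l IH] i x /= h; first by move/mem_emp.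
case/mem_cons=> [/op_inj[_ ->]|[j [z [/op_inj[_ ->]]]]]; first by apply: h; left.
by apply: IH => w wl; apply: h; right.
Qed.

Lemma sentence_lst f l : wf k (size l) f -> (forall x, List.In x l -> is_name P x) ->
  sentence P k (code f) (lst l).
Proof.
move=> wfl hl; split; last first.
  by exists (num (size l)); split; [apply: seq_lst|apply: form_code].
split; first by exists (num (size l)); apply: seq_lst.
by move=> i x /at_E; apply: lst_name.
Qed.

Definition rel_eq p x y := forces_eq F p x y.

Lemma D_eq x y : is_name P x -> is_name P y -> D (code (FEq 0 1)) (lst [:: x; y]).
Proof.
move=> nx ny; apply: (fr_atomic fr).
  by apply: sentence_lst => // z [<-|[<-|[]]].
by left; exists (num 0), (num 1); left; apply/is_nodeE.
Qed.

Lemma D_mem x y : is_name P x -> is_name P y -> D (code (FMem 0 1)) (lst [:: x; y]).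
Proof.
move=> nx ny; apply: (fr_atomic fr).
  by apply: sentence_lst => // z [<-|[<-|[]]].
by left; exists (num 0), (num 1); right; apply/is_nodeE.
Qed.

Lemma dense_ext (A B : M -> Prop) p : (forall q, le q p -> A q <-> B q) ->
  dense_below Le p A <-> dense_below Le p B.
Proof.
move=> h; split=> hd q qp; have [r [rq Ar]] := hd q qp; exists r; split=> //;
  by apply/(h r (cf_trans hP rq qp)).
Qed.

Lemma forces_memE p x y : is_name P x -> is_name P y -> P p ->
  forces_mem F p x y <-> amem Le rel_eq p x y.
Proof.
move=> nx ny pp; rewrite /forces_mem forcesE.
rewrite (fr_mem fr (D_mem nx ny) (i := num 0) (j := num 1) (x := x) (y := y)) //.
- by apply: dense_ext => q qp; split=> -[u [r [h ?]]]; exists u, r; split=> //;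
    move: h; rewrite rel2E.
- exact/is_nodeE.
- exact/at_E/at_cons0.
- exact/at_E/at_consS/at_cons0.
Qed.

Lemma forces_subE p x y : is_name P x -> is_name P y ->
  forces_sub Le F p x y <-> asub Le rel_eq p x y.
Proof.
move=> nx ny; split=> h u r q' ur q'p q'r.
  have [q [qq' hq]] := h u r q' (proj2 (rel2E _ _ _) ur) q'p q'r; exists q; split=> //.
  apply/forces_memE => //; last exact: (cf_le_dom hP qq').1.
  by case: (name_dom nx ur).
have {}ur : mem (op u r) x by exact: (proj1 (rel2E (fun z => mem z x) u r) ur).
have [q [qq' hq]] := h u r q' ur q'p q'r; exists q; split=> //.
apply/forces_memE => //; last exact: (cf_le_dom hP qq').1.
by case: (name_dom nx ur).
Qed.

Lemma rel_eqP p x y : is_name P x -> is_name P y -> P p ->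
  rel_eq p x y <-> asub Le rel_eq p x y /\ asub Le rel_eq p y x.
Proof.
move=> nx ny pp; rewrite {1}/rel_eq /forces_eq forcesE.
rewrite (fr_eq fr (D_eq nx ny) (i := num 0) (j := num 1) (x := x) (y := y)) //.
- by rewrite !forces_subE.
- exact/is_nodeE.
- exact/at_E/at_cons0.
- exact/at_E/at_consS/at_cons0.
Qed.

Lemma def_rel_eq : def3 rel_eq.
Proof.
apply: (dfn_ext (A := fun r : nat -> M => rel3 F (r 0) (code (FEq 0 1)) (cons (r 1) (cons (r 2) emp)))).
  by move=> r; rewrite /rel_eq /forces_eq forcesE.
by dfn_tac.
Qed.

Definition rel_forcing : atomic_forcing hM := AtomicForcing hP def_rel_eq rel_eqP.

End Relation.

Section Bridge.
Context {M : class_structure} {hM : GBC M} {S : atomic_forcing hM}.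
Variables (k : nat) (G : nat -> M -> Prop) (D : M -> M -> Prop) (F : M -> Prop).
Local Notation P := (af_P S).
Local Notation Le := (af_Le S).
Local Notation mem := (@cs_mem M).
Local Notation le := (rel2 Le).
Local Notation isseq := (@is_seq (sets M)).
Local Notation name := (name S).
Hypothesis fr : forcing_relation_on P Le k G D F.
Hypothesis hG : forall n, n < k -> class_name P (G n).
Hypothesis heq : forall p (x y : name), P p -> forces_eq F p x y <-> af_eq S p x y.
Implicit Types (p q r a c u : M) (x y z : name).

Let hP : class_forcing_notion P Le (af_one S) := af_notion S.

Lemma heq_sub p x y : P p -> forces_sub Le F p x y <-> asub Le (af_eq S) p x y.
Proof.
move=> pp; rewrite (forces_subE hP fr) ?nvP //; [|exact: nvP|exact: nvP].
have h u y' q : is_name P u -> P q -> is_name P y' -> amem Le (rel_eq F) q u y' <-> amem Le (af_eq S) q u y'.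
  move=> nu pq ny; apply: (dense_ext hP) => r rq.
  split=> -[v [t [vt [rt e]]]]; exists v, t; split=> //; split=> //;
    have [nv _] := name_dom ny vt; apply/(heq (Name nu) (Name nv) (cf_le_dom hP rq).1); exact: e.
split=> hs u r q' ur q'p q'r; have [q [qq' hq]] := hs u r q' ur q'p q'r; exists q; split=> //;
  have [nu _] := name_dom (nvP x) ur; apply/h => //; try exact: nvP; exact: (cf_le_dom hP qq').1.
Qed.

Lemma name_class (R : M -> Prop) u r : class_name P R -> R (op u r) -> is_name P u.
Proof. by move=> [_ h] /h[v [p [/is_pairE/op_inj[-> _] []]]]. Qed.

Lemma heq_dense (R : M -> Prop) p x : (forall u r, R (op u r) -> is_name P u) -> 
  dense_below Le p (fun q => exists u r, rel2 R u r /\ le q r /\ forces_eq F q x u) <->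
  predR R x p.
Proof.
move=> hR; apply: (dense_ext hP) => q qp; split=> -[u [r [ur [qr e]]]]; exists u, r.
  have {}ur : R (op u r) by apply/rel2E.
  split=> //; split=> //.
  by apply/(heq x (Name (hR _ _ ur)) (cf_le_dom hP qp).1).
split; first exact/rel2E.
by split=> //; apply/(heq x (Name (hR _ _ ur)) (cf_le_dom hP qp).1).
Qed.

Lemma bridge f a (rho : nat -> name) p : D (code f) a ->
  (forall i u, mem (op (num i) u) a -> u = rho i) -> P p ->
  rel3 F p (code f) a <-> frc G f rho p.
Proof.
have get c b n i : sentence P k c b -> isseq b n -> mem i n -> exists x, mem (op i (nv x)) b.
  move=> [[_ nb] _] sb i_n; have [u iu] := seq_total sb i_n.
  have nu : is_name P u by apply: nb; apply/at_E; exact: iu.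
  by exists (Name nu).
elim: f a rho p => [i j|i j|m i|g IHg h IHh|g IH|g IH] a rho p Dc ag pp.
- have sc := fr_sentences fr Dc; have [_ [n [sa fc]]] := sc.
  have [/(get _ _ _ _ sc sa)[x ix] /(get _ _ _ _ sc sa)[y jy]] := form_eq fc.
  rewrite (fr_eq fr Dc (i := num i) (j := num j) (x := x) (y := y)) //;
    try exact/is_nodeE; try exact/at_E.
  rewrite !heq_sub // (ag _ _ ix) (ag _ _ jy) /=.
  by rewrite -eqE.
- have sc := fr_sentences fr Dc; have [_ [n [sa fc]]] := sc.
  have [/(get _ _ _ _ sc sa)[x ix] /(get _ _ _ _ sc sa)[y jy]] := form_mem fc.
  rewrite (fr_mem fr Dc (i := num i) (j := num j) (x := x) (y := y)) //;
    try exact/is_nodeE; try exact/at_E.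
  rewrite heq_dense; last by move=> u r /(name_dom (nvP y))[].
  by rewrite /= (ag _ _ ix) (ag _ _ jy).
- have sc := fr_sentences fr Dc; have [_ [n [sa fc]]] := sc.
  have [mk /(get _ _ _ _ sc sa)[x ix]] := form_pred fc.
  rewrite (fr_pred fr Dc mk (i := num i) (x := x)) //; try exact/c_predE; try exact/at_E.
  rewrite heq_dense; last by move=> u r; apply: name_class; apply: hG.
  by rewrite /= (ag _ _ ix).
- have hc : @c_and (sets M) (code (FAnd g h)) (code g) (code h) by apply/is_nodeE.
  have [Dg Dh] := fr_sub_and fr Dc hc.
  by rewrite (fr_and fr Dc hc pp) (IHg _ rho) // (IHh _ rho).
- have hc : @c_not (sets M) (code (FNot g)) (code g) by apply/is_nodeE.
  have Dg := fr_sub_not fr Dc hc.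
  rewrite (fr_not fr Dc hc pp); split=> [nq q qp gq|nq [q [qp gq]]].
    by apply: nq; exists q; split=> //; apply/(IH _ rho) => //; apply: le_l qp.
  by apply: (nq q qp); apply/(IH a) => //; apply: le_l qp.
- have hc : @c_all (sets M) (code (FAll g)) (code g) by apply/is_nodeE.
  have [_ [n [sa _]]] := fr_sentences fr Dc.
  rewrite (fr_all fr Dc hc pp).
  have key x : rel3 F p (code g) (cons x a) <-> frc G g (scons x rho) p.
    apply: IH => //.
      apply: (fr_sub_all fr Dc hc (nvP x)); exact/(is_consE _ _ sa).
    by move=> [|i] u; [move/at_cons0|move/at_consS; apply: ag].
  split=> [H x|H u a' nu /(is_consE _ _ sa) ->].
    by apply/key; apply: (H x) => //; [apply: nvP|apply/(is_consE _ _ sa)].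
  by apply/(key (Name nu)); apply: H.
Qed.

End Bridge.

(** * Forcing that a predicate is a truth predicate *)

Section Truth.
Context {M : class_structure} {hM : GBC M} {S : atomic_forcing hM}.
Context {k : nat} {G : nat -> M -> Prop}.
Hypothesis hG : forall n, n <= k -> class_name (af_P S) (G n).
Local Notation L := (frcL S G).
Local Notation mem := (@cs_mem M).
Local Notation P := (af_P S).
Local Notation le := (rel2 (af_Le S)).
Local Notation one := (af_one S).
Local Notation name := (name S).
Local Notation nseq := (name_sequence S).
Local Notation eqR := (@eqR M hM S).
Local Notation memR := (@memR M hM S).
Local Notation isform := (@is_formula (sets M)).
Implicit Types (p q r c f g : M) (x y z w : name) (B : ro S) (s : nseq).

Let hGk : names_only S (G k).
Proof. by move=> u r; apply: name_class; apply: hG. Qed.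

Definition holdsR x y : fo L := @l_ex L (fun z => @l_and L (@is_pair L z x y) (@l_pred L k z)).

Definition instR x y : fo L :=
  @l_ex L (fun n => @l_and L (@is_seq L y n) (@is_formula L k x n)).

Definition holds c s : ro S := predR (G k) (opN (chkN c) (sqN s)).

Lemma holdsR_eq x y c s p : P p -> eqR x (chkN c) p -> eqR y (sqN s) p ->
  (holdsR x y : ro S) p <-> holds c s p.
Proof.
move=> pp ex ey; have e := opN_congr pp ex ey; split=> h.
  apply: (ex_elim pp h) => q qp z [/(is_pairR _ _ _ (le_l qp)) e' hz]; have pq := le_l qp.
  apply: (predR_congr hGk pq _ hz); apply: (eq_trans pq e'); exact: ro_mono qp e.
apply: (ex_intro (x := opN x y)) => //; split; first by apply/is_pairR => //; apply: eq_refl.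
by apply: (predR_congr hGk pp _ h); apply: eq_sym.
Qed.

Lemma instR_up c s x y p : P p -> isform k c (slen s) -> eqR x (chkN c) p ->
  eqR y (sqN s) p -> (instR x y : ro S) p.
Proof.
move=> pp f ex ey; apply: (ex_intro (x := chkN (slen s))) => //; split.
  by apply: is_seqR_up ey _ => //; apply: eq_refl.
by apply: is_formulaR_up f ex _ => //; apply: eq_refl.
Qed.

Lemma instR_down x y B p : P p -> (instR x y : ro S) p ->
  (forall q c s, le q p -> isform k c (slen s) -> eqR x (chkN c) q ->
    eqR y (sqN s) q -> B q) -> B p.
Proof.
move=> pp h K; apply: (ex_elim pp h) => q qp n [h1 h2]; have pq := le_l qp.
apply: (is_seqR_down pq h1) => r s rq es en; have pr := le_l rq.
apply: (is_formulaR_down pr (ro_mono rq h2)) => t c n0 tr f ec en'; have pt := le_l tr.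
apply: (K t c s _ _ ec (ro_mono tr es)).
  exact: le_trans tr (le_trans rq qp).
by rewrite (chk_inj pt (eq_trans pt (eq_sym pt (ro_mono tr en)) en')).
Qed.

Record truth_clauses : Prop := {
  tc_eq : forall c s i j x y p, P p -> isform k c (slen s) -> c = node 0 i j ->
    mem (op i x) s -> mem (op j y) s -> holds c s p <-> eqR x y p;
  tc_mem : forall c s i j x y p, P p -> isform k c (slen s) -> c = node 1 i j ->
    mem (op i x) s -> mem (op j y) s -> holds c s p <-> memR x y p;
  tc_pred : forall c s (n : nat) i x p, P p -> isform k c (slen s) -> n < k ->
    c = node 2 (num n) i -> mem (op i x) s -> holds c s p <-> predR (G n) x p;
  tc_and : forall c s f g p, P p -> isform k c (slen s) -> c = node 3 f g ->
    holds c s p <-> holds f s p /\ holds g s p;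
  tc_not : forall c s f p, P p -> isform k c (slen s) -> c = node 4 f f ->
    holds c s p <-> notR (holds f s) p;
  tc_all : forall c s f p, P p -> isform k c (slen s) -> c = node 5 f f ->
    holds c s p <-> forall x, holds f (consS x s) p }.

Lemma iff_both (A B A' B' : ro S) p : P p -> iffR A B p -> (A p <-> A' p) -> (B p <-> B' p) ->
  A' p <-> B' p.
Proof. by move=> pp h <- <-; split; [apply: iff_l|apply: iff_r]. Qed.

Lemma inst_refl c s p : P p -> isform k c (slen s) -> (instR (chkN c) (sqN s) : ro S) p.
Proof. by move=> pp f; apply: (instR_up pp f); apply: eq_refl. Qed.

Lemma holdsR_refl c s p : P p -> (holdsR (chkN c) (sqN s) : ro S) p <-> holds c s p.
Proof. by move=> pp; apply: holdsR_eq => //; apply: eq_refl. Qed.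

Lemma at_refl i x s p : P p -> mem (op i x) s -> (@at_ L (sqN s) (chkN i) x : ro S) p.
Proof. by move=> pp h; apply/at_R => //; apply: sq_intro. Qed.

Lemma truth_elim : (@truth_predicate L k : ro S) one -> truth_clauses.
Proof.
move=> [_ [teq [tmem [tpred [tand [tnot tall]]]]]].
have rf p : P p -> le p p by apply: le_refl.
have l1 p : P p -> le p one by apply: le_one.
have N (t : nat) (c a b : M) p : P p -> c = node t a b ->
    (@is_node L t (chkN c) (chkN a) (chkN b) : ro S) p.
  by move=> pp ->; apply/is_nodeR => //; apply: chkN_node.
split.
- move=> c s i j x y p pp f /(N _ _ _ _ p pp) e ix jy.
  have H := teq (chkN c) (sqN s) (chkN i) (chkN j) x y p (l1 p pp)
    (inst_refl pp f) p (rf p pp) e p (rf p pp) (at_refl pp ix) p (rf p pp) (at_refl pp jy).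
  exact: (iff_both pp H (holdsR_refl c s pp)).
- move=> c s i j x y p pp f /(N _ _ _ _ p pp) e ix jy.
  have H := tmem (chkN c) (sqN s) (chkN i) (chkN j) x y p (l1 p pp)
    (inst_refl pp f) p (rf p pp) e p (rf p pp) (at_refl pp ix) p (rf p pp) (at_refl pp jy).
  exact: (iff_both pp H (holdsR_refl c s pp)).
- move=> c s n i x p pp f nk e ix.
  have e' : (@c_pred L n (chkN c) (chkN i) : ro S) p.
    by apply/c_predR => //; rewrite e; apply: chkN_node.
  have p1 : P one by apply: cf_one (af_notion S).
  have H := proj1 (all_belowR k _ p1) tpred n nk (chkN c) (sqN s) (chkN i) x p (l1 p pp)
    (inst_refl pp f) p (rf p pp) e' p (rf p pp) (at_refl pp ix).
  exact: (iff_both pp H (holdsR_refl c s pp)).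
- move=> c s f g p pp h /(N _ _ _ _ p pp) e.
  have H := tand (chkN c) (chkN f) (chkN g) (sqN s) p (l1 p pp)
    (inst_refl pp h) p (rf p pp) e.
  apply: (iff_both (B' := andR (holds f s) (holds g s)) pp H (holdsR_refl c s pp)).
  by split=> -[h1 h2]; split; apply/holdsR_refl.
- move=> c s f p pp h /(N _ _ _ _ p pp) e.
  have H := tnot (chkN c) (chkN f) (sqN s) p (l1 p pp)
    (inst_refl pp h) p (rf p pp) e.
  apply: (iff_both pp H (holdsR_refl c s pp)).
  by split=> h1 q qp h2; apply: (h1 q qp); apply/(holdsR_refl f s (le_l qp)).
- move=> c s f p pp h /(N _ _ _ _ p pp) e.
  have H := tall (chkN c) (chkN f) (sqN s) p (l1 p pp)
    (inst_refl pp h) p (rf p pp) e.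
  apply: (iff_both (B' := allR (fun x => holds f (consS x s))) pp H (holdsR_refl c s pp)).
  split=> h1 x.
    apply: (ex_elim pp (h1 x)) => q qp y [/(is_consR y x (le_l qp) (eq_refl (sqN s) (le_l qp))) ey h2].
    exact/(holdsR_eq (le_l qp) (eq_refl _ (le_l qp)) ey).
  apply: (ex_intro (x := sqN (consS x s))) => //; split.
    by apply/is_consR => //; apply: eq_refl.
  exact/holdsR_refl.
Qed.

Lemma form_node c n : isform k c n -> exists (t : nat) a b, c = node t a b.
Proof.
move/form_inv => [_ [[i [j [_ [_ ->]]]]|[[i [j [_ [_ ->]]]]|[[n' [i [_ [_ ->]]]]|
  [[f [g [-> _]]]|[[f [-> _]]|[f [-> _]]]]]]]]; by do 3 eexists.
Qed.

Lemma node_down (t : nat) c n z x y p : P p -> isform k c n -> eqR z (chkN c) p ->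
  eqR z (nodeN t x y) p ->
  exists a b, [/\ c = node t a b, eqR x (chkN a) p & eqR y (chkN b) p].
Proof.
move=> pp /form_node[t' [a [b ec]]] ez ez'; exists a, b.
have e : eqR (nodeN t x y) (nodeN t' (chkN a) (chkN b)) p.
  apply: (eq_trans pp (eq_sym pp ez')); apply: (eq_trans pp ez).
  by rewrite ec; apply: chkN_node.
by have [-> ? ?] := nodeN_inj pp e.
Qed.

Lemma at_down x z y s i p B : P p -> eqR x (sqN s) p -> eqR z (chkN i) p ->
  (@at_ L x z y : ro S) p ->
  (forall q w, le q p -> mem (op i w) s -> eqR y w q -> B q) -> B p.
Proof.
move=> pp ex ez /(at_R _ _ _ pp) h K.
apply: (sq_at pp (mem_congr_r pp ex h)) => q j w qp jw e e'.
have ij := chk_inj (le_l qp) (eq_trans (le_l qp) (eq_sym (le_l qp) (ro_mono qp ez)) e).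
by subst j; apply: (K q w).
Qed.

Lemma iffR_intro (A B A' B' : ro S) p : (forall q, le q p -> A q <-> A' q) ->
  (forall q, le q p -> B q <-> B' q) -> (forall q, le q p -> A' q <-> B' q) -> iffR A B p.
Proof. by move=> hA hB h; split=> q qp; rewrite hA // hB // h. Qed.

Lemma truth_intro :
  (forall u r, G k (op u r) -> exists c s, u = opN (chkN c) (sqN s) /\ isform k c (slen s)) ->
  truth_clauses -> (@truth_predicate L k : ro S) one.
Proof.
move=> hT tc; have p1 : P one by apply: cf_one (af_notion S).
split.
  move=> z q qp hz; have pq := le_l qp.
  apply: (dense_elim pq hz) => r rq [u [t [ut [rt e]]]]; have pr := le_l rq.
  have [c [s [eu f]]] := hT _ _ ut.
  apply: (ex_intro (x := chkN c)) => //; apply: (ex_intro (x := sqN s)) => //; split.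
    by apply/is_pairR => //; move: e; rewrite eu.
  exact: inst_refl.
have holdsRq (x y : name) c s q r : le r q -> eqR x (chkN c) q -> eqR y (sqN s) q ->
    (holdsR x y : ro S) r <-> holds c s r.
  by move=> rq e1 e2; apply: holdsR_eq; [exact: le_l rq|exact: ro_mono e1|exact: ro_mono e2].
split.
  move=> x a i j y z q _ hi r rq he r1 r1r hy r2 r21 hz.
  have p2 := le_l r21; down rq; down r1r; down r21.
  apply: (instR_down p2 hi) => t c s tr f ec es; have pt := le_l tr; down tr.
  have [i0 [j0 [ec0 ei ej]]] := node_down pt f ec (proj1 (is_nodeR _ _ _ _ pt) he).
  apply: (at_down pt es ei hy) => v y0 vt iy ey; have pv := le_l vt; down vt.
  apply: (at_down pv es ej hz) => o z0 ov jz ez; have po := le_l ov; down ov.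
  apply: (iffR_intro (A' := holds c s) (B' := eqR y0 z0)) => q' qo; first exact: holdsRq qo ec es.
    have pq := le_l qo; have {}ey := ro_mono qo ey; have {}ez := ro_mono qo ez.
    split=> h; first exact: (eq_trans pq (eq_sym pq ey) (eq_trans pq h ez)).
    exact: (eq_trans pq ey (eq_trans pq h (eq_sym pq ez))).
  exact: tc_eq tc _ _ _ _ _ _ _ (le_l qo) f ec0 iy jz.
split.
  move=> x a i j y z q _ hi r rq he r1 r1r hy r2 r21 hz.
  have p2 := le_l r21; down rq; down r1r; down r21.
  apply: (instR_down p2 hi) => t c s tr f ec es; have pt := le_l tr; down tr.
  have [i0 [j0 [ec0 ei ej]]] := node_down pt f ec (proj1 (is_nodeR _ _ _ _ pt) he).
  apply: (at_down pt es ei hy) => v y0 vt iy ey; have pv := le_l vt; down vt.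
  apply: (at_down pv es ej hz) => o z0 ov jz ez; have po := le_l ov; down ov.
  apply: (iffR_intro (A' := holds c s) (B' := memR y0 z0)) => q' qo; first exact: holdsRq qo ec es.
    have pq := le_l qo; have {}ey := ro_mono qo ey; have {}ez := ro_mono qo ez.
    split=> h; first exact: (mem_congr_r pq ez (mem_congr_l pq ey h)).
    exact: (mem_congr_r pq (eq_sym pq ez) (mem_congr_l pq (eq_sym pq ey) h)).
  exact: tc_mem tc _ _ _ _ _ _ _ (le_l qo) f ec0 iy jz.
split.
  apply/(all_belowR k _ p1) => n nk x a i y q _ hi r rq he r1 r1r hy.
  have p2 := le_l r1r; down rq; down r1r.
  apply: (instR_down p2 hi) => t c s tr f ec es; have pt := le_l tr; down tr.
  have [n0 [i0 [ec0 en ei]]] := node_down pt f ec (proj1 (c_predR _ _ _ pt) he).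
  have {en} en := chk_inj pt en; subst n0.
  apply: (at_down pt es ei hy) => v y0 vt iy ey; have pv := le_l vt; down vt.
  have hn : names_only S (G n) by move=> u w; apply: name_class; apply: hG; exact: ltnW.
  apply: (iffR_intro (A' := holds c s) (B' := predR (G n) y0)) => q' qo; first exact: holdsRq qo ec es.
    have pq := le_l qo; have {}ey := ro_mono qo ey.
    split=> h; first exact: (predR_congr hn pq ey h).
    exact: (predR_congr hn pq (eq_sym pq ey) h).
  exact: tc_pred tc _ _ _ _ _ _ (le_l qo) f nk ec0 iy.
split.
  move=> x y z a q _ hi r rq he; have pr := le_l rq; down rq.
  apply: (instR_down pr hi) => t c s tr f ec es; have pt := le_l tr; down tr.
  have [i0 [j0 [ec0 ei ej]]] := node_down pt f ec (proj1 (is_nodeR _ _ _ _ pt) he).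
  apply: (iffR_intro (A' := holds c s) (B' := andR (holds i0 s) (holds j0 s))) => q' qo.
  - exact: holdsRq qo ec es.
  - have t1 := holdsRq _ _ _ _ _ _ qo ei es; have t2 := holdsRq _ _ _ _ _ _ qo ej es.
    by split=> -[h1 h2]; split; [apply/t1|apply/t2|apply/t1|apply/t2].
  - exact: tc_and tc _ _ _ _ _ (le_l qo) f ec0.
split.
  move=> x y a q _ hi r rq he; have pr := le_l rq; down rq.
  apply: (instR_down pr hi) => t c s tr f ec es; have pt := le_l tr; down tr.
  have [i0 [j0 [ec0 ei ej]]] := node_down pt f ec (proj1 (is_nodeR _ _ _ _ pt) he).
  have ij : i0 = j0 by apply: (chk_inj pt); apply: eq_trans ej; [|exact: eq_sym].
  subst j0.
  apply: (iffR_intro (A' := holds c s) (B' := notR (holds i0 s))) => q' qo.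
  - exact: holdsRq qo ec es.
  - split=> h v vq hv; apply: (h v vq); apply/(holdsRq _ _ _ _ _ _ (le_trans vq qo) ei es); exact: hv.
  - exact: tc_not tc _ _ _ _ (le_l qo) f ec0.
move=> x y a q _ hi r rq he; have pr := le_l rq; down rq.
apply: (instR_down pr hi) => t c s tr f ec es; have pt := le_l tr; down tr.
have [i0 [j0 [ec0 ei ej]]] := node_down pt f ec (proj1 (is_nodeR _ _ _ _ pt) he).
have ij : i0 = j0 by apply: (chk_inj pt); apply: eq_trans ej; [|exact: eq_sym].
subst j0.
apply: (iffR_intro (A' := holds c s) (B' := allR (fun b => holds i0 (consS b s)))) => q' qo.
- exact: holdsRq qo ec es.
- have pq := le_l qo; have ei' := ro_mono qo ei; have es' := ro_mono qo es.
  split=> h b.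
    apply: (ex_elim pq (h b)) => v vq a' [/(is_consR _ _ (le_l vq) (ro_mono vq es')) e h'].
    exact/(holdsR_eq (le_l vq) (ro_mono vq ei') e).
  apply: (ex_intro (x := sqN (consS b s))) => //; split.
    by apply/(is_consR _ _ pq es'); apply: eq_refl.
  by apply/(holdsR_eq pq ei' (eq_refl _ pq)); apply: h.
- exact: tc_all tc _ _ _ _ (le_l qo) f ec0.
Qed.

End Truth.

Section Sentences.
Context {M : class_structure} {hM : GBC M} (S : atomic_forcing hM).
Variable k : nat.
Local Notation mem := (@cs_mem M).
Local Notation P := (af_P S).
Local Notation Le := (af_Le S).
Local Notation one := (af_one S).
Local Notation nseq := (name_sequence S).
Local Notation isform := (@is_formula (sets M)).
Implicit Types (p q r c f g a : M) (s : nseq).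

Let hP : class_forcing_notion P Le one := af_notion S.
Let cP : cs_class P := cf_class hP.

Lemma empS_name i u : mem (op i u) emp -> is_name P u.
Proof. by move/mem_emp. Qed.

Definition empS : nseq := NameSeq seq_emp empS_name.

Lemma sentenceE c a : sentence P k c a <-> exists s, a = s /\ isform k c (slen s).
Proof.
split=> [[[_ na] [n [sa f]]]|[s [-> f]]].
  have h i x : mem (op i x) a -> is_name P x by move=> /at_E; apply: na.
  by exists (NameSeq sa h).
split; last by exists (slen s); split=> //; apply: sv_seq.
split; first by exists (slen s); apply: sv_seq.
by move=> i x /at_E; apply: sv_name.
Qed.

Lemma sentence_and c f g a : sentence P k c a -> c = node 3 f g ->
  sentence P k f a /\ sentence P k g a.
Proof.
move=> /sentenceE[s [-> h]] e; rewrite e in h; move/form_and: h => [h1 h2].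
by split; apply/sentenceE; exists s.
Qed.

Lemma sentence_not c f a : sentence P k c a -> c = node 4 f f -> sentence P k f a.
Proof.
move=> /sentenceE[s [-> h]] e; rewrite e in h; move/form_not: h => h1.
by apply/sentenceE; exists s.
Qed.

Lemma sentence_all c f a x a' : sentence P k c a -> c = node 5 f f -> is_name P x ->
  @is_cons (sets M) a' x a -> sentence P k f a' /\ a' = cons x a.
Proof.
move=> /sentenceE[s [-> h]] e nx /(is_consE _ _ (sv_seq s)) ea; split=> //.
rewrite e in h; move/form_all: h => [_ h1].
by apply/sentenceE; exists (consS (Name nx) s).
Qed.

Lemma def_sentence : def2 (sentence P k).
Proof. by rewrite /sentence /name_seq; dfn_tac. Qed.

End Sentences.

Lemma forcing_relation_on_ext (M : class_structure) (P Le : M -> Prop) k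
  (G G' : nat -> M -> Prop) D F : (forall n, n < k -> G n = G' n) ->
  forcing_relation_on P Le k G D F -> forcing_relation_on P Le k G' D F.
Proof.
move=> e fr; split; try by case: fr.
by move=> c a n i x Dc nk; rewrite -e //; apply: (fr_pred fr).
Qed.

Section FromTruth.
Context {M : class_structure} {hM : GBC M} {S : atomic_forcing hM}.
Variables (k : nat) (G : nat -> M -> Prop).
Local Notation mem := (@cs_mem M).
Local Notation P := (af_P S).
Local Notation Le := (af_Le S).
Local Notation le := (rel2 Le).
Local Notation one := (af_one S).
Local Notation name := (name S).
Local Notation nseq := (name_sequence S).
Local Notation isform := (@is_formula (sets M)).
Hypothesis hG : forall n, n <= k -> class_name P (G n).
Hypothesis tc : truth_clauses (S := S) (k := k) (G := G).
Implicit Types (p q r c f g a u : M) (x y : name) (s : nseq).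

Let hP : class_forcing_notion P Le one := af_notion S.
Let cP : cs_class P := cf_class hP.
Let cLe : cs_class Le := cf_le_class hP.

Let F z := exists p c a, z = op p (op c a) /\ P p /\ sentence P k c a /\
  dense_below Le p (fun q => exists u r, G k (op u r) /\ le q r /\
    af_eq S q (nop one (chk one c) (sq one a)) u).

Let cF : cs_class F.
Proof.
have ds := def_sentence S k; have dE := af_def S.
have cT : cs_class (G k) by case: (hG (leqnn k)).
by apply: cls_dfn; rewrite /F /dense_below; dfn_tac.
Qed.

Let FE p c s : P p -> isform k c (slen s) ->
  rel3 F p c s <-> holds (G := G) (k := k) c s p.
Proof.
move=> pp f; rewrite rel3E; split=> [[p' [c' [a' [/op_inj[<- /op_inj[<- <-]] [_ [_ h]]]]]]|h].
  exact: h.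
exists p, c, s; split=> //; split=> //; split=> //.
by apply/sentenceE; exists s.
Qed.

Let force_eq q x u : P q -> is_name P u -> forces_eq F q x u <-> af_eq S q x u.
Proof.
move=> pq nu; rewrite /forces_eq forcesE.
pose s := consS x (consS (Name nu) (empS S)).
have f : isform k (code (FEq 0 1)) (slen s) by exact: (@form_code _ _ k 2 (FEq 0 1)).
rewrite (FE (s := s) pq f).
apply: (tc_eq tc pq f (i := num 0) (j := num 1) (x := x) (y := Name nu)) => //.
  exact/at_cons0.
exact/at_consS/at_cons0.
Qed.

Let force_dense (R : M -> Prop) p x : (forall u r, R (op u r) -> is_name P u) ->
  predR R x p <-> dense_below Le p (fun q => exists u r, rel2 R u r /\ le q r /\ forces_eq F q x u).
Proof.
move=> hR; apply: (dense_ext hP) => q qp; have pq : P q by exact: (cf_le_dom hP qp).1.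
split=> -[u [r [ur [qr e]]]]; exists u, r.
  split; first exact/rel2E.
  by split=> //; apply/force_eq => //; apply: hR ur.
have {}ur : R (op u r) by apply/rel2E.
by split=> //; split=> //; apply/force_eq => //; apply: hR ur.
Qed.

Let force_sub p x y : P p -> asub Le (af_eq S) p x y <-> forces_sub Le F p x y.
Proof.
move=> pp.
have key u q : is_name P u -> P q -> amem Le (af_eq S) q u y <-> forces_mem F q u y.
  move=> nu pq; rewrite /forces_mem forcesE.
  pose s := consS (Name nu) (consS y (empS S)).
  have f : isform k (code (FMem 0 1)) (slen s) by exact: (@form_code _ _ k 2 (FMem 0 1)).
  rewrite (FE (s := s) pq f) (tc_mem tc pq f (i := num 0) (j := num 1) (x := Name nu) (y := y)) //.
    exact/at_cons0.
  exact/at_consS/at_cons0.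
split=> h u r q' ur q'p q'r.
  have {}ur : mem (op u r) x by exact: (proj1 (rel2E (fun z => mem z x) u r) ur).
  have [q [qq hq]] := h u r q' ur q'p q'r; exists q; split=> //.
  by apply/key => //; [case: (name_dom (nvP x) ur)|exact: (cf_le_dom hP qq).1].
have [q [qq hq]] := h u r q' (proj2 (rel2E (fun z => mem z x) _ _) ur) q'p q'r; exists q; split=> //.
by apply/key => //; [case: (name_dom (nvP x) ur)|exact: (cf_le_dom hP qq).1].
Qed.

Lemma uniform_of_truth : admits_uniform_forcing P Le k G.
Proof.
exists F; split; first exact: cF.
have getn s i u : mem (op i u) s -> exists x, u = x by apply: nseq_name.
split.
- by [].
- by [].
- by move=> c f g a sc /is_nodeE; apply: sentence_and.
- by move=> c f a sc /is_nodeE; apply: sentence_not.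
- by move=> c f a x a' sc /is_nodeE e nx /(sentence_all sc e nx)[].
- move=> c a i j u v /sentenceE[s [-> f]] /is_nodeE e /at_E iu /at_E jv p pp.
  have [x eu] := getn _ _ _ iu; have [y ev] := getn _ _ _ jv; subst u v.
  rewrite (FE pp f) (tc_mem tc pp f e iu jv); apply: force_dense.
  by move=> u r /(name_dom (nvP y))[].
- move=> c a i j u v /sentenceE[s [-> f]] /is_nodeE e /at_E iu /at_E jv p pp.
  have [x eu] := getn _ _ _ iu; have [y ev] := getn _ _ _ jv; subst u v.
  by rewrite (FE pp f) (tc_eq tc pp f e iu jv) -!force_sub // -eqE.
- move=> c a n i u /sentenceE[s [-> f]] nk /c_predE e /at_E iu p pp.
  have [x eu] := getn _ _ _ iu; subst u.
  rewrite (FE pp f) (tc_pred tc pp f nk e iu); apply: force_dense.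
  by move=> u r; apply: name_class; apply: hG; apply: ltnW.
- move=> c f g a sc /is_nodeE e p pp; have [s1 s2] := sentence_and sc e.
  move: sc => /sentenceE[s [ea h]]; subst a.
  have h' := h; rewrite e in h'; move/form_and: h' => [hf hg].
  by rewrite (FE pp h) (tc_and tc pp h e) !FE.
- move=> c f a /sentenceE[s [ea h]] /is_nodeE e p pp; subst a.
  have h' := h; rewrite e in h'; move/form_not: h' => hf.
  rewrite (FE pp h) (tc_not tc pp h e); split=> [h1 [q [qp fq]]|h1 q qp h2].
    by apply: (h1 q qp); apply/FE => //; apply: le_l qp.
  by apply: h1; exists q; split=> //; apply/FE => //; apply: le_l qp.
- move=> c f a /sentenceE[s [ea h]] /is_nodeE e p pp; subst a.
  have h' := h; rewrite e in h'; move/form_all: h' => [_ hf].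
  rewrite (FE pp h) (tc_all tc pp h e); split=> [h1 u a' nu /(is_consE _ _ (sv_seq s)) ->|h1 x].
    by apply/(FE (s := consS (Name nu) s)) => //; apply: h1.
  apply/(FE (s := consS x s)) => //; apply: h1; first exact: nvP.
  exact/(is_consE _ _ (sv_seq s)).
Qed.

End FromTruth.

Section ToTruth.
Context {M : class_structure} {hM : GBC M} {S : atomic_forcing hM}.
Variables (k : nat) (G : nat -> M -> Prop) (F : M -> Prop).
Local Notation mem := (@cs_mem M).
Local Notation P := (af_P S).
Local Notation Le := (af_Le S).
Local Notation le := (rel2 Le).
Local Notation one := (af_one S).
Local Notation name := (name S).
Local Notation nseq := (name_sequence S).
Local Notation isform := (@is_formula (sets M)).
Local Notation isseq := (@is_seq (sets M)).
Hypothesis cF : cs_class F.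
Hypothesis fr : forcing_relation_on P Le k G (sentence P k) F.
Hypothesis hG : forall n, n < k -> class_name P (G n).
Hypothesis heq : forall p (x y : name), P p -> forces_eq F p x y <-> af_eq S p x y.
Implicit Types (p q r c f g a b u : M) (x y : name) (s : nseq).

Let hP : class_forcing_notion P Le one := af_notion S.
Let cP : cs_class P := cf_class hP.
Let cLe : cs_class Le := cf_le_class hP.

Let sent c s : isform k c (slen s) -> sentence P k c s.
Proof. by move=> h; apply/sentenceE; exists s. Qed.

Lemma force_eq c s i j x y p : P p -> isform k c (slen s) -> c = node 0 i j ->
  mem (op i x) s -> mem (op j y) s -> rel3 F p c s <-> eqR x y p.
Proof.
move=> pp h e ix jy.
rewrite (fr_eq fr (sent h) (proj2 (is_nodeE _ _ _ _) e) (proj2 (at_E _ _ _) ix) (proj2 (at_E _ _ _) jy) pp).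
by rewrite !(heq_sub fr heq) //= -eqE.
Qed.

Lemma force_mem c s i j x y p : P p -> isform k c (slen s) -> c = node 1 i j ->
  mem (op i x) s -> mem (op j y) s -> rel3 F p c s <-> memR x y p.
Proof.
move=> pp h e ix jy.
rewrite (fr_mem fr (sent h) (proj2 (is_nodeE _ _ _ _) e) (proj2 (at_E _ _ _) ix) (proj2 (at_E _ _ _) jy) pp).
by apply: (heq_dense heq) => u r /(name_dom (nvP y))[].
Qed.

Lemma force_pred c s (n : nat) i x p : P p -> isform k c (slen s) -> n < k ->
  c = node 2 (num n) i -> mem (op i x) s -> rel3 F p c s <-> predR (G n) x p.
Proof.
move=> pp h nk e ix.
rewrite (fr_pred fr (sent h) nk (proj2 (c_predE _ _ _) e) (proj2 (at_E _ _ _) ix) pp).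
by apply: (heq_dense heq) => u r; apply: name_class; apply: hG.
Qed.

Lemma force_and c s f g p : P p -> isform k c (slen s) -> c = node 3 f g ->
  rel3 F p c s <-> rel3 F p f s /\ rel3 F p g s.
Proof. by move=> pp h e; apply: (fr_and fr (sent h)) => //; apply/is_nodeE. Qed.

Lemma force_not c s f p : P p -> isform k c (slen s) -> c = node 4 f f ->
  rel3 F p c s <-> forall q, le q p -> ~ rel3 F q f s.
Proof.
move=> pp h e; rewrite (fr_not fr (sent h) (proj2 (is_nodeE _ _ _ _) e) pp).
by split=> [h1 q qp fq|h1 [q [qp fq]]]; [apply: h1; exists q|apply: (h1 q qp)].
Qed.

Lemma force_all c s f p : P p -> isform k c (slen s) -> c = node 5 f f ->
  rel3 F p c s <-> forall x, rel3 F p f (consS x s).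
Proof.
move=> pp h e; rewrite (fr_all fr (sent h) (proj2 (is_nodeE _ _ _ _) e) pp).
split=> [h1 x|h1 u a' nu /(is_consE _ _ (sv_seq s)) ->]; last exact: (h1 (Name nu)).
by apply: h1; [apply: nvP|apply/(is_consE _ _ (sv_seq s))].
Qed.

Definition regular (X : M -> Prop) :=
  (forall p q, le q p -> X p -> X q) /\
  (forall p, P p -> (forall q, le q p -> exists r, le r q /\ X r) -> X p).

Lemma regular_ro (B : ro S) (X : M -> Prop) : (forall p, P p -> X p <-> B p) -> regular X.
Proof.
move=> h; split=> [p q qp|p pp hd].
  by rewrite (h p (le_r qp)) (h q (le_l qp)); apply: ro_mono.
apply/h => //; apply: ro_dense => // q /hd[r [rq Xr]]; exists r; split=> //.
by apply/h => //; apply: le_l rq.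
Qed.

Definition ro_of X (h : regular X) : ro S := Ro h.1 h.2.

Lemma nseq_mem s n i : slen s = n -> mem i n -> exists x, mem (op i (nv x)) s.
Proof.
move=> <- hi; have [u iu] := seq_total (sv_seq s) hi.
by have [x e] := nseq_name iu; exists x; rewrite -e.
Qed.

Lemma force_regular c s : isform k c (slen s) -> regular (fun p => rel3 F p c s).
Proof.
suff H : forall c n, isform k c n -> forall a, isseq a n ->
    (forall i u, mem (@op M hM i u) a -> is_name P u) -> regular (fun p => rel3 F p c a).
  by move=> h; exact: (H _ _ h _ (sv_seq s) (@sv_name _ _ _ s)).
move=> {c s}; apply: form_ind_def; first by rewrite /regular; dfn_tac.
move=> c n st a sa na.
have hf : isform k c n by apply: form_intro; apply: fstep_mono st => ? ? [].
pose s := @NameSeq _ _ S a n sa na.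
have hs : isform k c (slen s) by [].
have [nn H] := st; case: H => [[i [j [il [jl e]]]]|H].
  have [x ix] := nseq_mem (s := s) erefl il; have [y jy] := nseq_mem (s := s) erefl jl.
  by apply: (regular_ro (B := eqR x y)) => p pp; apply: (force_eq pp hs e ix jy).
case: H => [[i [j [il [jl e]]]]|H].
  have [x ix] := nseq_mem (s := s) erefl il; have [y jy] := nseq_mem (s := s) erefl jl.
  by apply: (regular_ro (B := memR x y)) => p pp; apply: (force_mem pp hs e ix jy).
case: H => [[m [i [mk [il e]]]]|H].
  have [x ix] := nseq_mem (s := s) erefl il.
  by apply: (regular_ro (B := predR (G m) x)) => p pp; apply: (force_pred pp hs mk e ix).
case: H => [[f [g [e [[hf1 rf] [hg rg]]]]]|H].
  apply: (regular_ro (B := andR (ro_of (rf a sa na)) (ro_of (rg a sa na)))) => p pp.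
  exact: (force_and pp hs e).
case: H => [[f [e [hf1 rf]]]|[f [e [hf1 rf]]]].
  apply: (regular_ro (B := notR (ro_of (rf a sa na)))) => p pp.
  exact: (force_not pp hs e).
have rx x : regular (fun p => rel3 F p f (consS x s)).
  apply: (rf (consS x s) (sv_seq (consS x s))) => i u; exact: sv_name.
apply: (regular_ro (B := allR (fun x => ro_of (rx x)))) => p pp.
exact: (force_all pp hs e).
Qed.

Lemma force_subst c s s' p : P p -> isform k c (slen s) -> slen s = slen s' ->
  (forall i x y, mem (op i x) s -> mem (op i y) s' -> eqR x y p) ->
  rel3 F p c s -> rel3 F p c s'.
Proof.
suff H : forall c n, isform k c n -> forall a b p, P p -> isseq a n -> isseq b n ->
    (forall i u, mem (@op M hM i u) a -> is_name P u) ->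
    (forall i u, mem (@op M hM i u) b -> is_name P u) ->
    (forall i u v, mem (@op M hM i u) a -> mem (@op M hM i v) b -> af_eq S p u v) ->
    rel3 F p c a -> rel3 F p c b.
  move=> pp h e he; have sb := sv_seq s'; rewrite -e in sb.
  apply: (H _ _ h _ _ _ pp (sv_seq s) sb); [exact: sv_name|exact: sv_name|].
  move=> i u v iu iv; have [x ex] := nseq_name iu; have [y ey] := nseq_name iv; subst u v.
  exact: he iu iv.
have dE := af_def S.
move=> {c s s' p}; apply: form_ind_def; first by dfn_tac.
move=> c n st a b p pp sa sb na nb hab.
have hf : isform k c n by apply: form_intro; apply: fstep_mono st => ? ? [].
pose s := @NameSeq _ _ S a n sa na; pose s' := @NameSeq _ _ S b n sb nb.
have hs : isform k c (slen s) by [].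
have hs' : isform k c (slen s') by [].
have eab i x y : mem (op i x) a -> mem (op i y) b -> eqR x y p by apply: hab.
have [nn H] := st; case: H => [[i [j [il [jl e]]]]|H].
  have [x ix] := nseq_mem (s := s) erefl il; have [y jy] := nseq_mem (s := s) erefl jl.
  have [x' ix'] := nseq_mem (s := s') erefl il; have [y' jy'] := nseq_mem (s := s') erefl jl.
  move=> /(force_eq pp hs e ix jy) h; apply/(force_eq pp hs' e ix' jy').
  have e1 := eab _ _ _ ix ix'; have e2 := eab _ _ _ jy jy'.
  exact: (eq_trans pp (eq_sym pp e1) (eq_trans pp h e2)).
case: H => [[i [j [il [jl e]]]]|H].
  have [x ix] := nseq_mem (s := s) erefl il; have [y jy] := nseq_mem (s := s) erefl jl.
  have [x' ix'] := nseq_mem (s := s') erefl il; have [y' jy'] := nseq_mem (s := s') erefl jl.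
  move=> /(force_mem pp hs e ix jy) h; apply/(force_mem pp hs' e ix' jy').
  have e1 := eab _ _ _ ix ix'; have e2 := eab _ _ _ jy jy'.
  exact: (mem_congr_r pp e2 (mem_congr_l pp e1 h)).
case: H => [[m [i [mk [il e]]]]|H].
  have [x ix] := nseq_mem (s := s) erefl il; have [x' ix'] := nseq_mem (s := s') erefl il.
  move=> /(force_pred pp hs mk e ix) h; apply/(force_pred pp hs' mk e ix').
  apply: (predR_congr _ pp (eab _ _ _ ix ix') h).
  by move=> u r; apply: name_class; apply: hG.
case: H => [[f [g [e [[hf1 rf] [hg rg]]]]]|H].
  move=> /(force_and pp hs e)[h1 h2]; apply/(force_and pp hs' e); split.
    exact: (rf a b p pp).
  exact: (rg a b p pp).
case: H => [[f [e [hf1 rf]]]|[f [e [hf1 rf]]]].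
  move=> /(force_not pp hs e) h; apply/(force_not pp hs' e) => q qp hq; apply: (h q qp).
  apply: (rf b a q (le_l qp)) hq => // i u v iu iv.
  have nu := nb _ _ iu; have nv' := na _ _ iv.
  apply: (@eq_sym _ _ S (Name nv') (Name nu) q (le_l qp)).
  exact: (@aeq_mono _ _ S p q (Name nv') (Name nu) qp (hab _ _ _ iv iu)).
move=> /(force_all pp hs e) h; apply/(force_all pp hs' e) => x.
apply: (rf _ _ p pp (sv_seq (consS x s)) (sv_seq (consS x s'))) (h x).
- by move=> i u; apply: sv_name.
- by move=> i u; apply: sv_name.
move=> i u v /mem_cons[/op_inj[-> ->]|[j [w [/op_inj[-> ->] ju]]]].
  by move/at_cons0 ->; apply: eq_refl.
by move/at_consS; apply: hab.
Qed.

Definition truth_name z := exists p c a, z = op (nop one (chk one c) (sq one a)) p /\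
  P p /\ sentence P k c a /\ rel3 F p c a.

Lemma truth_name_class : class_name P truth_name.
Proof.
split.
  have ds := def_sentence S k; have dE := af_def S.
  by apply: cls_dfn; rewrite /truth_name; dfn_tac.
move=> z [p [c [a [-> [pp [/sentenceE[s [-> f]] h]]]]]].
exists (nv (opN (chkN c) (sqN s))), p; split; first exact/is_pairE.
by split=> //; apply: nvP.
Qed.

Variable G' : nat -> M -> Prop.
Hypothesis GG' : forall n, n < k -> G' n = G n.
Hypothesis GT : G' k = truth_name.

Lemma holds_force c s p : P p -> isform k c (slen s) -> holds (k := k) (G := G') c s p <-> rel3 F p c s.
Proof.
move=> pp f; have [Fmono Fdense] := force_regular f; rewrite /holds GT; split=> h.
  apply: Fdense => // q qp; have [r [rq [u [t [[p' [c' [a' [/op_inj[eu <-] [pt [sc hF]]]]]] [rt e]]]]]] := h q qp.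
  exists r; split=> //; have pr := le_l rq.
  move: sc hF eu => /sentenceE[s' [-> f']] hF eu; subst u.
  have [e1 e2] := @opN_inj _ _ S (chkN c) (sqN s) (chkN c') (sqN s') r pr e.
  have ec := chk_inj pr e1; subst c'.
  have [Fmono' _] := force_regular f'.
  apply: (force_subst pr f' (esym (sq_inj_len pr e2)) _ (Fmono' _ _ rt hF)) => i x y ix iy.
  exact: sq_inj_val pr (eq_sym pr e2) ix iy.
apply: dense_intro => // q qp; have pq := le_l qp.
exists (nv (opN (chkN c) (sqN s))), q; split.
  exists q, c, s; split=> //; split=> //; split; first exact: sent.
  exact: Fmono qp h.
by split; [apply: le_refl|apply: (eq_refl (opN (chkN c) (sqN s)))].
Qed.

Lemma truth_clauses_of_forcing : truth_clauses (S := S) (k := k) (G := G').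
Proof.
split.
- by move=> c s i j x y p pp h e ix jy; rewrite holds_force // (force_eq pp h e ix jy).
- by move=> c s i j x y p pp h e ix jy; rewrite holds_force // (force_mem pp h e ix jy).
- by move=> c s n i x p pp h nk e ix; rewrite holds_force // (force_pred pp h nk e ix) GG'.
- move=> c s f g p pp h e; have h' := h; rewrite e in h'; move/form_and: h' => [hf hg].
  by rewrite !holds_force // (force_and pp h e).
- move=> c s f p pp h e; have h' := h; rewrite e in h'; move/form_not: h' => hf.
  rewrite holds_force // (force_not pp h e); split=> h1 q qp h2; apply: (h1 q qp).
    by apply/holds_force => //; apply: le_l qp.
  by apply/holds_force => //; apply: le_l qp.
- move=> c s f p pp h e; have h' := h; rewrite e in h'; move/form_all: h' => [_ hf].
  by rewrite holds_force // (force_all pp h e); split=> h1 x; move: (h1 x); rewrite (holds_force (s := consS x s)).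
Qed.

End ToTruth.

(** * Forcing relations for standard formulas *)

Fixpoint subs (f : fm) : seq fm :=
  f :: match f with
       | FAnd g h => subs g ++ subs h
       | FNot g => subs g
       | FAll g => subs g
       | _ => [::]
       end.

Lemma subs_refl f : List.In f (subs f).
Proof. by case: f => *; left. Qed.

Lemma subs_trans f g h : List.In g (subs f) -> List.In h (subs g) -> List.In h (subs f).
Proof.
elim: f => [i j|i j|n i|f1 IH1 f2 IH2|f1 IH|f1 IH] /=.
- by move=> [<-|[]].
- by move=> [<-|[]].
- by move=> [<-|[]].
- move=> [<-|/List.in_app_iff[/IH1 H1|/IH2 H2]] // hh; right; apply/List.in_app_iff.
    by left; apply: H1.
  by right; apply: H2.
- by move=> [<-|/IH H] // hh; right; apply: H.
- by move=> [<-|/IH H] // hh; right; apply: H.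
Qed.

Section Standard.
Context {M : class_structure} {hM : GBC M} {S : atomic_forcing hM}.
Variables (k : nat) (G : nat -> M -> Prop) (f0 : fm).
Local Notation mem := (@cs_mem M).
Local Notation P := (af_P S).
Local Notation Le := (af_Le S).
Local Notation le := (rel2 Le).
Local Notation one := (af_one S).
Local Notation aeq := (af_eq S).
Local Notation name := (name S).
Hypothesis hG : forall n, class_name P (G n).
Hypothesis wf0 : wf k 0 f0.
Implicit Types (p q r c a b u v : M) (x y : name) (s : name_sequence S) (f g h : fm).

Let hP : class_forcing_notion P Le one := af_notion S.
Let cP : cs_class P := cf_class hP.
Let cLe : cs_class Le := cf_le_class hP.
Let dE : def3 aeq := af_def S.
Let cG n : cs_class (G n). Proof. by case: (hG n). Qed.

Let pred_at n p u := dense_below Le p (fun q => exists v r, G n (op v r) /\ le q r /\ aeq q u v).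

Let def_pred_at n : def2 (pred_at n).
Proof. by have cGn := cG n; rewrite /pred_at /dense_below; dfn_tac. Qed.

Let def_amem : def3 (amem Le aeq).
Proof. by rewrite /amem /dense_below; dfn_tac. Qed.

Fixpoint frcA f p a : Prop :=
  match f with
  | FEq i j => exists u v, mem (op (num i) u) a /\ mem (op (num j) v) a /\ aeq p u v
  | FMem i j => exists u v, mem (op (num i) u) a /\ mem (op (num j) v) a /\ amem Le aeq p u v
  | FPred n i => n < k /\ exists u, mem (op (num i) u) a /\ pred_at n p u
  | FAnd g h => frcA g p a /\ frcA h p a
  | FNot g => forall q, le q p -> ~ frcA g q a
  | FAll g => forall u, is_name P u -> frcA g p (cons u a)
  end.

Lemma def_frcA f : def2 (frcA f).
Proof. by elim: f => [i j|i j|n i|g IHg h IHh|g IH|g IH] /=; dfn_tac. Qed.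

Definition atomic_code c := (exists i j, c = node 0 i j \/ c = node 1 i j) \/
  exists (n : nat) i, n < k /\ c = node 2 (num n) i.

Fixpoint is_code (l : seq fm) c : Prop :=
  if l is f :: l' then c = code f \/ is_code l' c else False.

Fixpoint coded_force (l : seq fm) p c a : Prop :=
  if l is f :: l' then (c = code f /\ frcA f p a) \/ coded_force l' p c a else False.

Lemma is_codeE l c : is_code l c <-> exists f, List.In f l /\ c = code f.
Proof.
elim: l => [|g l IH] /=; first by split=> // -[f []].
rewrite IH; split=> [[->|[f [fl ->]]]|[f [[<-|fl] ->]]].
- by exists g; split=> //; left.
- by exists f; split=> //; right.
- by left.
- by right; exists f.
Qed.

Lemma coded_forceE l p c a : coded_force l p c a <->
  exists f, List.In f l /\ c = code f /\ frcA f p a.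
Proof.
elim: l => [|g l IH] /=; first by split=> // -[f []].
rewrite IH; split=> [[[-> h]|[f [fl [-> h]]]]|[f [[<-|fl] [-> h]]]].
- by exists g; split=> //; left.
- by exists f; split=> //; right.
- by left.
- by right; exists f.
Qed.

Definition atom_pred c p a := exists (n : nat) i u, n < k /\ c = node 2 (num n) i /\
  mem (op i u) a /\ pred_at n p u.

Lemma dfn_lt (B : nat -> (nat -> M) -> Prop) m : (forall n, dfn (B n)) ->
  dfn (fun r : nat -> M => exists n : nat, n < m /\ B n r).
Proof.
move=> hB; apply: (dfn_ext (A := fun r : nat -> M => @any_below (sets M) m (fun n => B n r))).
  by move=> r /=; rewrite any_belowE.
exact: dfn_any_below.
Qed.

Let def_atomic : def1 atomic_code.
Proof.
apply: (dfn_ext (A := fun r : nat -> M => (exists i j, r 0 = node 0 i j \/ r 0 = node 1 i j) \/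
    exists n : nat, n < k /\ exists i, r 0 = node 2 (num n) i)).
  move=> r; rewrite /atomic_code; split=> -[h|[n h]]; [by left| |by left|].
    by right; case: h => nk [i e]; exists n, i.
  by right; case: h => i [nk e]; exists n; split=> //; exists i.
apply: dfn_or; first by dfn_tac.
by apply: dfn_lt => n; dfn_tac.
Qed.

Let def_atom_pred : def3 atom_pred.
Proof.
apply: (dfn_ext (A := fun r : nat -> M => exists n : nat, n < k /\ exists i u,
   r 0 = node 2 (num n) i /\ mem (op i u) (r 2) /\ pred_at n (r 1) u)).
  move=> r; rewrite /atom_pred; split.
    by move=> [n [nk [i [u h]]]]; exists n, i, u.
  by move=> [n [i [u [nk h]]]]; exists n; split=> //; exists i, u.
by apply: dfn_lt => n; have dn := def_pred_at n; dfn_tac.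
Qed.

Let def_is_code l : def1 (is_code l).
Proof. by elim: l => [|f l IH] /=; dfn_tac. Qed.

Let def_coded_force l : def3 (coded_force l).
Proof. by elim: l => [|f l IH] /=; [|have df := def_frcA f]; dfn_tac. Qed.

Definition std_sentence z := exists c a, z = op c a /\ sentence P k c a /\
  (atomic_code c \/ is_code (subs f0) c).

Definition std_force z := exists p c a, z = op p (op c a) /\ P p /\
  ((exists i j u v, c = node 0 i j /\ mem (op i u) a /\ mem (op j v) a /\ aeq p u v) \/
   (exists i j u v, c = node 1 i j /\ mem (op i u) a /\ mem (op j v) a /\ amem Le aeq p u v) \/
   atom_pred c p a \/ coded_force (subs f0) p c a).

Lemma std_sentence_class : cs_class std_sentence.
Proof.
have ds := def_sentence S k; have dc := def_is_code (subs f0).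
by apply: cls_dfn; rewrite /std_sentence; dfn_tac.
Qed.

Lemma std_force_class : cs_class std_force.
Proof.
have dc := def_coded_force (subs f0).
by apply: cls_dfn; rewrite /std_force; dfn_tac.
Qed.

Lemma std_sentenceE c a : rel2 std_sentence c a <-> sentence P k c a /\
  (atomic_code c \/ is_code (subs f0) c).
Proof.
rewrite rel2E; split=> [[c' [a' [/op_inj[<- <-]]]]|h] //.
by exists c, a.
Qed.

Lemma std_forceE p c a : P p -> rel3 std_force p c a <->
  ((exists i j u v, c = node 0 i j /\ mem (op i u) a /\ mem (op j v) a /\ aeq p u v) \/
   (exists i j u v, c = node 1 i j /\ mem (op i u) a /\ mem (op j v) a /\ amem Le aeq p u v) \/
   atom_pred c p a \/ coded_force (subs f0) p c a).
Proof.
move=> pp; rewrite rel3E; split=> [[p' [c' [a' [/op_inj[<- /op_inj[<- <-]] [_]]]]]|h] //.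
by exists p, c, a.
Qed.

Lemma std_code g p a : P p -> List.In g (subs f0) -> rel3 std_force p (code g) a <-> frcA g p a.
Proof.
move=> pp gs; rewrite std_forceE //; split; last first.
  by move=> h; do 3 right; apply/coded_forceE; exists g.
case=> [[i [j [u [v [e h]]]]]|].
  case: g gs e => [i' j'|i' j'|n' i'|g1 g2|g1|g1] gs /node_inj[] // _ ei ej.
  by exists u, v; rewrite ei ej.
case=> [[i [j [u [v [e h]]]]]|].
  case: g gs e => [i' j'|i' j'|n' i'|g1 g2|g1|g1] gs /node_inj[] // _ ei ej.
  by exists u, v; rewrite ei ej.
case=> [[n [i [u [nk [e h]]]]]|].
  case: g gs e => [i' j'|i' j'|n' i'|g1 g2|g1|g1] gs /node_inj[] // _ /num_inj en ei.
  by rewrite /= en ei; split=> //; exists u.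
by move=> /coded_forceE[f [_ [/code_inj <-]]].
Qed.

Lemma std_eq p i j s x y : P p -> mem (op i x) s -> mem (op j y) s ->
  rel3 std_force p (node 0 i j) s <-> aeq p x y.
Proof.
move=> pp ix jy; rewrite std_forceE //; split; last by move=> h; left; exists i, j, x, y.
case=> [[i' [j' [u [v [/node_inj[_ <- <-] [iu [jv]]]]]]]|].
  by rewrite (seq_fun (sv_seq s) ix iu) (seq_fun (sv_seq s) jy jv).
case=> [[? [? [? [? [/node_inj[]]]]]]|] //.
case=> [[? [? [? [_ [/node_inj[]]]]]]|] //.
move=> /coded_forceE[[i' j'|i' j'|n' i'|g1 g2|g1|g1] [_ [/node_inj[] // _ ei ej]]] /=.
move=> [u [v [iu [jv]]]]; rewrite -ei in iu; rewrite -ej in jv.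
by rewrite (seq_fun (sv_seq s) ix iu) (seq_fun (sv_seq s) jy jv).
Qed.

Lemma std_mem p i j s x y : P p -> mem (op i x) s -> mem (op j y) s ->
  rel3 std_force p (node 1 i j) s <-> amem Le aeq p x y.
Proof.
move=> pp ix jy; rewrite std_forceE //; split; last by move=> h; right; left; exists i, j, x, y.
case=> [[? [? [? [? [/node_inj[]]]]]]|] //.
case=> [[i' [j' [u [v [/node_inj[_ <- <-] [iu [jv]]]]]]]|].
  by rewrite (seq_fun (sv_seq s) ix iu) (seq_fun (sv_seq s) jy jv).
case=> [[? [? [? [_ [/node_inj[]]]]]]|] //.
move=> /coded_forceE[[i' j'|i' j'|n' i'|g1 g2|g1|g1] [_ [/node_inj[] // _ ei ej]]] /=.
move=> [u [v [iu [jv]]]]; rewrite -ei in iu; rewrite -ej in jv.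
by rewrite (seq_fun (sv_seq s) ix iu) (seq_fun (sv_seq s) jy jv).
Qed.

Lemma std_pred p (n : nat) i s x : P p -> n < k -> mem (op i x) s ->
  rel3 std_force p (node 2 (num n) i) s <-> pred_at n p x.
Proof.
move=> pp nk ix; rewrite std_forceE //; split; last first.
  by move=> h; do 2 right; left; exists n, i, x.
case=> [[? [? [? [? [/node_inj[]]]]]]|] //.
case=> [[? [? [? [? [/node_inj[]]]]]]|] //.
case=> [[n' [i' [u [_ [/node_inj[_ /num_inj <- <-] [iu]]]]]]|].
  by rewrite (seq_fun (sv_seq s) ix iu).
move=> /coded_forceE[[i' j'|i' j'|n' i'|g1 g2|g1|g1] [_ [/node_inj[] // _ en ei]]] /=.
move=> [_ [u [iu]]]; rewrite -ei in iu; move/num_inj: en => <-.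
by rewrite (seq_fun (sv_seq s) ix iu).
Qed.

Lemma std_forces_eq q x y : P q -> forces_eq std_force q x y <-> aeq q x y.
Proof.
move=> pq; rewrite /forces_eq forcesE.
apply: (std_eq (s := consS x (consS y (empS S))) (i := num 0) (j := num 1)) => //.
  exact/at_cons0.
exact/at_consS/at_cons0.
Qed.

Lemma std_forces_mem q x y : P q -> forces_mem std_force q x y <-> amem Le aeq q x y.
Proof.
move=> pq; rewrite /forces_mem forcesE.
apply: (std_mem (s := consS x (consS y (empS S))) (i := num 0) (j := num 1)) => //.
  exact/at_cons0.
exact/at_consS/at_cons0.
Qed.

Lemma std_forces_sub p x y : P p -> asub Le aeq p x y <-> forces_sub Le std_force p x y.
Proof.
move=> pp; split=> h u r q' ur q'p q'r.
  have {}ur : mem (op u r) x by exact: (proj1 (rel2E (fun z => mem z x) u r) ur).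
  have [q [qq hq]] := h u r q' ur q'p q'r; exists q; split=> //.
  have [nu _] := name_dom (nvP x) ur.
  by apply/(std_forces_mem (Name nu) y (le_l qq)).
have [nu _] := name_dom (nvP x) ur.
have [q [qq hq]] := h u r q' (proj2 (rel2E (fun z => mem z x) _ _) ur) q'p q'r; exists q; split=> //.
by apply/(std_forces_mem (Name nu) y (le_l qq)).
Qed.

Lemma std_dense (R : M -> Prop) p x : (forall u r, R (op u r) -> is_name P u) ->
  predR R x p <-> dense_below Le p (fun q => exists u r, rel2 R u r /\ le q r /\ forces_eq std_force q x u).
Proof.
move=> hR; apply: (dense_ext hP) => q qp; have pq := le_l qp.
split=> -[u [r [ur [qr e]]]]; exists u, r.
  split; first exact/rel2E.
  by split=> //; apply/(std_forces_eq x (Name (hR _ _ ur))).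
have {}ur : R (op u r) by apply/rel2E.
by split=> //; split=> //; apply/(std_forces_eq x (Name (hR _ _ ur))).
Qed.

Lemma std_node (t : nat) a b : 2 < t -> atomic_code (node t a b) -> False.
Proof.
by move=> t2 [[i [j [/node_inj[e]|/node_inj[e]]]]|[n [i [_ /node_inj[e]]]]]; rewrite e in t2.
Qed.

Lemma std_forcing : forcing_relation_on P Le k G (rel2 std_sentence) std_force.
Proof.
have getn s i u : mem (op i u) s -> exists x, u = x by apply: nseq_name.
have hcode (t : nat) a b c d : 2 < t -> rel2 std_sentence c d -> c = node t a b ->
    sentence P k c d /\ exists h, List.In h (subs f0) /\ node t a b = code h.
  by move=> t2 /std_sentenceE[sc [ac|/is_codeE hc]] e; [rewrite e in ac; case: (std_node t2 ac)|
    rewrite -e].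
have sub (h g : fm) : List.In h (subs f0) -> List.In g (subs h) -> is_code (subs f0) (code g).
  by move=> h1 h2; apply/is_codeE; exists g; split=> //; apply: subs_trans h2.
split.
- by move=> c a /std_sentenceE[].
- move=> c a sc h; apply/std_sentenceE; split=> //; left; case: h.
    by move=> [i [j [/is_nodeE|/is_nodeE] e]]; left; exists i, j; auto.
  by move=> [n [i [nk /c_predE e]]]; right; exists n, i.
- move=> c f g a Dc /is_nodeE e; have [sc [h [hs eh]]] := hcode 3 _ _ _ _ isT Dc e.
  have [s1 s2] := sentence_and sc e.
  case: h hs eh => [i' j'|i' j'|n' i'|g1 g2|g1|g1] hs /node_inj[] // _ e1 e2.
  split; apply/std_sentenceE; split=> //; right; rewrite ?e1 ?e2; apply: (sub _ _ hs).
    by right; apply/List.in_app_iff; left; apply: subs_refl.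
  by right; apply/List.in_app_iff; right; apply: subs_refl.
- move=> c f a Dc /is_nodeE e; have [sc [h [hs eh]]] := hcode 4 _ _ _ _ isT Dc e.
  have s1 := sentence_not sc e.
  case: h hs eh => [i' j'|i' j'|n' i'|g1 g2|g1|g1] hs /node_inj[] // _ e1 _.
  apply/std_sentenceE; split=> //; right; rewrite e1; apply: (sub _ _ hs).
  by right; apply: subs_refl.
- move=> c f a x a' Dc /is_nodeE e nx hc; have [sc [h [hs eh]]] := hcode 5 _ _ _ _ isT Dc e.
  have [s1 _] := sentence_all sc e nx hc.
  case: h hs eh => [i' j'|i' j'|n' i'|g1 g2|g1|g1] hs /node_inj[] // _ e1 _.
  apply/std_sentenceE; split=> //; right; rewrite e1; apply: (sub _ _ hs).
  by right; apply: subs_refl.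
- move=> c a i j u v /std_sentenceE[/sentenceE[s [-> f]] _] /is_nodeE -> /at_E iu /at_E jv p pp.
  have [x eu] := getn _ _ _ iu; have [y ev] := getn _ _ _ jv; subst u v.
  rewrite (std_mem pp iu jv); apply: (std_dense (R := fun z => mem z y)).
  by move=> u r /(name_dom (nvP y))[].
- move=> c a i j u v /std_sentenceE[/sentenceE[s [-> f]] _] /is_nodeE -> /at_E iu /at_E jv p pp.
  have [x eu] := getn _ _ _ iu; have [y ev] := getn _ _ _ jv; subst u v.
  by rewrite (std_eq pp iu jv) -!std_forces_sub // -eqE.
- move=> c a n i u /std_sentenceE[/sentenceE[s [-> f]] _] nk /c_predE -> /at_E iu p pp.
  have [x eu] := getn _ _ _ iu; subst u.
  rewrite (std_pred pp nk iu); apply: std_dense.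
  by move=> u r; apply: name_class; apply: hG.
- move=> c f g a Dc /is_nodeE e p pp; have [sc [h [hs eh]]] := hcode 3 _ _ _ _ isT Dc e.
  case: h hs eh => [i' j'|i' j'|n' i'|g1 g2|g1|g1] hs eh; have := eh => /node_inj[] // _ e1 e2.
  rewrite e eh e1 e2 !std_code //.
    by apply: subs_trans hs _; right; apply/List.in_app_iff; right; apply: subs_refl.
  by apply: subs_trans hs _; right; apply/List.in_app_iff; left; apply: subs_refl.
- move=> c f a Dc /is_nodeE e p pp; have [sc [h [hs eh]]] := hcode 4 _ _ _ _ isT Dc e.
  case: h hs eh => [i' j'|i' j'|n' i'|g1 g2|g1|g1] hs eh; have := eh => /node_inj[] // _ e1 _.
  have gs : List.In g1 (subs f0) by apply: subs_trans hs _; right; apply: subs_refl.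
  rewrite e eh e1 std_code //; split=> [h1 [q [qp /(std_code _ (le_l qp) gs)]]|h1 q qp h2].
    exact: h1.
  by apply: h1; exists q; split=> //; apply/(std_code _ (le_l qp) gs).
- move=> c f a Dc /is_nodeE e p pp; have [sc [h [hs eh]]] := hcode 5 _ _ _ _ isT Dc e.
  case: h hs eh => [i' j'|i' j'|n' i'|g1 g2|g1|g1] hs eh; have := eh => /node_inj[] // _ e1 _.
  have gs : List.In g1 (subs f0) by apply: subs_trans hs _; right; apply: subs_refl.
  move: sc => /sentenceE[s [ea _]]; subst a.
  rewrite e eh e1 std_code //; split=> [h1 u a' nu /(is_consE _ _ (sv_seq s)) ->|h1 u nu].
    by apply/std_code => //; apply: h1.
  apply/(std_code _ pp gs); apply: (h1 u) => //.
  exact/(is_consE _ _ (sv_seq s)).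
Qed.

Lemma std_forcing_for : forcing_relation_for P Le k G f0 std_force.
Proof.
split; first exact: std_force_class.
exists std_sentence; split; first exact: std_sentence_class.
split; first exact: std_forcing.
exists (code f0), emp; split; first exact/codesE.
split; first exact/is_listE.
apply/std_sentenceE; split; first by apply/sentenceE; exists (empS S); split=> //;
  exact: (form_code (n := 0) wf0).
by right; apply/is_codeE; exists f0; split=> //; apply: subs_refl.
Qed.

End Standard.

Section TruthWellFormed.
Variable k : nat.
Let W (d : nat) (f : fo syn) := wf k.+1 d (f d).

Let W_and d f g : W d f -> W d g -> W d (l_and f g).
Proof. by rewrite /W /= => -> ->. Qed.

Let W_or d f g : W d f -> W d g -> W d (l_or f g).
Proof. by rewrite /W /= => -> ->. Qed.

Let W_imp d f g : W d f -> W d g -> W d (l_imp f g).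
Proof. by rewrite /W /= => -> ->. Qed.

Let W_iff d f g : W d f -> W d g -> W d (l_iff f g).
Proof. by rewrite /W /= => -> ->. Qed.

Let W_all d (f : tm syn -> fo syn) : W d.+1 (f d) -> W d (l_all f).
Proof. by []. Qed.

Let W_ex d (f : tm syn -> fo syn) : W d.+1 (f d) -> W d (l_ex f).
Proof. by []. Qed.

Let W_not d f : W d f -> W d (l_not f).
Proof. by []. Qed.

Let lt_atom (d l : nat) : l < d -> d - l.+1 < d.
Proof. by move=> ld; rewrite ltn_subrL /=; apply: leq_ltn_trans ld. Qed.

Let W_eq d (l m : tm syn) : l < d -> m < d -> W d (l_eq l m).
Proof. by move=> h1 h2; rewrite /W /= !lt_atom. Qed.

Let W_mem d (l m : tm syn) : l < d -> m < d -> W d (l_mem l m).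
Proof. by move=> h1 h2; rewrite /W /= !lt_atom. Qed.

Let W_pred d p (l : tm syn) : p <= k -> l < d -> W d (@l_pred syn p l).
Proof. by move=> h1 h2; rewrite /W /= ltnS h1 lt_atom. Qed.

Ltac w_step := lazymatch goal with
  | |- is_true (W _ (l_and _ _)) => apply: W_and
  | |- is_true (W _ (l_or _ _)) => apply: W_or
  | |- is_true (W _ (l_imp _ _)) => apply: W_imp
  | |- is_true (W _ (l_iff _ _)) => apply: W_iff
  | |- is_true (W _ (l_not _)) => apply: W_not
  | |- is_true (W _ (l_all _)) => apply: W_all
  | |- is_true (W _ (l_ex _)) => apply: W_ex
  | |- is_true (W _ (l_eq _ _)) => apply: W_eq
  | |- is_true (W _ (l_mem _ _)) => apply: W_mem
  end.
Ltac w_tac := cbv beta; repeat w_step.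

Let W_num d n (l : tm syn) : l < d -> W d (@is_num syn n l).
Proof.
elim: n d l => [|n IH] d l h; cbn [is_num].
  by rewrite /is_empty; w_tac => //; apply: ltnW.
apply: W_ex; apply: W_and; first exact: IH.
by rewrite /is_succ; w_tac => //; do 2?apply: ltnW.
Qed.

Let W_any d n A : (forall i, i < n -> W d (A i)) -> W d (@any_below syn n A).
Proof.
elim: n => [|n IH] h; cbn [any_below]; first by w_tac.
by apply: W_or; [apply: IH => i ni; apply: h; apply: ltnW|apply: h].
Qed.

Let W_allb d n A : (forall i, i < n -> W d (A i)) -> W d (@all_below syn n A).
Proof.
elim: n => [|n IH] h; cbn [all_below]; first by w_tac.
by apply: W_and; [apply: IH => i ni; apply: h; apply: ltnW|apply: h].
Qed.

Ltac w_step' := lazymatch goal with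
  | |- is_true (W _ (is_num _ _)) => apply: W_num
  | |- is_true (W _ (any_below _ _)) => apply: W_any => ? ?
  | |- is_true (W _ (all_below _ _)) => apply: W_allb => ? ?
  | |- is_true (W _ (l_pred _ _)) => apply: W_pred
  | |- _ => w_step
  end.

Lemma wf_truth_statement : wf k.+1 0 (truth_statement k).
Proof.
change (W 0 (@truth_predicate syn k)).
rewrite /truth_predicate /is_formula /is_cons /c_eq /c_mem /c_pred /c_and /c_not
  /c_all /is_node /is_seq /at_ /is_nat /zero_or_succ /is_trans /is_subset
  /is_pair /is_upair /is_succ /is_empty.
by cbv beta; repeat w_step'; rewrite // ltnW.
Qed.

End TruthWellFormed.

Theorem theorem9 (M : class_structure) (hM : GBC M)
    (P Le : M -> Prop) (one : M) (hP : class_forcing_notion P Le one)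
    (m : nat) (Gamma : nat -> M -> Prop)
    (hGamma : forall i, i <= m -> class_name P (Gamma i)) :
  admits_uniform_forcing P Le m.+1 Gamma <->
  exists T F : M -> Prop,
    class_name P T /\
    forcing_relation_for P Le m.+2 (add_pred m.+1 Gamma T)
      (truth_statement m.+1) F /\
    forces F one (truth_statement m.+1) [::].
Proof.
have P1 : P one by apply: cf_one hP.
split=> [[F [cF fr]]|[T [F [hT [[cF [D [_ [fr [c [a [/codesE -> [/is_listE -> hD]]]]]]]] h1]]]]].
- pose S : atomic_forcing hM := rel_forcing hP cF fr.
  pose T := truth_name (S := S) m.+1 F.
  have hT : class_name P T by apply: (truth_name_class (S := S)).
  pose G' n := if n < m.+1 then Gamma n else T.
  have hG' n : class_name (af_P S) (G' n).
    by rewrite /G'; case: ifP => // nm; apply: hGamma; rewrite -ltnS.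
  have hG n : n < m.+1 -> class_name (af_P S) (Gamma n) by move=> nm; apply: hGamma.
  have heq p (x y : name S) : af_P S p -> forces_eq F p x y <-> af_eq S p x y by [].
  have GG' n : n < m.+1 -> G' n = Gamma n by move=> nm; rewrite /G' nm.
  have GT : G' m.+1 = T by rewrite /G' ltnn.
  have hGk n : n <= m.+1 -> class_name (af_P S) (G' n) by move=> _; apply: hG'.
  have tc := truth_clauses_of_forcing (S := S) cF fr hG heq GG' GT.
  have htruth : (@truth_predicate (frcL S G') m.+1 : ro S) one.
    apply: (truth_intro (S := S) hGk _ tc) => // u r; rewrite GT => -[p [c [a [/op_inj[-> _] [pp [sc _]]]]]].
    by have [s [-> f]] := proj1 (sentenceE S _ _ _) sc; exists c, s.
  have ffor := @std_forcing_for M hM S m.+2 G' _ hG' (wf_truth_statement m.+1).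
  exists T, (std_force (S := S) m.+2 G' (truth_statement m.+1)); split=> //.
  have Ge n : n < m.+2 -> G' n = add_pred m.+1 Gamma T n.
    rewrite /add_pred ltnS leq_eqVlt => /orP[/eqP ->|nm]; first by rewrite eqxx GT.
    by rewrite (ltn_eqF nm) GG'.
  split.
    case: ffor => [cF' [D [cD [fr' rest]]]]; split=> //; exists D; split=> //.
    by split=> //; apply: forcing_relation_on_ext fr'.
  case: ffor => [_ [D [_ [fr' [c [a [/codesE -> [/is_listE -> hD]]]]]]]].
  apply/forcesE.
  have ag i u : cs_mem (op (num i) u) (lst [::]) -> u = (empN (S := S) : name S) by move/mem_emp.
  apply/(bridge (S := S) fr' (fun n _ => hG' n) _ (rho := fun _ => empN (S := S)) hD ag P1).
    by move=> p x y; apply: (std_forces_eq (S := S)).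
  exact/frc_truth_statement.
- pose S : atomic_forcing hM := rel_forcing hP cF fr.
  pose G := add_pred m.+1 Gamma T.
  have hG n : n <= m.+1 -> class_name (af_P S) (G n).
    rewrite /G /add_pred; case: eqP => // /eqP ne le; apply: hGamma.
    by rewrite -ltnS ltn_neqAle ne.
  have heq p (x y : name S) : af_P S p -> forces_eq F p x y <-> af_eq S p x y by [].
  have htruth : (@truth_predicate (frcL S G) m.+1 : ro S) one.
    apply/(frc_truth_statement _ _ (fun _ => empN (S := S)) P1).
    have ag i u : cs_mem (op (num i) u) (lst [::]) -> u = (empN (S := S) : name S) by move/mem_emp.
    apply/(bridge (S := S) fr (fun n h => hG n h) heq (rho := fun _ => empN (S := S)) hD ag P1).
    exact/forcesE.
  have [F' [cF' fr']] := uniform_of_truth hG (truth_elim hG htruth).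
  exists F'; split=> //; apply: forcing_relation_on_ext fr' => n nm.
  by rewrite /G /add_pred ltn_eqF.
Qed.
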